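(* Let $A$ be a simple unital C*-algebra with bounded commutators generation. Then: (i) $SU_0(A)/Z(SU_0(A))$ is a simple group with local bounded normal generation. (ii) If $SU_0(A)$ is bounded as a metric space, then $SU_0(A)/Z(SU_0(A))$ has bounded normal generation (BNG).
   Context: Let $A$ be a unital C*-algebra. $A_{\mathrm{sa}}$ is the set of selfadjoint elements, $[x,y]=xy-yx$, $[A,A]$ is the linear span of all commutators, and $\overline{[A,A]}$ is its norm closure. $U_0(A)$ is the connected component of the identity in the unitary group of $A$ (norm topology). $Z(G)$ is the center of a group $G$. For $X\subseteq G$, $X^n$ denotes the set of products of $n$ elements of $X$. $A$ has bounded commutators generation if $[A,A]$ is closed and there exist $m\in\mathbb{N}$ and $C>0$ such that every $h\in\overline{[A,A]}$ can be written as $h=\sum_{i=1}^m[x_i,y_i]$ with $x_i,y_i\in A$ and $\|x_i\|\cdot\|y_i\|\le C\|h\|$ for all $i$. $SU_0(A)$ is the subgroup of $U_0(A)$ generated by $\{e^{ih}: h\in\overline{[A,A]}\cap A_{\mathrm{sa}}\}$, endowed with the group topology having as basis of neighborhoods of the identity the sets $\{e^{ih}: h\in\overline{[A,A]}\cap A_{\mathrm{sa}},\ \|h\|<\epsilon\}$, $\epsilon>0$. The exponential length on $SU_0(A)$ is $$\mathrm{el}_{SU_0(A)}(u)=\inf\Big\{\sum_{j=1}^n\|h_j\| : u=\prod_{j=1}^n e^{ih_j},\ h_j\in\overline{[A,A]}\cap A_{\mathrm{sa}}\text{ for all }j\Big\},$$ and $SU_0(A)$ is regarded as a metric space with the bi-invariant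 metric $(u,v)\mapsto \mathrm{el}_{SU_0(A)}(u^*v)$, which induces the group topology on $SU_0(A)$ having as basis of neighborhoods of the identity the sets $\{e^{ih}: h\in\overline{[A,A]}\cap A_{\mathrm{sa}},\ \|h\|<\epsilon\}$, $\epsilon>0$. The quotient $SU_0(A)/Z(SU_0(A))$ carries the quotient topology. A simple group $G$ has bounded normal generation (BNG) if for every $g\in G\setminus\{1\}$ there exists $n\in\mathbb{N}$ such that $G=(\{hg^{\pm1}h^{-1}: h\in G\})^n$. A topological group $G$ has local bounded normal generation if for every $g\in G\setminus\{1\}$ there exists $n\in\mathbb{N}$ such that $(\{hg^{\pm1}h^{-1}: h\in G\})^n$ is a neighborhood of the identity. A group is called simple here if its only normal subgroups are the trivial subgroup and the whole group; the trivial group is allowed (it occurs when $A=\mathbb{C}$). *)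

(* Defs.v *)
From HB Require Import structures.
From mathcomp Require Import all_boot all_order all_algebra.
From mathcomp Require Import all_classical all_reals all_analysis.
From mathcomp Require Import complex.

Set Implicit Arguments.
Unset Strict Implicit.
Unset Printing Implicit Defensive.

Import Order.TTheory GRing.Theory Num.Theory.
Import numFieldNormedType.Exports.

Local Open Scope classical_set_scope.
Local Open Scope ring_scope.
Local Open Scope complex_scope.

HB.structure Definition PreTopologicalGroup := {G of Group G & Topological G}.
Notation preTopologicalGroupType := PreTopologicalGroup.type.

Section Groups.
Local Open Scope group_scope.

Definition subgroup (G : groupType) (H : set G) : Prop :=
  [/\ H 1, (forall x y, H x -> H y -> H (x * y)) & (forall x, H x -> H x^-1)].

Definition normal_subgroup (G : groupType) (N : set G) : Prop :=
  subgroup N /\ forall g x, N x -> N (g * x * g^-1).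

Definition simple_group (G : groupType) : Prop :=
  forall N : set G, normal_subgroup N -> N = [set 1] \/ N = setT.

Definition generated_subgroup (G : groupType) (X : set G) : set G :=
  [set x | forall H : set G, subgroup H -> X `<=` H -> H x].

Lemma generated_subgroupP (G : groupType) (X : set G) :
  subgroup (generated_subgroup X).
Proof.
split=> [H [] //|x y Hx Hy H sH XH|x Hx H sH XH].
  by case: (sH) => _ HM _; apply: HM; [exact: Hx|exact: Hy].
by case: (sH) => _ _ HV; apply: HV; exact: Hx.
Qed.

Definition center (G : groupType) : set G :=
  [set z | forall x : G, z * x = x * z].

Definition setprod_pow (G : groupType) (X : set G) (n : nat) : set G :=
  [set x | exists t : 'I_n -> G, (forall i, X (t i)) /\ x = \prod_(i < n) t i].

Definition conjugates (G : groupType) (g : G) : set G :=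
  [set x | exists h : G, x = h * g * h^-1 \/ x = h * g^-1 * h^-1].

Definition bounded_normal_generation (G : groupType) : Prop :=
  simple_group G /\
  forall g : G, g <> 1 -> exists n : nat, setprod_pow (conjugates g) n = setT.

Definition local_bounded_normal_generation (G : preTopologicalGroupType) : Prop :=
  forall g : G, g <> 1 ->
    exists n : nat, nbhs (1 : G) (setprod_pow (conjugates g) n).

Section CenterQuotient.
Variable G : groupType.

Definition eq_mod_center : rel G := fun x y => `[< center (x^-1 * y) >].

Lemma center_inv (x : G) : center x -> center x^-1.
Proof. by move=> cx w; apply: invg_inj; rewrite !invgM !invgK cx. Qed.

Lemma center_mul (x y : G) : center x -> center y -> center (x * y).
Proof. by move=> cx cy w; rewrite -mulgA cy mulgA (cx w) -mulgA. Qed.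

Lemma eq_mod_center_equiv : equiv_class_of eq_mod_center.
Proof.
split=> [x|x y|y x z].
- by apply/asboolP => w; rewrite mulVg mul1g mulg1.
- have sym (a b : G) : eq_mod_center a b -> eq_mod_center b a.
    by move=> /asboolP/center_inv; rewrite invgM invgK => h; exact/asboolP.
  by apply/idP/idP; exact: sym.
- move=> /asboolP h1 /asboolP h2; apply/asboolP.
  have -> : x^-1 * z = (x^-1 * y) * (y^-1 * z).
    by rewrite -(mulgA x^-1) mulVKg.
  exact: center_mul.
Qed.

Canonical eq_mod_center_equivRel := EquivRelPack eq_mod_center_equiv.

End CenterQuotient.

Local Open Scope quotient_scope.

Definition center_quotient (G : preTopologicalGroupType) :=
  quotient_topology {eq_quot @eq_mod_center G}.

Section CenterQuotientGroup.
Variable G : preTopologicalGroupType.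
Local Notation Q := (center_quotient G).

HB.instance Definition _ := Topological.on Q.
HB.instance Definition _ := Quotient.on Q.

Lemma center_quotient_eqP (x y : G) :
  \pi_Q x = \pi_Q y <-> center (x^-1 * y).
Proof.
split=> [/eqquotP/asboolP //|h]; apply/eqquotP; exact/asboolP.
Qed.

Definition center_quotient_one : Q := \pi_Q 1.
Definition center_quotient_mul (a b : Q) : Q := \pi_Q (repr a * repr b).
Definition center_quotient_inv (a : Q) : Q := \pi_Q ((repr a)^-1).

Fact center_quotient_mulE x y :
  center_quotient_mul (\pi_Q x) (\pi_Q y) = \pi_Q (x * y).
Proof.
apply/center_quotient_eqP.
have /center_quotient_eqP cx : \pi_Q (repr (\pi_Q x)) = \pi_Q x.
  by rewrite reprK.
have /center_quotient_eqP cy : \pi_Q (repr (\pi_Q y)) = \pi_Q y.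
  by rewrite reprK.
set x' := repr _ in cx *; set y' := repr _ in cy *.
have -> : (x' * y')^-1 * (x * y) = (x'^-1 * x) * (y'^-1 * y).
  by rewrite [RHS]mulgA (cx y'^-1) invgM !mulgA.
exact: center_mul.
Qed.

Fact center_quotient_invE x : center_quotient_inv (\pi_Q x) = \pi_Q (x^-1).
Proof.
apply/center_quotient_eqP.
have /center_quotient_eqP cx : \pi_Q (repr (\pi_Q x)) = \pi_Q x.
  by rewrite reprK.
set x' := repr _ in cx *.
have -> : (x'^-1)^-1 * x^-1 = (x'^-1 * x)^-1.
  have e : x = x'^-1 * x * x' by rewrite cx mulVKg.
  by apply: invg_inj; rewrite invgK invgM !invgK {1}e mulgK.
exact: center_inv.
Qed.

Fact center_quotient_mulA : associative center_quotient_mul.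
Proof.
elim/quotW=> x; elim/quotW=> y; elim/quotW=> z.
by rewrite (center_quotient_mulE y z) (center_quotient_mulE x y)
  (center_quotient_mulE x (y * z)) (center_quotient_mulE (x * y) z) mulgA.
Qed.
Fact center_quotient_mul1 : left_id center_quotient_one center_quotient_mul.
Proof. by elim/quotW=> x; rewrite (center_quotient_mulE 1 x) mul1g. Qed.
Fact center_quotient_mulr1 : right_id center_quotient_one center_quotient_mul.
Proof. by elim/quotW=> x; rewrite (center_quotient_mulE x 1) mulg1. Qed.
Fact center_quotient_mulV :
  left_inverse center_quotient_one center_quotient_inv center_quotient_mul.
Proof.
by elim/quotW=> x; rewrite center_quotient_invE (center_quotient_mulE x^-1 x) mulVg.
Qed.
Fact center_quotient_mulrV :
  right_inverse center_quotient_one center_quotient_inv center_quotient_mul.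
Proof.
by elim/quotW=> x; rewrite center_quotient_invE (center_quotient_mulE x x^-1) mulgV.
Qed.

HB.instance Definition _ := isGroup.Build Q
  center_quotient_mulA center_quotient_mul1 center_quotient_mulr1
  center_quotient_mulV center_quotient_mulrV.

Lemma center_quotientM (x y : G) : \pi_Q (x * y) = \pi_Q x * \pi_Q y.
Proof. exact/esym/center_quotient_mulE. Qed.

End CenterQuotientGroup.

End Groups.

(* The library has no common ancestor for rings and normed modules, so the
   product is part of the mixin; [calg A] is A with its algebra structure. *)
HB.mixin Record isCStarAlgebra (R : realType) A
    of CompleteNormedModule R[i] A := {
  cs_one : A;
  cs_mul : A -> A -> A;
  cs_star : A -> A;
  cs_mulA : associative cs_mul;
  cs_mul1 : left_id cs_one cs_mul;
  cs_mulr1 : right_id cs_one cs_mul;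
  cs_mulDl : left_distributive cs_mul +%R;
  cs_mulDr : right_distributive cs_mul +%R;
  cs_one_neq0 : cs_one != 0;
  cs_scaleAl : forall (a : R[i]) (x y : A), a *: cs_mul x y = cs_mul (a *: x) y;
  cs_scaleAr : forall (a : R[i]) (x y : A), a *: cs_mul x y = cs_mul x (a *: y);
  cs_starK : involutive cs_star;
  cs_starD : {morph cs_star : x y / x + y};
  cs_starZ : forall (a : R[i]) (x : A), cs_star (a *: x) = a^* *: cs_star x;
  cs_starM : forall x y : A, cs_star (cs_mul x y) = cs_mul (cs_star y) (cs_star x);
  cs_normM : forall x y : A, `|cs_mul x y| <= `|x| * `|y|;
  cs_norm_star : forall x : A, `|cs_mul (cs_star x) x| = `|x| ^+ 2
}.

#[short(type="cstarAlgType")]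
HB.structure Definition CStarAlgebra (R : realType) :=
  {A of CompleteNormedModule R[i] A & isCStarAlgebra R A}.

Definition calg (R : realType) (A : cstarAlgType R) : Type := A.

Section CAlgInstances.
Variables (R : realType) (A : cstarAlgType R).

HB.instance Definition _ := CompleteNormedModule.on (calg A).
HB.instance Definition _ := GRing.Zmodule_isNzRing.Build (calg A)
  (@cs_mulA R A) (@cs_mul1 R A) (@cs_mulr1 R A)
  (@cs_mulDl R A) (@cs_mulDr R A) (@cs_one_neq0 R A).
HB.instance Definition _ :=
  GRing.Lmodule_isLalgebra.Build R[i] (calg A) (@cs_scaleAl R A).
HB.instance Definition _ :=
  GRing.Lalgebra_isAlgebra.Build R[i] (calg A) (@cs_scaleAr R A).

Definition star (x : calg A) : calg A := cs_star (x : A).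

Lemma starK : involutive star.
Proof. exact: cs_starK. Qed.
Lemma starD : {morph star : x y / x + y}.
Proof. exact: cs_starD. Qed.
Lemma starZ (a : R[i]) (x : calg A) : star (a *: x) = a^* *: star x.
Proof. exact: cs_starZ. Qed.
Lemma starM (x y : calg A) : star (x * y) = star y * star x.
Proof. exact: cs_starM. Qed.
Lemma star1 : star 1 = 1.
Proof. by rewrite -[star 1]mulr1 -[X in _ * X]starK -starM mulr1 starK. Qed.
Lemma calg_normM (x y : calg A) : `|x * y| <= `|x| * `|y|.
Proof. exact: cs_normM. Qed.
Lemma calg_norm_star (x : calg A) : `|star x * x| = `|x| ^+ 2.
Proof. exact: cs_norm_star. Qed.

End CAlgInstances.

Section CStarAlgebras.
Variables (R : realType) (A : cstarAlgType R).
Implicit Types x y h u : calg A.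

(* the norm as an element of R; `|x| is in R[i] *)
Definition rnorm x : R := complex.Re `|x|.

Definition closed_ideal (I : set (calg A)) : Prop :=
  [/\ closed I, I 0, (forall x y, I x -> I y -> I (x + y)),
      (forall (a : R[i]) x, I x -> I (a *: x)) &
      (forall y x, I x -> I (y * x) /\ I (x * y))].

Definition simple_cstar : Prop :=
  forall I : set (calg A), closed_ideal I -> I = [set 0] \/ I = setT.

Definition commutator x y : calg A := x * y - y * x.

Definition commutator_span : set (calg A) :=
  [set h | exists (n : nat) (c : 'I_n -> R[i]) (x y : 'I_n -> calg A),
     h = \sum_(i < n) c i *: commutator (x i) (y i)].

Definition bounded_commutators_generation : Prop :=
  closed commutator_span /\
  exists (m : nat) (C : R), 0 < C /\
    forall h, closure commutator_span h ->
      exists x y : 'I_m -> calg A,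
        h = \sum_(i < m) commutator (x i) (y i) /\
        forall i, rnorm (x i) * rnorm (y i) <= C * rnorm h.

Definition cexp x : calg A :=
  limn (series (fun n => (n`!%:R^-1 : R[i]) *: x ^+ n)).

Definition selfadjoint_comm : set (calg A) :=
  [set h | closure commutator_span h /\ star h = h].

Definition unitary : set (calg A) :=
  [set u | star u * u = 1 /\ u * star u = 1].

(* U(A); it carries the norm topology inherited from A *)
Definition unitary_group : Type := set_type unitary.

End CStarAlgebras.

Section UnitaryGroup.
Variables (R : realType) (A : cstarAlgType R).
Local Notation U := (unitary_group A).

HB.instance Definition _ := SubChoice.on U.
HB.instance Definition _ := Topological.on U.

Lemma unitary1 : unitary (1 : calg A).
Proof. by rewrite /unitary /= star1 mulr1. Qed.

Lemma unitaryM (u v : calg A) : unitary u -> unitary v -> unitary (u * v).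
Proof.
move=> [u1 u2] [v1 v2]; split; rewrite starM.
  by rewrite mulrA -(mulrA (star v)) u1 mulr1.
by rewrite mulrA -(mulrA u) v2 mulr1.
Qed.

Lemma unitaryV (u : calg A) : unitary u -> unitary (star u).
Proof. by move=> [u1 u2]; split; rewrite starK. Qed.

Definition unitary_one : U := SigSub (mem_set unitary1).
Definition unitary_mul (u v : U) : U :=
  SigSub (mem_set (unitaryM (set_mem (valP u)) (set_mem (valP v)))).
Definition unitary_inv (u : U) : U :=
  SigSub (mem_set (unitaryV (set_mem (valP u)))).

Fact unitary_mulA : associative unitary_mul.
Proof. by move=> u v w; apply: val_inj; rewrite /= mulrA. Qed.
Fact unitary_mul1 : left_id unitary_one unitary_mul.
Proof. by move=> u; apply: val_inj; rewrite /= mul1r. Qed.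
Fact unitary_mulr1 : right_id unitary_one unitary_mul.
Proof. by move=> u; apply: val_inj; rewrite /= mulr1. Qed.
Fact unitary_mulV : left_inverse unitary_one unitary_inv unitary_mul.
Proof. by move=> u; apply: val_inj; case: (set_mem (valP u)). Qed.
Fact unitary_mulrV : right_inverse unitary_one unitary_inv unitary_mul.
Proof. by move=> u; apply: val_inj; case: (set_mem (valP u)). Qed.

HB.instance Definition _ := isGroup.Build U
  unitary_mulA unitary_mul1 unitary_mulr1 unitary_mulV unitary_mulrV.

Definition U0 : set U := connected_component [set: U] (1 : U)%g.

End UnitaryGroup.

Section SU0.
Variables (R : realType) (A : cstarAlgType R).
Local Notation U := (unitary_group A).

(* The e^{ih}, taken as elements of U_0(A); each lies there, on the path
   t |-> e^{ith}. *)
Definition SU0_generators : set U :=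
  [set u | U0 u /\
     exists2 h : calg A, selfadjoint_comm h & val u = cexp ('i *: h)].

Definition SU0 : set U := generated_subgroup SU0_generators.

Record SU0_group : Type := SU0Elem { SU0_val : U; _ : SU0_val \in SU0 }.

HB.instance Definition _ := [isSub for SU0_val].
HB.instance Definition _ := [Choice of SU0_group by <:].

Fact SU0_closed : group_closed [in SU0].
Proof.
have [S1 SM SV] := generated_subgroupP SU0_generators.
split; first exact: mem_set.
move=> u v /set_mem Su /set_mem Sv; apply: mem_set.
exact: SM Su (SV _ Sv).
Qed.

HB.instance Definition _ :=
  SubChoice_isSubGroup.Build U [in SU0] SU0_group SU0_closed.

Definition SU0_to_alg (u : SU0_group) : calg A := val (SU0_val u).

Definition SU0_nbhs1 (eps : R) : set SU0_group :=
  [set v | exists h : calg A,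
     [/\ selfadjoint_comm h, rnorm h < eps & SU0_to_alg v = cexp ('i *: h)]].

(* Open sets of the group topology having the sets SU0_nbhs1 eps, 0 < eps, as
   a basis of neighborhoods of 1: W is a neighborhood of each of its points,
   the left translates u * SU0_nbhs1 eps being a basis at u. *)
Definition SU0_open (W : set SU0_group) : Prop :=
  forall u, W u -> exists2 eps : R, 0 < eps &
    forall v, SU0_nbhs1 eps v -> W (u * v)%g.

Fact SU0_openT : SU0_open setT.
Proof. by move=> u _; exists 1. Qed.

Fact SU0_openI : setI_closed SU0_open.
Proof.
move=> V W oV oW u [Vu Wu].
have [e e0 eV] := oV _ Vu; have [f f0 fW] := oW _ Wu.
exists (Num.min e f); first by rewrite lt_min e0 f0.
by move=> v [h [hc + vE]]; rewrite lt_min => /andP[he hf]; split;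
  [apply: eV|apply: fW]; exists h.
Qed.

Fact SU0_open_bigU (I : Type) (f : I -> set SU0_group) :
  (forall i, SU0_open (f i)) -> SU0_open (\bigcup_i f i).
Proof.
move=> of_ u [i _ fiu]; have [e e0 eV] := of_ i _ fiu.
by exists e => // v /eV fv; exists i.
Qed.

HB.instance Definition _ := isOpenTopological.Build SU0_group
  SU0_openT SU0_openI SU0_open_bigU.

Definition exp_length (u : SU0_group) : R :=
  inf [set l : R | exists hs : seq (calg A),
    [/\ forall h, h \in hs -> selfadjoint_comm h,
        SU0_to_alg u = \prod_(h <- hs) cexp ('i *: h) &
        l = \sum_(h <- hs) rnorm h]].

(* u^-1 is star u *)
Definition SU0_dist (u v : SU0_group) : R := exp_length (u^-1 * v)%g.

Definition SU0_metric_bounded : Prop :=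
  exists M : R, forall u v : SU0_group, SU0_dist u v <= M.

End SU0.

(* Main.v *)
(* Let [g] be a noncentral element of SU_0(A). Functional calculus of the unitary [g] gives
   cutoffs n_0, n_1, ..., n_19 of [g] around a point of its spectrum, at widely separated
   scales, with n_0 <> 0 and n_19 <> 1. If [a] is small, skew and has only the two blocks
   between the ranges of n_i and 1 - n_(i+1), then
     e^(-a/2) g e^a g^-1 e^(-a/2)
   is a product of a conjugate of [g] and a conjugate of [g^-1], and a fixed-point argument
   shows that every small exponential of such an off-diagonal element has this form.
   Simplicity of A writes 1 as a sum of products through n_0 and through 1 - n_19, and so,
   with bounded commutators generation, every skew [h] in [A, A] as a sum of a fixed number
   of conjugates of off-diagonal elements of norm O(|h|). A sum in the exponent becomes a
   product by the identity
     e^(a + b) = (e^l e^a e^-l) (e^m e^b e^-m),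
   with [l] and [m] in the closed Lie algebra generated by small [a] and [b], which is proved
   for formal power series and then evaluated. Hence for small [h] the exponential e^h is a
   product of a fixed number of conjugates of g and g^-1: this is local bounded normal
   generation. Cutting a product of exponentials into pieces of small length gives
   simplicity, and the number of pieces is bounded when SU_0(A) is. *)

Require Import Defs.
From HB Require Import structures.
From mathcomp Require Import all_boot all_order all_algebra.
From mathcomp Require Import all_classical.
From mathcomp Require Import zify ring lra.

Set Implicit Arguments.
Unset Strict Implicit.
Unset Printing Implicit Defensive.

Import Order.TTheory GRing.Theory Num.Theory.

Local Open Scope ring_scope.

(** Conjugators in a product must lie in SU_0(A), so each is kept in the form e^l with l skew in
    [A, A]; this is why the estimates for the conjugating series bound brackets only. The
    Baker-Campbell-Hausdorff formula would leave an error term in e^(a + b); the identity used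
    instead is exact. Off-diagonal elements are the building blocks for two reasons: they lie in
    [A, A] automatically, and an equation between symmetrised exponentials reduces to its odd part,
    which is off-diagonal again. A commutator of two opposite corners is not off-diagonal, but
    [p, q] = e^p h e^-p - e^-p h e^p can be solved for h when p is small, the right side being 2
    sinh (ad p) h. The indices up to 19 only provide room: each use of a corner needs two adjacent
    cutoffs strictly between the supports involved. No spectrum is constructed: norms are bounded by
    suprema over the whole unit circle, and a point counts as spectral when a bump function
    supported near it takes a nonzero value at g. *)

(** * Identities in noncommutative rings *)

(* Reflexive decision of identities in noncommutative rings: both sides are expanded into
   integer combinations of words. *)
Inductive nc_expr :=
  NcVar of nat | Nc0 | Nc1 | NcAdd of nc_expr & nc_expr | NcOpp of nc_expr
  | NcMul of nc_expr & nc_expr.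

Section NcRing.
Variable V : nzRingType.

Fixpoint nc_eval (e : seq V) t : V := match t with
  | NcVar i => nth 0 e i | Nc0 => 0 | Nc1 => 1
  | NcAdd t1 t2 => nc_eval e t1 + nc_eval e t2 | NcOpp t1 => - nc_eval e t1
  | NcMul t1 t2 => nc_eval e t1 * nc_eval e t2 end.

Fixpoint nc_norm t : seq (int * seq nat) := match t with
  | NcVar i => [:: (1%Z, [:: i])] | Nc0 => [::] | Nc1 => [:: (1%Z, [::])]
  | NcAdd t1 t2 => nc_norm t1 ++ nc_norm t2
  | NcOpp t1 => [seq (- x.1, x.2) | x <- nc_norm t1]
  | NcMul t1 t2 => [seq (x.1 * y.1, x.2 ++ y.2) | x <- nc_norm t1, y <- nc_norm t2]
  end.

Definition nc_zero (d : seq (int * seq nat)) : bool :=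
  all (fun m => foldr (fun x s => if x.2 == m then x.1 + s else s) 0 d == 0)
    (undup [seq x.2 | x <- d]).

Definition nc_mon (e : seq V) (m : seq nat) : V := \prod_(i <- m) nth 0 e i.

Lemma nc_normP e t : nc_eval e t = \sum_(x <- nc_norm t) x.1%:~R * nc_mon e x.2.
Proof.
elim: t => [i|||t1 IH1 t2 IH2|t IH|t1 IH1 t2 IH2] /=.
- by rewrite big_seq1 mul1r /nc_mon big_seq1.
- by rewrite big_nil.
- by rewrite big_seq1 mul1r /nc_mon big_nil.
- by rewrite big_cat IH1 IH2.
- rewrite big_map IH -sumrN; apply: eq_bigr => x _ /=.
  by rewrite mulrNz mulNr.
- rewrite big_allpairs_dep /= IH1 IH2 mulr_suml; apply: eq_bigr => x _.
  rewrite mulr_sumr; apply: eq_bigr => y _ /=.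
  rewrite /nc_mon big_cat /= intrM -!mulrA; congr (_ * _); rewrite !mulrA.
  by rewrite -(commr_int (\prod_(i <- x.2) _)).
Qed.

(** Grouping the expansion by words leaves one total coefficient per word, and these are what
    [nc_zero] computes. *)
Lemma nc_ringP e t1 t2 : nc_zero (nc_norm (NcAdd t1 (NcOpp t2))) ->
  nc_eval e t1 = nc_eval e t2.
Proof.
move=> h; apply/eqP; rewrite -subr_eq0; apply/eqP.
rewrite -[LHS]/(nc_eval e (NcAdd t1 (NcOpp t2))) nc_normP.
move: (nc_norm _) h => d /allP h.
rewrite (eq_big_seq (fun x => \sum_(m <- undup [seq y.2 | y <- d] | m == x.2)
    x.1%:~R * nc_mon e m)); last first.
  move=> x xd; rewrite -big_filter.
  have -> : [seq i <- undup [seq y.2 | y <- d] | i == x.2] = [:: x.2].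
    by apply: filter_pred1_uniq; rewrite ?undup_uniq // mem_undup map_f.
  by rewrite big_seq1.
rewrite (exchange_big_dep xpredT) //= big_seq big1 // => m md.
rewrite (eq_bigl (fun x : int * seq nat => x.2 == m)); last by move=> x; rewrite eq_sym.
rewrite -mulr_suml -(big_morph (fun z : int => z%:~R : V) (id1 := 0) (op1 := +%R) (id2 := 0) (op2 := +%R)) //.
  rewrite (_ : \sum_(x <- d | _) _ = 0) ?mul0r // -[RHS](eqP (h _ md)).
  by elim: (d) => [|x d' IH] /=; rewrite (big_nil, big_cons) // IH.
by move=> x y; rewrite intrD.
Qed.
End NcRing.

Ltac nc_mem x l :=
  match l with
  | nil => constr:(false) | x :: _ => constr:(true) | _ :: ?l' => nc_mem x l' end.
Ltac nc_idx x l :=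
  match l with
  | x :: _ => constr:(O) | _ :: ?l' => let n := nc_idx x l' in constr:(S n) end.
Ltac nc_atoms t l :=
  match t with
  | Algebra.add ?a ?b => let l := nc_atoms a l in nc_atoms b l
  | Algebra.opp ?a => nc_atoms a l
  | GRing.mul ?a ?b => let l := nc_atoms a l in nc_atoms b l
  | @Algebra.zero _ => l
  | @GRing.one _ => l
  | _ => let b := nc_mem t l in
    match b with true => l | false => constr:(t :: l) end
  end.
Ltac nc_reify t l :=
  match t with
  | Algebra.add ?a ?b => let a := nc_reify a l in let b := nc_reify b l in
                         constr:(NcAdd a b)
  | Algebra.opp ?a => let a := nc_reify a l in constr:(NcOpp a)
  | GRing.mul ?a ?b => let a := nc_reify a l in let b := nc_reify b l in
                         constr:(NcMul a b)
  | @Algebra.zero _ => constr:(Nc0)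
  | @GRing.one _ => constr:(Nc1)
  | _ => let n := nc_idx t l in constr:(NcVar n)
  end.
Ltac nc_ring_on V :=
  match goal with |- ?a = ?b =>
    let l := nc_atoms a (@nil (GRing.NzRing.sort V)) in let l := nc_atoms b l in
    let ta := nc_reify a l in let tb := nc_reify b l in
    refine (@nc_ringP V l ta tb _); vm_compute; exact: erefl end.
Ltac nc_ring :=
  match goal with |- @eq ?T ?a ?b =>
    let V := constr:(ltac:(let V := open_constr:(_ : nzRingType) in
      unify (GRing.NzRing.sort V) T; exact V)) in nc_ring_on V end.

(** * Formal power series over an algebra *)

(** A separate name, so that the Cauchy product can be the ring structure while addition and scaling
    stay those of functions. *)
Definition fps (V : Type) := nat -> V.

Section FpsRing.
Variable V : nzRingType.
HB.instance Definition _ := GRing.Zmodule.copy (fps V) (nat -> V).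
Implicit Types f g h : fps V.

Definition fps_mul f g : fps V := fun n => \sum_(i < n.+1) f i * g (n - i)%N.
Definition fps_const (x : V) : fps V := fun n => if n is 0 then x else 0.

Lemma fps_addE f g n : (f + g) n = f n + g n. Proof. by []. Qed.
Lemma fps_oppE f n : (- f) n = - f n. Proof. by []. Qed.
Lemma fps_0E n : (0 : fps V) n = 0. Proof. by []. Qed.
Lemma fps_sumE I (r : seq I) (P : pred I) (F : I -> fps V) n :
  (\sum_(i <- r | P i) F i) n = \sum_(i <- r | P i) F i n.
Proof. by elim/big_rec2: _ => // i y1 y2 _ <-. Qed.

(** Truncations to polynomials have the same product coefficients below N, so associativity is
    inherited from [{poly V}]. *)
Let tr N f : {poly V} := \poly_(i < N) f i.
Let coef_tr N f i : (i < N)%N -> (tr N f)`_i = f i.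
Proof. by move=> iN; rewrite coef_poly iN. Qed.

Let fps_mul_tr N f g n : (n < N)%N -> fps_mul f g n = (tr N f * tr N g)`_n.
Proof.
move=> nN; rewrite coefM; apply: eq_bigr => i _.
rewrite !coef_tr //; first by apply: leq_ltn_trans nN; rewrite leq_subr.
by rewrite (leq_trans (ltn_ord i)).
Qed.

Fact fps_mulA : associative fps_mul.
Proof.
move=> f g h; apply/funext => n.
have -> : fps_mul f (fps_mul g h) n = (tr n.+1 f * (tr n.+1 g * tr n.+1 h))`_n.
  rewrite /fps_mul coefM; apply: eq_bigr => i _; rewrite coef_tr //.
  congr (_ * _); apply: fps_mul_tr; by rewrite ltnS leq_subr.
rewrite mulrA [LHS]coefM /fps_mul; apply: eq_bigr => i _.
rewrite coef_tr ?ltnS ?leq_subr // -(@fps_mul_tr n.+1) //.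
Qed.
Fact fps_mul1 : left_id (fps_const 1) fps_mul.
Proof.
move=> f; apply/funext => n; rewrite /fps_mul big_ord_recl /= mul1r subn0.
by rewrite big1 ?addr0 // => i _; rewrite mul0r.
Qed.
Fact fps_mulr1 : right_id (fps_const 1) fps_mul.
Proof.
move=> f; apply/funext => n; rewrite /fps_mul big_ord_recr /= subnn mulr1.
rewrite big1 ?add0r // => i _; rewrite /fps_const.
by case E : (n - i)%N => [|k]; rewrite ?mulr0 //; have := ltn_ord i; lia.
Qed.
Fact fps_mulDl : left_distributive fps_mul +%R.
Proof.
move=> f g h; apply/funext => n; rewrite fps_addE /fps_mul -big_split /=.
by apply: eq_bigr => i _; rewrite mulrDl.
Qed.
Fact fps_mulDr : right_distributive fps_mul +%R.
Proof.
move=> f g h; apply/funext => n; rewrite fps_addE /fps_mul -big_split /=.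
by apply: eq_bigr => i _; rewrite mulrDr.
Qed.
Fact fps_1neq0 : fps_const 1 != 0.
Proof.
apply/eqP => /(congr1 (fun f : fps V => f 0%N)) /= /eqP.
by rewrite oner_eq0.
Qed.

HB.instance Definition _ := GRing.Zmodule_isNzRing.Build (fps V)
  fps_mulA fps_mul1 fps_mulr1 fps_mulDl fps_mulDr fps_1neq0.

Lemma fps_mulE f g n : (f * g) n = \sum_(i < n.+1) f i * g (n - i)%N.
Proof. by []. Qed.
Lemma fps_1E : 1 = fps_const 1. Proof. by []. Qed.
End FpsRing.

Section FpsAlg.
Variables (R : numFieldType) (V : algType R).
HB.instance Definition _ := GRing.Lmodule.copy (fps V) (nat -> V).
Implicit Types (f g : fps V) (a : R).
Lemma fps_scaleE a f n : (a *: f) n = a *: f n. Proof. by []. Qed.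
Fact fps_scaleAl a f g : a *: (f * g) = (a *: f) * g.
Proof.
apply/funext => n; rewrite fps_scaleE !fps_mulE scaler_sumr.
by apply: eq_bigr => i _; rewrite scalerAl.
Qed.
HB.instance Definition _ := GRing.Lmodule_isLalgebra.Build R (fps V) fps_scaleAl.
Fact fps_scaleAr a f g : a *: (f * g) = f * (a *: g).
Proof.
apply/funext => n; rewrite fps_scaleE !fps_mulE scaler_sumr.
by apply: eq_bigr => i _; rewrite scalerAr.
Qed.
HB.instance Definition _ := GRing.Lalgebra_isAlgebra.Build R (fps V) fps_scaleAr.
End FpsAlg.

Section FpsShift.
Variable V : nzRingType.
Implicit Types f g : fps V.

Definition fps_shift f : fps V := fun n => if n is m.+1 then f m else 0.

Lemma fps_shiftMl f g : fps_shift f * g = fps_shift (f * g).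
Proof.
apply/funext => -[|n]; rewrite fps_mulE big_ord_recl /= mul0r add0r.
  by rewrite big_ord0.
by rewrite fps_mulE; apply: eq_bigr => i _; rewrite /bump /= add1n subSS.
Qed.
Lemma fps_shiftMr f g : f * fps_shift g = fps_shift (f * g).
Proof.
apply/funext => -[|n]; rewrite fps_mulE big_ord_recr /= ?subnn mulr0 addr0.
  by rewrite big_ord0.
rewrite fps_mulE; apply: eq_bigr => i _ /=; rewrite subSn //.
by rewrite -ltnS.
Qed.
Lemma fps_shiftD f g : fps_shift (f + g) = fps_shift f + fps_shift g.
Proof. by apply/funext => -[|n] //; rewrite fps_addE /= addr0. Qed.
Lemma fps_shiftN f : fps_shift (- f) = - fps_shift f.
Proof. by apply/funext => -[|n] //; rewrite fps_oppE /= oppr0. Qed.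
End FpsShift.

(** The infinite sum of the y j, meaningful when y j has order at least j ([ford]): then no term
    beyond j = n reaches coefficient n. *)
HB.lock Definition fsum (V : nzRingType) (y : nat -> fps V) : fps V :=
  fun n => \sum_(j < n.+1) y j n.
Lemma fsum_coef (V : nzRingType) (y : nat -> fps V) n :
  fsum y n = \sum_(j < n.+1) y j n.
Proof. by rewrite fsum.unlock. Qed.

Section FpsCalculus.
Variables (R : numFieldType) (V : algType R).
Implicit Types f g h : fps V.
Local Notation fsum := (@fsum V).

Definition fps_deriv f : fps V := fun n => f n.+1 *+ n.+1.
Definition fps_integ f : fps V :=
  fun n => if n is m.+1 then m.+1%:R^-1 *: f m else 0.

Lemma mulrn_inj (x y : V) n : x *+ n.+1 = y *+ n.+1 -> x = y.
Proof.
have n0 : n.+1%:R != 0 :> R by rewrite pnatr_eq0.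
rewrite -!(scaler_nat n.+1 _ : n.+1%:R *: _ = _) => h.
by rewrite -[x]scale1r -[y]scale1r -(mulVf n0) -!scalerA h.
Qed.

Lemma fps_deriv_inj f g : fps_deriv f = fps_deriv g -> f 0%N = g 0%N -> f = g.
Proof.
move=> h h0; apply/funext => -[|n] //.
by have := congr1 (fun u => u n) h => /mulrn_inj.
Qed.

Lemma fps_derivZ a f : fps_deriv (a *: f) = a *: fps_deriv f.
Proof. by apply/funext => n; rewrite /fps_deriv !fps_scaleE scalerMnr. Qed.
Lemma fps_deriv_const x : fps_deriv (fps_const x) = 0.
Proof. by apply/funext => n; rewrite /fps_deriv mul0rn. Qed.

Lemma fps_derivM f g : fps_deriv (f * g) = fps_deriv f * g + f * fps_deriv g.
Proof.
apply/funext => n; rewrite fps_addE !fps_mulE /fps_deriv fps_mulE.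
rewrite -sumrMnl.
rewrite (eq_bigr (fun i : 'I_n.+2 => (f i * g (n.+1 - i)%N) *+ i
    + (f i * g (n.+1 - i)%N) *+ (n.+1 - i))); last first.
  by move=> i _; rewrite -mulrnDr subnKC // -ltnS.
rewrite big_split /=; congr (_ + _).
  rewrite big_ord_recl /= mulr0n add0r; apply: eq_bigr => i _.
  by rewrite /bump /= add1n subSS mulrnAl.
rewrite big_ord_recr /= subnn mulr0n addr0; apply: eq_bigr => i _.
by rewrite subSn -1?ltnS // mulrnAr.
Qed.

Lemma fps_integK f : fps_deriv (fps_integ f) = f.
Proof.
apply/funext => n; rewrite /fps_deriv /fps_integ -(scaler_nat n.+1).
by rewrite scalerA mulfV ?scale1r // pnatr_eq0.
Qed.

Lemma fps_deriv_shift f : fps_deriv (fps_shift f) = f + fps_shift (fps_deriv f).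
Proof.
by apply/funext => -[|n]; rewrite fps_addE /fps_deriv /= ?addr0 ?mulr1n ?mulrS.
Qed.

Definition ford (y : nat -> fps V) := forall j i, (i < j)%N -> y j i = 0.

Lemma fsumE y n N : ford y -> (n < N)%N -> fsum y n = \sum_(j < N) y j n.
Proof.
move=> oy nN; rewrite fsum_coef.
rewrite -(big_mkord xpredT (fun j => y j n)) -(big_mkord xpredT (fun j => y j n)).
rewrite (@big_cat_nat _ _ _ n.+1 0 N) //= [X in _ + X]big_nat_cond [X in _ + X]big1 ?addr0 //.
by move=> j /andP[/andP[nj _] _]; exact: oy.
Qed.

Lemma fps_mul_ord m k f g i : (forall i, (i < m)%N -> f i = 0) ->
  (forall i, (i < k)%N -> g i = 0) -> (i < m + k)%N -> (f * g) i = 0.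
Proof.
move=> fm gk imk; rewrite fps_mulE big1 // => j _.
have [jm|mj] := ltnP j m; first by rewrite fm ?mul0r.
by rewrite gk ?mulr0 //; have := ltn_ord j; lia.
Qed.

(** Both sides add up (y j * z k) n, over the square j, k <= n on the left and over the triangle j +
    k <= n on the right. The other terms vanish because y j * z k has order at least j + k. *)
Lemma fsumM y z : ford y -> ford z ->
  fsum y * fsum z = fsum (fun n => \sum_(j < n.+1) y j * z (n - j)%N).
Proof.
move=> oy oz; apply/funext => n.
transitivity (\sum_(j < n.+1) \sum_(k < n.+1) (y j * z k) n).
  rewrite fps_mulE.
  rewrite (eq_bigr (fun i : 'I_n.+1 =>
      \sum_(j < n.+1) \sum_(k < n.+1) y j i * z k (n - i)%N)).
    rewrite exchange_big; apply: eq_bigr => j _.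
    rewrite exchange_big; apply: eq_bigr => k _.
    by rewrite fps_mulE.
  move=> i _; rewrite (fsumE oy (ltn_ord i)) mulr_suml; apply: eq_bigr => j _.
  by rewrite (@fsumE z _ n.+1) ?ltnS ?leq_subr // mulr_sumr.
rewrite !fsum_coef [RHS](eq_bigr (fun l : 'I_n.+1 => \sum_(j < n.+1 | (j <= l)%N) (y j * z (l - j)%N) n)); last first.
  move=> l _ /=; rewrite fps_sumE.
  rewrite (big_ord_widen n.+1 (fun j => (y j * z (l - j)%N) n)) //.
rewrite [RHS](exchange_big_dep xpredT) //=; apply: eq_bigr => j _.
rewrite -(big_mkord xpredT (fun k => (y j * z k) n)).
rewrite -(big_mkord (fun l => (j <= l)%N) (fun l => (y j * z (l - j)%N) n)).
have jn : (j <= n.+1)%N by rewrite ltnW.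
rewrite [RHS](@big_cat_nat _ _ _ j) //= [X in _ = X + _]big_nat_cond [X in _ = X + _]big1 ?add0r; last first.
  by move=> l /andP[/andP[_ lj]]; rewrite leqNgt lj.
rewrite (@big_cat_nat _ _ _ (n.+1 - j)%N) //= ?leq_subr //.
rewrite [X in _ + X]big_nat_cond [X in _ + X]big1 ?addr0; last first.
  move=> k /andP[/andP[jk kn] _].
  by apply: (@fps_mul_ord j k); [exact: oy|exact: oz|lia].
have := big_addn 0 n.+1 j (fun l => (j <= l)%N) (fun l => (y j * z (l - j)%N) n).
rewrite add0n => ->.
rewrite big_nat_cond [RHS]big_nat_cond; apply: congr_big => //.
  by move=> k; rewrite leq_addl.
by move=> k _; rewrite addnK.
Qed.

(** Causality of T takes the place of continuity: coefficient n of T f depends on finitely many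
    coefficients of f, for which the sum is finite. *)
Lemma fsum_linear (T : fps V -> fps V) y :
  (forall f g, T (f + g) = T f + T g) -> T 0 = 0 ->
  (forall f g n, (forall i, (i <= n)%N -> f i = g i) -> T f n = T g n) ->
  ford y -> T (fsum y) = fsum (fun j => T (y j)).
Proof.
move=> TD T0 Tc oy; apply/funext => n.
rewrite (Tc _ (\sum_(j < n.+1) y j)).
  by rewrite (big_morph T TD T0) fps_sumE fsum_coef.
by move=> i ile; rewrite fps_sumE (@fsumE y i n.+1).
Qed.

Lemma eq_fsum y z : (forall j, y j = z j) -> fsum y = fsum z.
Proof. by move=> h; have -> : y = z by apply/funext. Qed.

Lemma fsumD y z : fsum (fun j => y j + z j) = fsum y + fsum z.
Proof. by apply/funext => n; rewrite fps_addE !fsum_coef -big_split. Qed.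
Lemma fsumN y : fsum (fun j => - y j) = - fsum y.
Proof. by apply/funext => n; rewrite fps_oppE !fsum_coef -sumrN. Qed.

Lemma fsum_recl y : ford y -> fsum y = y 0%N + fsum (fun j => y j.+1).
Proof.
move=> oy; apply/funext => n; rewrite fps_addE (@fsumE y n n.+2) //.
by rewrite big_ord_recl fsum_coef.
Qed.

Lemma fps_deriv_fsum y : ford y ->
  fps_deriv (fsum y) = fps_deriv (y 0%N) + fsum (fun j => fps_deriv (y j.+1)).
Proof.
move=> oy; apply/funext => n; rewrite fps_addE /fps_deriv {1}fsum_coef big_ord_recl /=.
by rewrite mulrnDl fsum_coef -sumrMnl.
Qed.

End FpsCalculus.

Definition cexpo (R : numFieldType) : fps R := fun n => n`!%:R^-1.
(** (exp x - 1) / x, the series that governs the derivative of an exponential in [fexp_deriv]. *)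
Definition cphi (R : numFieldType) : fps R := fun n => n.+1`!%:R^-1.
Lemma cphiE (R : numFieldType) n : cphi R n = n.+1`!%:R^-1.
Proof. by []. Qed.
Definition fad (V : nzRingType) (H m : fps V) : fps V := H * m - m * H.
(* [fpsi c H m] is [c (ad H) m]. *)
HB.lock Definition fpsi (R : numFieldType) (V : algType R) (c : fps R) (H m : fps V) : fps V :=
  fsum (fun j => c j *: iter j (fad H) m).
HB.lock Definition fexp (R : numFieldType) (V : algType R) (H : fps V) : fps V :=
  fsum (fun n => cexpo R n *: H ^+ n).
Lemma fpsiE (R : numFieldType) (V : algType R) (c : fps R) (H m : fps V) :
  fpsi c H m = fsum (fun j => c j *: iter j (fad H) m).
Proof. by rewrite fpsi.unlock. Qed.
Lemma fexpE (R : numFieldType) (V : algType R) (H : fps V) :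
  fexp H = fsum (fun n => cexpo R n *: H ^+ n).
Proof. by rewrite fexp.unlock. Qed.

Section FpsAdjoint.
Variables (R : numFieldType) (V : algType R).
Implicit Types (f g h H K m : fps V) (c d : fps R).
Local Notation fsum := (@fsum V).
Local Notation cexpo := (cexpo R).
Local Notation cphi := (cphi R).


Lemma fadD H f g : fad H (f + g) = fad H f + fad H g.
Proof. by rewrite /fad mulrDr mulrDl opprD addrACA. Qed.
Lemma fadN H f : fad H (- f) = - fad H f.
Proof. by rewrite /fad mulrN mulNr opprB opprK addrC. Qed.
Lemma fad0 H : fad H 0 = 0.
Proof. by rewrite /fad mulr0 mul0r subrr. Qed.
Lemma fadZ a H f : fad H (a *: f) = a *: fad H f.
Proof. by rewrite /fad -scalerAr -scalerAl scalerBr. Qed.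
Lemma iter_fadD n H f g : iter n (fad H) (f + g) = iter n (fad H) f + iter n (fad H) g.
Proof. by elim: n => //= n ->; rewrite fadD. Qed.
Lemma iter_fadN n H f : iter n (fad H) (- f) = - iter n (fad H) f.
Proof. by elim: n => //= n ->; rewrite fadN. Qed.
Lemma iter_fad0 n H : iter n (fad H) 0 = 0.
Proof. by elim: n => //= n ->; rewrite fad0. Qed.
Lemma iter_fadZ n a H f : iter n (fad H) (a *: f) = a *: iter n (fad H) f.
Proof. by elim: n => //= n ->; rewrite fadZ. Qed.

Lemma fps_mul_coef_eq f f' g g' n :
  (forall i, (i <= n)%N -> f i = f' i) -> (forall i, (i <= n)%N -> g i = g' i) ->
  (f * g) n = (f' * g') n.
Proof.
move=> ff gg; rewrite !fps_mulE; apply: eq_bigr => i _.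
by rewrite ff -1?ltnS // gg // leq_subr.
Qed.

Lemma iter_fad_coef_eq k H f g n : (forall i, (i <= n)%N -> f i = g i) ->
  iter k (fad H) f n = iter k (fad H) g n.
Proof.
elim: k n => [|k IH] n fg /=; first exact: fg.
have IH' i : (i <= n)%N -> iter k (fad H) f i = iter k (fad H) g i.
  by move=> ile; apply: IH => j ji; apply: fg; apply: leq_trans ile.
rewrite /fad !fps_addE !fps_oppE (@fps_mul_coef_eq H H _ _ n _ IH') //.
by rewrite (@fps_mul_coef_eq _ _ H H n IH').
Qed.

Section Order.
Variable H : fps V.
Hypothesis H0 : H 0%N = 0.

Lemma expr_ord n i : (i < n)%N -> (H ^+ n) i = 0.
Proof.
elim: n i => // n IH i ilt; rewrite exprS; apply: (@fps_mul_ord _ _ 1 n) => //.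
by case.
Qed.

Lemma fad_ord k f : (forall i, (i < k)%N -> f i = 0) ->
  forall i, (i < k.+1)%N -> fad H f i = 0.
Proof.
move=> fk i ik; have H1 j : (j < 1)%N -> H j = 0 by case: j.
rewrite /fad fps_addE fps_oppE (@fps_mul_ord _ _ 1 k) // (@fps_mul_ord _ _ k 1) ?subr0 //.
by rewrite addn1.
Qed.

Lemma iter_fad_ord j m i : (i < j)%N -> iter j (fad H) m i = 0.
Proof. by elim: j i => // j IH i ij /=; apply: (fad_ord (k := j)). Qed.

Lemma ford_pow c : ford (fun n => c n *: H ^+ n).
Proof. by move=> j i ij; rewrite fps_scaleE expr_ord ?scaler0. Qed.
Lemma ford_psi c m : ford (fun j => c j *: iter j (fad H) m).
Proof. by move=> j i ij; rewrite fps_scaleE iter_fad_ord ?scaler0. Qed.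
Hint Resolve ford_pow ford_psi : core.

Lemma fpsiD c f g : fpsi c H (f + g) = fpsi c H f + fpsi c H g.
Proof.
by rewrite !fpsiE -fsumD; apply: eq_fsum => j; rewrite iter_fadD scalerDr.
Qed.
Lemma fpsiN c f : fpsi c H (- f) = - fpsi c H f.
Proof.
by rewrite !fpsiE -fsumN; apply: eq_fsum => j; rewrite iter_fadN scalerN.
Qed.
Lemma fpsiB c f g : fpsi c H (f - g) = fpsi c H f - fpsi c H g.
Proof. by rewrite fpsiD fpsiN. Qed.
Lemma fpsi_subl c d f : fpsi (c - d) H f = fpsi c H f - fpsi d H f.
Proof.
by rewrite !fpsiE -fsumN -fsumD; apply: eq_fsum => j; rewrite scalerBl.
Qed.
Lemma fpsi_0 c : fpsi c H 0 = 0.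
Proof.
apply/funext => n; rewrite fpsiE fsum_coef big1 // => j _.
by rewrite iter_fad0 scaler0.
Qed.
Lemma fpsi_1 m : fpsi 1 H m = m.
Proof.
rewrite fpsiE fsum_recl //= scale1r; rewrite [X in _ + X](_ : _ = 0) ?addr0 //.
by apply/funext => n; rewrite fsum_coef big1 // => j _; rewrite scale0r.
Qed.
Lemma fpsi_shift c m : fpsi (fps_shift c) H m = fad H (fpsi c H m).
Proof.
rewrite [in RHS]fpsiE (fsum_linear (T := fad H)) //.
- rewrite {1}fpsiE fsum_recl //= scale0r add0r.
  by apply: eq_fsum => j; rewrite fadZ.
- exact: fadD.
- exact: fad0.
- by move=> f g n fg; have := @iter_fad_coef_eq 1 H f g n fg.
Qed.
Lemma fpsi_comp c d m : fpsi c H (fpsi d H m) = fpsi (c * d) H m.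
Proof.
apply/funext => n; rewrite {1}[in LHS]fpsiE fsum_coef.
transitivity (\sum_(j < n.+1) \sum_(k < n.+1) (c j * d k) *: iter (j + k) (fad H) m n).
  apply: eq_bigr => j _; rewrite fps_scaleE.
  rewrite (@iter_fad_coef_eq j H _ (\sum_(k < n.+1) d k *: iter k (fad H) m)).
    rewrite (big_morph (iter j (fad H)) (iter_fadD j H) (iter_fad0 j H)).
    rewrite fps_sumE scaler_sumr; apply: eq_bigr => k _.
    by rewrite iter_fadZ fps_scaleE scalerA iterD.
  by move=> i ile; rewrite fps_sumE fpsiE (@fsumE _ _ _ i n.+1).
rewrite [in RHS]fpsiE [RHS]fsum_coef [RHS](eq_bigr (fun l : 'I_n.+1 =>
    \sum_(j < n.+1 | (j <= l)%N) (c j * d (l - j)%N) *: iter l (fad H) m n)); last first.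
  move=> l _; rewrite fps_scaleE fps_mulE scaler_suml.
  by rewrite (big_ord_widen n.+1 (fun j => (c j * d (l - j)%N) *: iter l (fad H) m n)).
rewrite [RHS](exchange_big_dep xpredT) //=; apply: eq_bigr => j _.
rewrite -(big_mkord xpredT (fun k => (c j * d k) *: iter (j + k) (fad H) m n)).
rewrite -(big_mkord (fun l => (j <= l)%N) (fun l => (c j * d (l - j)%N) *: iter l (fad H) m n)).
have jn : (j <= n.+1)%N by rewrite ltnW.
rewrite [RHS](@big_cat_nat _ _ _ j) //= [X in _ = X + _]big_nat_cond [X in _ = X + _]big1 ?add0r; last first.
  by move=> l /andP[/andP[_ lj]]; rewrite leqNgt lj.
rewrite (@big_cat_nat _ _ _ (n.+1 - j)%N) //= ?leq_subr //.
rewrite [X in _ + X]big_nat_cond [X in _ + X]big1 ?addr0; last first.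
  move=> k /andP[/andP[jk kn] _]; rewrite iter_fad_ord ?scaler0 //; lia.
have := big_addn 0 n.+1 j (fun l => (j <= l)%N)
  (fun l => (c j * d (l - j)%N) *: iter l (fad H) m n).
rewrite add0n => ->.
rewrite big_nat_cond [RHS]big_nat_cond; apply: congr_big => //.
  by move=> k; rewrite leq_addl.
by move=> k _; rewrite addnK addnC.
Qed.

(** Left multiplication by H is the sum of two commuting operators, ad H and right multiplication by
    H; this is the binomial formula for its powers. *)
Lemma expr_ad n m :
  H ^+ n * m = \sum_(j < n.+1) (iter j (fad H) m * H ^+ (n - j)) *+ 'C(n, j).
Proof.
elim: n => [|n IH]; first by rewrite big_ord_recl big_ord0 /= expr0 mul1r mulr1 addr0 mulr1n.
rewrite exprS -mulrA IH mulr_sumr.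
have E j : (j < n.+1)%N -> H * ((iter j (fad H) m * H ^+ (n - j)) *+ 'C(n, j)) =
    (iter j.+1 (fad H) m * H ^+ (n.+1 - j.+1)) *+ 'C(n, j)
    + (iter j (fad H) m * H ^+ (n.+1 - j)) *+ 'C(n, j).
  move=> jn; rewrite -mulrnDl subSS subSn // exprS mulrA -mulrDl /= -mulrnAr mulrA.
  by rewrite /fad subrK mulrnAr.
rewrite (eq_bigr _ (fun (j : 'I_n.+1) _ => E j (ltn_ord j))) big_split /=.
rewrite [RHS]big_ord_recl /= [X in _ + X]big_ord_recl /=.
rewrite !bin0 addrCA; congr (_ + _).
rewrite [RHS](eq_bigr (fun i : 'I_n.+1 => fad H (iter i (fad H) m) * H ^+ (n - i) *+ 'C(n, i.+1)
   + fad H (iter i (fad H) m) * H ^+ (n - i) *+ 'C(n, i))); last first.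
  by move=> i _; rewrite /bump /= ?add1n ?add0n subSS binS mulrnDr.
rewrite [RHS]big_split /= addrC; congr (_ + _).
rewrite [RHS]big_ord_recr /= bin_small // mulr0n addr0.
by apply: eq_bigr => i _; rewrite /bump /= ?add1n ?add0n subSS.
Qed.

Lemma factV (n j : nat) : (j <= n)%N ->
  n`!%:R^-1 * 'C(n, j)%:R = j`!%:R^-1 * (n - j)`!%:R^-1 :> R.
Proof.
move=> jn; rewrite -[in LHS](bin_fact jn) !natrM.
have h1 : 'C(n, j)%:R != 0 :> R by rewrite pnatr_eq0 -lt0n bin_gt0.
have h2 k : k`!%:R != 0 :> R by rewrite pnatr_eq0 -lt0n fact_gt0.
by rewrite !invfM [X in X * _]mulrC mulfVK ?mulfK // mulrC.
Qed.

(** Conjugation by exp H is exp (ad H): divide [expr_ad] by n! and recognise a Cauchy product. *)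
Lemma fexp_ad m : fexp H * m = fpsi cexpo H m * fexp H.
Proof.
rewrite {1}fexpE (fsum_linear (T := fun u => u * m)) //; last 3 first.
- by move=> f g; rewrite mulrDl.
- by rewrite mul0r.
- by move=> f g n fg; apply: fps_mul_coef_eq.
rewrite fpsiE {1}fexpE fsumM //; apply: eq_fsum => n.
rewrite -scalerAl expr_ad scaler_sumr; apply: eq_bigr => j _.
rewrite -scalerAl -scalerAr scalerA -factV -1?ltnS //.
by rewrite -scaler_nat scalerA.
Qed.

Lemma fexp_coef0 : fexp H 0%N = 1.
Proof. by rewrite fexpE fsum_coef big_ord_recl big_ord0 addr0 fps_scaleE /cexpo invr1 scale1r. Qed.

Lemma expr_deriv n : fps_deriv (H ^+ n.+1) =
  \sum_(j < n.+1) (iter j (fad H) (fps_deriv H) * H ^+ (n - j)) *+ 'C(n.+1, j.+1).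
Proof.
elim: n => [|n IH].
  by rewrite big_ord_recl big_ord0 /= expr1 addr0 mulr1.
rewrite exprSr fps_derivM IH expr_ad mulr_suml.
rewrite [X in X + _](eq_bigr (fun j : 'I_n.+1 => (iter j (fad H) (fps_deriv H) * H ^+ (n.+1 - j)) *+ 'C(n.+1, j.+1))); last first.
  by move=> j _; rewrite mulrnAl -mulrA -exprSr subSn // -ltnS.
rewrite [in RHS](eq_bigr (fun j : 'I_n.+2 => (iter j (fad H) (fps_deriv H) * H ^+ (n.+1 - j)) *+ 'C(n.+1, j.+1) + (iter j (fad H) (fps_deriv H) * H ^+ (n.+1 - j)) *+ 'C(n.+1, j))); last first.
  by move=> j _; rewrite binS mulrnDr.
rewrite big_split /=; congr (_ + _).
by rewrite [RHS]big_ord_recr /= bin_small // mulr0n addr0.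
Qed.

(** Duhamel's formula for the derivative of an exponential whose exponent does not commute with its
    own derivative. *)
Lemma fexp_deriv : fps_deriv (fexp H) = fpsi cphi H (fps_deriv H) * fexp H.
Proof.
rewrite {1}fexpE fps_deriv_fsum // fps_derivZ (fps_deriv_const (1 : V)) scaler0 add0r.
rewrite fpsiE {1}fexpE fsumM //; apply: eq_fsum => n.
rewrite fps_derivZ expr_deriv scaler_sumr; apply: eq_bigr => j _.
rewrite -scalerAl -scalerAr scalerA.
have := @factV n.+1 j.+1; rewrite subSS ltnS => /(_ (ltn_ord j)) <-.
by rewrite -scaler_nat scalerA.
Qed.


End Order.

Lemma fexpD H K : H 0%N = 0 -> K 0%N = 0 -> GRing.comm H K ->
  fexp (H + K) = fexp H * fexp K.
Proof.
move=> H0 K0 HK; have HK0 : (H + K) 0%N = 0 by rewrite fps_addE H0 K0 addr0.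
rewrite !fexpE fsumM; [|exact: ford_pow..]; apply: eq_fsum => n.
rewrite addrC exprDn_comm; last exact/commr_sym.
rewrite scaler_sumr; apply: eq_bigr => j _.
have -> : K ^+ (n - j) * H ^+ j = H ^+ j * K ^+ (n - j).
  by apply/commrX/commr_sym/commrX.
rewrite -scalerAl -scalerAr scalerA -factV -1?ltnS //.
by rewrite -scaler_nat scalerA.
Qed.

Lemma fexp0 : fexp (0 : fps V) = 1.
Proof.
rewrite fexpE fsum_recl; last exact: ford_pow.
rewrite expr0 /cexpo invr1 scale1r [X in _ + X](_ : _ = 0) ?addr0 //.
by apply/funext => n; rewrite fsum_coef big1 // => j _; rewrite exprS mul0r scaler0.
Qed.

Lemma fexpN H : H 0%N = 0 -> fexp H * fexp (- H) = 1.
Proof.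
move=> H0; rewrite -fexpD ?subrr ?fexp0 ?fps_oppE ?H0 ?oppr0 //.
exact/commrN/commr_refl.
Qed.

Lemma fexpNl H : H 0%N = 0 -> fexp (- H) * fexp H = 1.
Proof.
move=> H0; have := @fexpN (- H); rewrite opprK; apply.
by rewrite fps_oppE H0 oppr0.
Qed.

Lemma fpsi_exp H m : H 0%N = 0 -> fpsi cexpo H m = fexp H * m * fexp (- H).
Proof. by move=> H0; rewrite fexp_ad // -mulrA fexpN // mulr1. Qed.

Lemma fexpo_phi : cexpo = 1 + fps_shift cphi.
Proof. by apply/funext => -[|n]; rewrite fps_addE /= ?addr0 ?add0r // /cexpo invr1. Qed.

End FpsAdjoint.

(** * The Magnus expansion and the derivative of the Baker-Campbell-Hausdorff series *)

Section CausalFixpoint.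
Variables (T : Type) (t0 : T) (F : (nat -> T) -> nat -> T).
(** When F f n depends only on the values of f before n, one further iteration settles one further
    value; n.+1 iterations settle value n. *)
Definition ffix : nat -> T := fun n => iter n.+1 F (fun=> t0) n.
Hypothesis causal : forall f g n, (forall i, (i < n)%N -> f i = g i) -> F f n = F g n.

Lemma ffix_stable k n : (n < k)%N -> iter k F (fun=> t0) n = ffix n.
Proof.
elim: n {-2}n (leqnn n) k => [|N IH] n nN k nk.
  by move: nN nk; case: n => // _; case: k => // k _; rewrite /ffix /=; apply: causal.
case: k nk => // k nk; rewrite /ffix /=; apply: causal => i ilt.
have iN : (i <= N)%N by rewrite -ltnS (leq_trans ilt).
by rewrite IH // ?[RHS]IH // (leq_trans ilt).
Qed.

Lemma ffixE : F ffix = ffix.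
Proof.
apply/funext => n; rewrite {2}/ffix /=; apply: causal => i ilt.
by rewrite ffix_stable.
Qed.

(** Bounds on the fixed point are proved on the iterates, since value n of [ffix] is a value of
    iterate n.+1. *)
Lemma ffix_ind (P : (nat -> T) -> Prop) : P (fun=> t0) ->
  (forall f, P f -> P (F f)) -> forall k, P (iter k F (fun=> t0)).
Proof. by move=> P0 PF; elim=> //= k; apply: PF. Qed.
End CausalFixpoint.

Lemma fps_mulC (R : comNzRingType) (f g : fps R) : f * g = g * f.
Proof.
apply/funext => n; rewrite !fps_mulE (reindex_inj rev_ord_inj) /=.
by apply: eq_bigr => i _; rewrite subSS subKn -1?ltnS // mulrC.
Qed.

Lemma fps_mul_coef_lt (V : nzRingType) (e f g : fps V) n : e 0%N = 0 ->
  (forall i, (i < n)%N -> f i = g i) -> (e * f) n = (e * g) n.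
Proof.
move=> e0 fg; rewrite !fps_mulE !big_ord_recl e0 !mul0r; congr (_ + _).
apply: eq_bigr => i _; rewrite fg //= /bump /=; have := ltn_ord i; lia.
Qed.

Section InvPhi.
Variable R : numFieldType.
Local Notation cphi := (cphi R).
Local Notation cexpo := (cexpo R).

(* The coefficients of [x / (exp x - 1)], the inverse of [cphi = (exp x - 1) / x]. *)
Definition dphi : fps R := ffix 0 (fun d : fps R => 1 - (cphi - 1) * d).

Lemma cphi0 : (cphi - 1) 0%N = 0.
Proof. by rewrite fps_addE fps_oppE cphiE (_ : 1`! = 1%N) // invr1 subrr. Qed.

Lemma dphiE : dphi = 1 - (cphi - 1) * dphi.
Proof.
rewrite {1}/dphi -(ffixE 0) // => f g n fg.
by rewrite !fps_addE !fps_oppE (fps_mul_coef_lt cphi0 fg).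
Qed.

Lemma cphiK : cphi * dphi = 1.
Proof. by rewrite -{1}[cphi](subrK 1) mulrDl mul1r {2}dphiE addrC subrK. Qed.

Lemma dphi0 : dphi 0%N = 1.
Proof.
by rewrite dphiE fps_addE fps_oppE fps_mulE big_ord_recl big_ord0 cphi0 mul0r addr0 subr0.
Qed.

(* [ephi = (1 - dphi) / (exp - 1)]: the quotient exists because [dphi 0 = 1]. *)
Definition ephi : fps R := - (dphi * (fun n => dphi n.+1 : R)).

Lemma ephiE : (cexpo - 1) * ephi = 1 - dphi.
Proof.
have -> : cexpo - 1 = fps_shift cphi by rewrite fexpo_phi addrC addKr.
rewrite fps_shiftMl /ephi mulrN mulrA cphiK mul1r.
apply/funext => -[|n]; rewrite fps_addE fps_oppE /= ?dphi0 ?subrr //.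
by rewrite fps_oppE sub0r.
Qed.
End InvPhi.

Section Magnus.
Variables (R : numFieldType) (V : algType R).
Implicit Types (f g h H K m B u : fps V) (c d : fps R).

Lemma fpsi_coef_eq c H H' m m' n : (forall i, (i <= n)%N -> H i = H' i) ->
  (forall i, (i <= n)%N -> m i = m' i) -> fpsi c H m n = fpsi c H' m' n.
Proof.
move=> HH mm; rewrite !fpsiE !fsum_coef; apply: eq_bigr => j _; rewrite !fps_scaleE.
congr (_ *: _); move: (j : nat) => {j} k.
elim: k n HH mm => [|k IH] n HH mm /=; first exact: mm.
have IH' i : (i <= n)%N -> iter k (fad H) m i = iter k (fad H') m' i.
  by move=> ile; apply: IH => l li; [apply: HH|apply: mm]; apply: leq_trans ile.
by rewrite /fad !fps_addE !fps_oppE (fps_mul_coef_eq HH IH') (fps_mul_coef_eq IH' HH).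
Qed.

Lemma fpsi_fix c H m : H 0%N = 0 -> fad H m = 0 -> fpsi c H m = c 0%N *: m.
Proof.
move=> H0 h; have Z k : fad H (iter k (fad H) m) = 0.
  by elim: k => //= k ->; rewrite fad0.
rewrite fpsiE fsum_recl /=; last exact: ford_psi.
rewrite [X in _ + X](_ : _ = 0) ?addr0 //.
by apply/funext => n; rewrite fsum_coef big1 // => j _; rewrite /= Z scaler0.
Qed.

(** By [fexp_deriv], exp H solves u' = B u as soon as phi (ad H) H' = B, that is H' = dphi (ad H) B.
    Integration shifts degrees, which makes the equation causal. *)
Definition magnus B : fps V := ffix 0 (fun H => fps_integ (fpsi (dphi R) H B)).

Lemma magnusE B : magnus B = fps_integ (fpsi (dphi R) (magnus B) B).
Proof.
rewrite {1}/magnus -(ffixE 0) // => f g [|n] // fg.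
by rewrite /fps_integ (@fpsi_coef_eq _ f g B B).
Qed.

Lemma magnus0 B : magnus B 0%N = 0.
Proof. by rewrite magnusE. Qed.

Lemma magnus_deriv B : fps_deriv (magnus B) = fpsi (dphi R) (magnus B) B.
Proof. by rewrite {1}magnusE fps_integK. Qed.

Lemma fps_ode_unique B u u' : fps_deriv u = B * u -> fps_deriv u' = B * u' ->
  u 0%N = u' 0%N -> u = u'.
Proof.
move=> hu hu' h0; apply/funext => n; elim: n {-2}n (leqnn n) => [|N IH] n.
  by rewrite leqn0 => /eqP ->.
case: n => // n nN; apply: (@mulrn_inj R V _ _ n).
have := congr1 (fun f => f n) hu; have := congr1 (fun f => f n) hu'.
rewrite /fps_deriv /= => -> ->; apply: fps_mul_coef_eq => // i ile.
by apply: IH; rewrite (leq_trans ile).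
Qed.


Lemma fexp_magnus_deriv B : fps_deriv (fexp (magnus B)) = B * fexp (magnus B).
Proof.
rewrite fexp_deriv ?magnus0 // magnus_deriv fpsi_comp ?magnus0 //.
by rewrite cphiK fpsi_1 ?magnus0.
Qed.

Lemma fexp_magnus B u : fps_deriv u = B * u -> u 0%N = 1 -> fexp (magnus B) = u.
Proof.
by move=> hu u0; apply: (fps_ode_unique (fexp_magnus_deriv B) hu); rewrite fexp_coef0.
Qed.
End Magnus.

Section Inner.
Variables (R : numFieldType) (V : algType R) (X Y : V).
Local Notation psi := fpsi.
Local Notation cexpo := (cexpo R).
Local Notation cphi := (cphi R).
Local Notation dphi := (dphi R).
Local Notation ephi := (ephi R).

(** Z times the series variable. *)
Definition tau (Z : V) : fps V := fps_shift (fps_const Z).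
Lemma tau0 Z : tau Z 0%N = 0. Proof. by []. Qed.
Lemma tauN Z : tau (- Z) = - tau Z.
Proof. by apply/funext => -[|[|n]]; rewrite fps_oppE /= ?oppr0. Qed.
Lemma tauD Z Z' : tau (Z + Z') = tau Z + tau Z'.
Proof. by apply/funext => -[|[|n]]; rewrite fps_addE /= ?addr0. Qed.
Lemma tau_deriv Z : fps_deriv (tau Z) = fps_const Z.
Proof. by rewrite fps_deriv_shift fps_deriv_const; apply/funext => -[|[|n]]; rewrite fps_addE /= ?addr0. Qed.

Lemma fad_tau_const Z : fad (tau Z) (fps_const Z) = 0.
Proof. by rewrite /fad fps_shiftMl fps_shiftMr subrr. Qed.

Lemma fexp_tau_deriv Z : fps_deriv (fexp (tau Z)) = fps_const Z * fexp (tau Z).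
Proof.
rewrite fexp_deriv // tau_deriv fpsi_fix ?fad_tau_const //.
by rewrite cphiE (_ : 1`! = 1%N) // invr1 scale1r.
Qed.

(* In the series variable [tau], [inH] is [log (exp (tau X) * exp (tau Y))], [inB] its
   logarithmic derivative and [inG] its derivative. *)
Definition inB : fps V := fps_const X + psi cexpo (tau X) (fps_const Y).
Definition inH : fps V := magnus inB.
Definition inG : fps V := psi dphi inH inB.
Definition inv : fps V := psi ephi inH inB.
Definition inp : fps V := psi cphi (tau X) (fps_const Y - psi cexpo (tau Y) inv).
Definition inq : fps V := psi cphi (tau Y) inv.

Lemma inH0 : inH 0%N = 0. Proof. exact: magnus0. Qed.

Lemma fexp_inH : fexp inH = fexp (tau X) * fexp (tau Y).
Proof.
apply: fexp_magnus; last by rewrite fps_mulE big_ord_recl big_ord0 !fexp_coef0 // mul1r addr0.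
rewrite fps_derivM !fexp_tau_deriv /inB mulrDl !mulrA; congr (_ + _).
by rewrite fexp_ad.
Qed.

Lemma fpsi_expE (Z : V) m : psi cexpo (tau Z) m = m + fad (tau Z) (psi cphi (tau Z) m).
Proof.
rewrite -fpsi_shift // -{2}[m](fpsi_1 (tau0 Z)).
have -> : fps_shift cphi = cexpo - 1 by rewrite fexpo_phi addrC addKr.
by rewrite fpsi_subl // addrC subrK.
Qed.

(* [inv] is chosen so that [inB - inG = Ad (exp inH) inv - inv], which is a sum of brackets
   with [tau X] and [tau Y]. *)
Lemma inGE : inG = fps_const X + fps_const Y + fad (tau X) inp - fad (tau Y) inq.
Proof.
have h : inB - inG = psi cexpo (tau X) (psi cexpo (tau Y) inv) - inv.
  rewrite -{1}[inB](fpsi_1 inH0) /inG -fpsi_subl ?inH0 // -ephiE.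
  rewrite -fpsi_comp ?inH0 // -/inv fpsi_subl ?inH0 // fpsi_1 ?inH0 //.
  congr (_ - _); rewrite !fpsi_exp ?inH0 // fexp_inH.
  have -> : fexp (- inH) = fexp (- tau Y) * fexp (- tau X).
    rewrite -[LHS]mulr1 -(fexpN (tau0 X)) -[X in _ * (X * _)]mulr1.
    rewrite -(fexpN (tau0 Y)) !mulrA -[X in X * _ * _]mulrA -fexp_inH.
    by rewrite fexpNl ?inH0 // mul1r.
  by rewrite !mulrA.
have -> : inG = inB - (psi cexpo (tau X) (psi cexpo (tau Y) inv) - inv).
  by rewrite -h opprB addrC subrK.
have e : psi cexpo (tau X) (fps_const Y) - psi cexpo (tau X) (psi cexpo (tau Y) inv)
   = fps_const Y - psi cexpo (tau Y) inv + fad (tau X) inp.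
  by rewrite -fpsiB // fpsi_expE.
have -> : inB = fps_const X + (fps_const Y - psi cexpo (tau Y) inv + fad (tau X) inp
    + psi cexpo (tau X) (psi cexpo (tau Y) inv)) by rewrite -e subrK.
rewrite [X in _ - X + _]fpsi_expE -/inq; nc_ring.
Qed.
End Inner.

(** * exp (a + b) as a product of conjugates of exp a and exp b *)

(* Sets the outer variable [tau] equal to the inner variable [t]. *)
HB.lock Definition fsub (V : nzRingType) (f : fps (fps V)) : fps V :=
  fun n => \sum_(j < n.+1) f j (n - j)%N.
Lemma fsubE (V : nzRingType) (f : fps (fps V)) n :
  fsub f n = \sum_(j < n.+1) f j (n - j)%N.
Proof. by rewrite fsub.unlock. Qed.

Section Substitution.
Variables (R : numFieldType) (V : algType R).
Implicit Types (f g : fps (fps V)).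

Lemma fsubD f g : fsub (f + g) = fsub f + fsub g.
Proof. by apply/funext => n; rewrite fps_addE !fsubE -big_split. Qed.
Lemma fsubN f : fsub (- f) = - fsub f.
Proof. by apply/funext => n; rewrite fps_oppE !fsubE -sumrN. Qed.
Lemma fsub_const (x : fps V) : fsub (fps_const x : fps (fps V)) = x.
Proof.
apply/funext => n; rewrite !fsubE big_ord_recl /= subn0 big1 ?addr0 //.
Qed.
Lemma fsub_shift f : fsub (fps_shift f) = fps_shift (fsub f).
Proof.
apply/funext => -[|n]; first by rewrite !fsubE big_ord_recl /= add0r big_ord0.
rewrite [LHS]fsubE big_ord_recl /= fps_0E add0r fsubE.
by apply: eq_bigr => i _; rewrite /bump /= add1n subSS.
Qed.

Lemma fsubM f g : fsub (f * g) = fsub f * fsub g.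
Proof.
pose y f : nat -> fps V := fun j => iter j (@fps_shift V) (f j).
have shE k (h : fps V) n : iter k (@fps_shift V) h n = if (n < k)%N then 0 else h (n - k)%N.
  elim: k n => [|k IH] [|n] //=; by rewrite IH subSS ltnS.
have oy h : ford (y h) by move=> j i ij; rewrite /y shE ij.
have fE h : fsub h = fsum (y h).
  apply/funext => n; rewrite !fsubE fsum_coef; apply: eq_bigr => j _.
  by rewrite /y shE ltnNge -ltnS ltn_ord.
rewrite !fE fsumM //; apply: eq_fsum => n.
rewrite /y fps_mulE.
have -> : iter n (@fps_shift V) (\sum_(i < n.+1) f i * g (n - i)%N) =
  \sum_(i < n.+1) iter n (@fps_shift V) (f i * g (n - i)%N).
  apply: (big_morph (iter n (@fps_shift V))).
    by move=> u v; elim: n => //= n ->; rewrite fps_shiftD.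
  by elim: n => //= n ->; apply/funext => -[].
apply: eq_bigr => i _.
have shM a b (u v : fps V) : iter a (@fps_shift V) u * iter b (@fps_shift V) v
   = iter (a + b) (@fps_shift V) (u * v).
  elim: a => [|a IH]; last by rewrite /= fps_shiftMl IH.
  by elim: b => //= b IH; rewrite fps_shiftMr IH.
by rewrite shM subnKC // -ltnS.
Qed.

Lemma fsub1 : fsub (1 : fps (fps V)) = 1. Proof. exact: fsub_const. Qed.
Lemma fsubX f n : fsub (f ^+ n) = fsub f ^+ n.
Proof. by elim: n => [|n IH]; rewrite ?expr0 ?fsub1 // !exprS fsubM IH. Qed.

Lemma fsub_coef0 f : fsub f 0%N = f 0%N 0%N.
Proof. by rewrite !fsubE big_ord_recl big_ord0 addr0. Qed.

Lemma fsub_fexp f : f 0%N = 0 -> fsub (fexp f) = fexp (fsub f).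
Proof.
move=> f0; have sf0 : fsub f 0%N = 0 by rewrite fsub_coef0 f0.
apply/funext => m; rewrite fsubE !fexpE.
transitivity (\sum_(j < m.+1) \sum_(n < m.+1) (cexpo R n *: (f ^+ n) j (m - j)%N)).
  apply: eq_bigr => j _; rewrite (@fsumE _ _ _ j m.+1) //; last exact: ford_pow.
  by rewrite fps_sumE.
rewrite exchange_big fsum_coef; apply: eq_bigr => n _.
by rewrite fps_scaleE -fsubX !fsubE scaler_sumr.
Qed.
End Substitution.

Section Average.
Variables (R : numFieldType) (V : algType R).
Implicit Types (f g : fps V).
Definition favg k f : fps V := fun n => (n + k)%:R^-1 *: f n.
Lemma favgD k f g : favg k (f + g) = favg k f + favg k g.
Proof. by apply/funext => n; rewrite /favg !fps_addE /favg scalerDr. Qed.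
Lemma favgN k f : favg k (- f) = - favg k f.
Proof. by apply/funext => n; rewrite /favg !fps_oppE /favg scalerN. Qed.
Lemma favg_const x : favg 1 (fps_const x) = fps_const x.
Proof.
apply/funext => -[|n]; rewrite /favg /= ?scaler0 //.
by rewrite add0n invr1 scale1r.
Qed.
Lemma favg_shift f : favg 1 (fps_shift f) = fps_shift (favg 2 f).
Proof.
apply/funext => -[|n]; rewrite /favg /= ?scaler0 //.
by rewrite addn2 addn1.
Qed.
Lemma fconst_mulE x f n : (fps_const x * f) n = x * f n.
Proof.
rewrite fps_mulE big_ord_recl subn0 /= big1 ?addr0 // => i _.
by rewrite mul0r.
Qed.
Lemma fmul_constE x f n : (f * fps_const x) n = f n * x.
Proof.
rewrite fps_mulE big_ord_recr subnn /= big1 ?add0r // => i _.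
by case E : (n - i)%N => [|k] /=; rewrite ?mulr0 //; have := ltn_ord i; lia.
Qed.
Lemma favg_fad_const k x f : favg k (fad (fps_const x) f) = fad (fps_const x) (favg k f).
Proof.
apply/funext => n; rewrite /favg /fad !fps_addE !fps_oppE !fconst_mulE !fmul_constE.
by rewrite scalerBr scalerAr scalerAl.
Qed.
Lemma fad_tau x f : fad (tau x) f = fps_shift (fad (fps_const x) f).
Proof. by rewrite /fad /tau fps_shiftMl fps_shiftMr fps_shiftD fps_shiftN. Qed.
Lemma favg_integ f : fps_integ f = fps_shift (favg 1 f).
Proof. by apply/funext => -[|n] //=; rewrite /favg addn1. Qed.
Implicit Types (H r ri : fps V).
Lemma fexp_conj H r ri : r * ri = 1 -> ri * r = 1 -> H 0%N = 0 ->
  fexp (r * H * ri) = r * fexp H * ri.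
Proof.
move=> rri rir H0.
have pw n : (r * H * ri) ^+ n = r * H ^+ n * ri.
  elim: n => [|n IH]; first by rewrite !expr0 mulr1.
  by rewrite !exprS IH !mulrA -[_ * ri * r]mulrA rir mulr1.
apply/funext => n; rewrite !fexpE.
rewrite (@fps_mul_coef_eq _ _ _ (r * \sum_(j < n.+1) cexpo R j *: H ^+ j) _ ri) //.
  rewrite mulr_sumr mulr_suml fps_sumE fsum_coef; apply: eq_bigr => j _.
  by rewrite pw -scalerAr -scalerAl.
move=> i ile; apply: fps_mul_coef_eq => // k ki.
rewrite fps_sumE (@fsumE _ _ _ k n.+1) //; first exact: ford_pow.
by rewrite ltnS (leq_trans ki).
Qed.

End Average.

Section Rouviere.
Variables (R : numFieldType) (V : algType R).
Implicit Types (X Y r s : fps V) (a b : V).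
Local Notation psi := fpsi.
Local Notation cexpo := (cexpo R).
Local Notation cphi := (cphi R).
Local Notation dphi := (dphi R).

(* [t * rW X Y = log (exp (t X) * exp (t Y))] for [X] and [Y] depending on [t]: it is the
   integral over [tau] in [0, t] of [inG X Y], and averaging divides it by [t]. *)
Definition tX X : fps V := fps_shift X.
Definition rW X Y : fps V := fsub (favg 1 (inG X Y)).
Definition rP X Y : fps V := fsub (favg 2 (inp X Y)).
Definition rQ X Y : fps V := fsub (favg 2 (inq X Y)).
(** Since [dphi] inverts [cphi], Ad (exp (t Y)) moves [rSig] by exactly [t Y, rQ], the last term of
    [rWE]. [rRho] does the same for [t X, rP] and absorbs what Ad (exp (t X)) makes of the Y
    part. *)
Definition rSig X Y : fps V := psi dphi (tX Y) (rQ X Y).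
Definition rRho X Y : fps V :=
  Y - fad (tX Y) (rQ X Y) - psi dphi (tX X) (rP X Y).

Lemma fsub_tau X : fsub (tau X) = tX X.
Proof. by rewrite fsub_shift fsub_const. Qed.

Lemma tX0 X : tX X 0%N = 0. Proof. by []. Qed.

Lemma fexp_rW X Y : fexp (tX (rW X Y)) = fexp (tX X) * fexp (tX Y).
Proof.
have -> : tX (rW X Y) = fsub (inH X Y).
  rewrite /inH magnusE favg_integ fsub_shift /rW /inG /tX.
  by [].
rewrite -(fsub_fexp (inH0 X Y)) fexp_inH fsubM.
by rewrite !fsub_fexp ?fsub_tau.
Qed.

Lemma rWE X Y : rW X Y = X + Y + fad (tX X) (rP X Y) - fad (tX Y) (rQ X Y).
Proof.
have fadE Z m : fsub (favg 1 (fad (tau Z) m)) = fad (tX Z) (fsub (favg 2 m)).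
  rewrite fad_tau favg_shift favg_fad_const fsub_shift /fad fsubD fsubN !fsubM fsub_const.
  by rewrite /tX fps_shiftMl fps_shiftMr fps_shiftD fps_shiftN.
rewrite /rW inGE /rP /rQ -!fadE.
move: (fad (tau X) _) (fad (tau Y) _) => u w.
by rewrite !favgD favgN !favg_const !fsubD fsubN !fsub_const.
Qed.

Lemma fpsi_expE' (H m : fps V) : H 0%N = 0 ->
  psi cexpo H m = m + fad H (psi cphi H m).
Proof.
move=> H0; rewrite -fpsi_shift // -{2}[m](fpsi_1 H0).
have -> : fps_shift cphi = cexpo - 1 by rewrite fexpo_phi addrC addKr.
by rewrite fpsi_subl // addrC subrK.
Qed.

(** The left side is the logarithmic derivative of exp (t X) exp (t Y) when X and Y move by X' =
    [rho, X] and Y' = [sig, Y]. Its equality with [rW], the logarithm divided by t, forces [rW] to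
    be constant by [log_deriv_unique]. *)
Lemma velocity X Y (rho := rRho X Y) (sig := rSig X Y) (Ad := fun Z => psi cexpo (tX Z)) :
  X + rho - Ad X rho + Ad X (Y + sig - Ad Y sig) = rW X Y.
Proof.
have e1 : Ad Y sig - sig = fad (tX Y) (rQ X Y).
  rewrite /Ad fpsi_expE' // addrC addKr /sig /rSig fpsi_comp // cphiK.
  by rewrite fpsi_1.
have -> : Y + sig - Ad Y sig = Y - fad (tX Y) (rQ X Y) by rewrite -e1; nc_ring.
set Y1 := Y - _; have -> : rho = Y1 - psi dphi (tX X) (rP X Y) by [].
rewrite rWE /Ad fpsiB // !fpsi_expE' // [psi cphi _ (psi dphi _ _)]fpsi_comp // cphiK fpsi_1 //.
rewrite /Y1; nc_ring.
Qed.

(** By [fexp_deriv] the logarithmic derivative of exp (t W) is W + phi (ad (t W)) (t W'), so the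
    second term vanishes, and phi (ad (t W)) is inverted by [dphi]. *)
Lemma log_deriv_unique (W : fps V) : fps_deriv (fexp (tX W)) = W * fexp (tX W) ->
  fps_deriv W = 0.
Proof.
move=> h; have := h; rewrite fexp_deriv // fps_deriv_shift fpsiD // mulrDl.
rewrite (fpsi_fix _ (tX0 W)); last by rewrite /fad /tX fps_shiftMl fps_shiftMr subrr.
rewrite cphiE (_ : 1`! = 1%N) // invr1 scale1r => /eqP.
rewrite -subr_eq0 addrC addKr => /eqP h2.
have h3 : psi cphi (tX W) (fps_shift (fps_deriv W)) = 0.
  by rewrite -[LHS]mulr1 -(fexpN (tX0 W)) mulrA h2 mul0r.
have : psi dphi (tX W) (psi cphi (tX W) (fps_shift (fps_deriv W))) = 0.
  by rewrite h3 fpsi_0.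
rewrite fpsi_comp // fps_mulC cphiK fpsi_1 // => h4.
by apply/funext => n; have := congr1 (fun f => f n.+1) h4.
Qed.

Lemma fad_ode_unique (rho X X' : fps V) : fps_deriv X = fad rho X -> fps_deriv X' = fad rho X' ->
  X 0%N = X' 0%N -> X = X'.
Proof.
move=> hu hu' h0; apply/funext => n; elim: n {-2}n (leqnn n) => [|N IH] n.
  by rewrite leqn0 => /eqP ->.
case: n => // n nN; apply: (@mulrn_inj R V _ _ n).
have := congr1 (fun f => f n) hu; have := congr1 (fun f => f n) hu'.
have IH' i : (i <= n)%N -> X i = X' i by move=> ile; apply: IH; rewrite (leq_trans ile).
rewrite /fps_deriv /= => -> ->; exact: (@iter_fad_coef_eq _ _ 1).
Qed.

(** The product r * ri satisfies u' = [rho, u], as the constant 1 does; the derivative of ri * r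
    cancels outright. *)
Lemma ode_inverse (rho r ri : fps V) : r 0%N = 1 -> ri 0%N = 1 -> fps_deriv r = rho * r ->
  fps_deriv ri = - (ri * rho) -> r * ri = 1 /\ ri * r = 1.
Proof.
move=> r0 ri0 dr dri; split.
  apply: (@fad_ode_unique rho).
  - rewrite fps_derivM dr dri /fad; nc_ring.
  - by rewrite fps_deriv_const /fad mulr1 mul1r subrr.
  - by rewrite fps_mulE big_ord_recl big_ord0 r0 ri0 mulr1 addr0.
apply: fps_deriv_inj.
  rewrite fps_derivM dr dri fps_deriv_const; nc_ring.
by rewrite fps_mulE big_ord_recl big_ord0 r0 ri0 mulr1 addr0.
Qed.

(* [X = Ad r a] and [Y = Ad s b] move so that [log (exp (t X) * exp (t Y)) / t] stays equal
   to its value [a + b] at [t = 0]. *)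
Theorem rouviere_formal a b X Y (r ri s si : fps V) (rho := rRho X Y) (sig := rSig X Y) :
  X 0%N = a -> fps_deriv X = fad rho X ->
  Y 0%N = b -> fps_deriv Y = fad sig Y ->
  r 0%N = 1 -> ri 0%N = 1 -> fps_deriv r = rho * r -> fps_deriv ri = - (ri * rho) ->
  s 0%N = 1 -> si 0%N = 1 -> fps_deriv s = sig * s -> fps_deriv si = - (si * sig) ->
  fexp (tau (a + b)) = r * fexp (tau a) * ri * (s * fexp (tau b) * si).
Proof.
move=> X0 dX Y0 dY r0 ri0 dr dri s0 si0 ds dsi.
have [rri rir] := ode_inverse r0 ri0 dr dri.
have [ssi sis] := ode_inverse s0 si0 ds dsi.
(* A solution of Z' = [eta, Z] is its initial value conjugated by the flow q of eta. *)
have XE (c : V) (Z q qi eta : fps V) : q 0%N = 1 -> qi 0%N = 1 -> q * qi = 1 -> qi * q = 1 ->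
    fps_deriv q = eta * q -> fps_deriv qi = - (qi * eta) ->
    Z 0%N = c -> fps_deriv Z = fad eta Z -> Z = q * fps_const c * qi.
  move=> q0 qi0 qqi qiq dq dqi Z0 dZ; apply: (fad_ode_unique dZ).
    rewrite !fps_derivM dq dqi fps_deriv_const /fad; nc_ring.
  by rewrite Z0 !fps_mulE !big_ord_recl !big_ord0 fps_mulE big_ord_recl big_ord0 q0 qi0 /= mul1r !addr0 mulr1.
have EX : fexp (tX X) = r * fexp (tau a) * ri.
  by rewrite -fexp_conj // (XE a X r ri rho) // /tX /tau !fps_shiftMr !fps_shiftMl.
have EY : fexp (tX Y) = s * fexp (tau b) * si.
  by rewrite -fexp_conj // (XE b Y s si sig) // /tX /tau !fps_shiftMr !fps_shiftMl.
(* Differentiating q exp (t c) qi gives the constant part Z and the two contributions of q and qi,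
   the latter moved to the left of the exponential by [fexp_ad]. *)
have dE (c : V) (Z q qi eta : fps V) : Z = q * fps_const c * qi -> q * qi = 1 -> qi * q = 1 ->
   fps_deriv q = eta * q -> fps_deriv qi = - (qi * eta) ->
   fexp (tX Z) = q * fexp (tau c) * qi ->
   fps_deriv (fexp (tX Z)) = (Z + eta - psi cexpo (tX Z) eta) * fexp (tX Z).
  move=> ZE qqi qiq dq dqi E.
  have -> : (Z + eta - psi cexpo (tX Z) eta) * fexp (tX Z) =
     Z * fexp (tX Z) + eta * fexp (tX Z) - fexp (tX Z) * eta.
    by rewrite mulrBl mulrDl -fexp_ad.
  have -> : Z * fexp (tX Z) = q * (fps_const c * fexp (tau c)) * qi.
    by rewrite E ZE !mulrA -[X in X * fexp _]mulrA qiq mulr1.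
  rewrite E !fps_derivM dq dqi fexp_tau_deriv; nc_ring.
have dx := dE _ _ _ _ _ (XE a X r ri rho r0 ri0 rri rir dr dri X0 dX) rri rir dr dri EX.
have dy := dE _ _ _ _ _ (XE b Y s si sig s0 si0 ssi sis ds dsi Y0 dY) ssi sis ds dsi EY.
have W0 : rW X Y 0%N = a + b.
  rewrite rWE !fps_addE fps_oppE X0 Y0.
  by rewrite !(@fad_ord _ _ _ _ 0) // subr0 addr0.
have WE : rW X Y = fps_const (a + b).
  apply: fps_deriv_inj => //; rewrite fps_deriv_const; apply: log_deriv_unique.
  rewrite fexp_rW fps_derivM dx dy -velocity -/rho -/sig.
  rewrite [in RHS]mulrDl; congr (_ + _); first by rewrite mulrA.
  by rewrite !mulrA -fexp_ad // mulrA.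
by rewrite -EX -EY -fexp_rW WE.
Qed.

(** One Picard step for the flow of [rouviere_formal], written on coefficients; pairs are used
    because the equations for X and Y are coupled. *)
Definition rSys a b (Z : nat -> V * V) : nat -> V * V :=
  let X : fps V := fun n => (Z n).1 in let Y : fps V := fun n => (Z n).2 in
  fun n => if n is m.+1 then
     (m.+1%:R^-1 *: fad (rRho X Y) X m, m.+1%:R^-1 *: fad (rSig X Y) Y m) else (a, b).
End Rouviere.

(** Agreement up to degree n in the inner variable has to be carried through series with
    coefficients in [fps V]. An abstract relation, lifted coefficientwise by [fps_congr], does this
    once for all the constructions. *)
Record alg_congr (R : numFieldType) (V : algType R) (E : V -> V -> Prop) : Prop := AlgCongr {
  congr_refl : forall x, E x x;
  congrD : forall x x' y y', E x x' -> E y y' -> E (x + y) (x' + y');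
  congrM : forall x x' y y', E x x' -> E y y' -> E (x * y) (x' * y');
  congrZ : forall (a : R) x x', E x x' -> E (a *: x) (a *: x') }.

Definition fps_congr (V : Type) (E : V -> V -> Prop) (f g : fps V) := forall n, E (f n) (g n).

Section Congruence.
Variables (R : numFieldType) (V : algType R).


Variables (E : V -> V -> Prop) (EP : alg_congr E).
Implicit Types (f g H B m : fps V).
Let FE := fps_congr E.

Lemma congrN x x' : E x x' -> E (- x) (- x').
Proof. by rewrite -!scaleN1r; apply: congrZ. Qed.
Lemma congr_sum I (r : seq I) (P : pred I) (F F' : I -> V) :
  (forall i, P i -> E (F i) (F' i)) ->
  E (\sum_(i <- r | P i) F i) (\sum_(i <- r | P i) F' i).
Proof. move=> h; elim/big_ind2: _ => [|x x' y y'|i Pi].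
- exact: (congr_refl EP).
- exact: (congrD EP).
- exact: h. Qed.

Lemma fps_congrP : alg_congr FE.
Proof.
split=> [f n|f f' g g' ff gg n|f f' g g' ff gg n|a f f' ff n].
- exact: congr_refl.
- exact: congrD.
- by rewrite !fps_mulE; apply: congr_sum => i _; apply: congrM.
- exact: congrZ.
Qed.

Lemma fps_congrN f f' : FE f f' -> FE (- f) (- f').
Proof. by move=> ff n; apply: congrN. Qed.
Lemma congr_fad H H' m m' : FE H H' -> FE m m' -> FE (fad H m) (fad H' m').
Proof.
move=> HH mm; apply: (congrD fps_congrP); last apply: fps_congrN.
  exact: (congrM fps_congrP).
exact: (congrM fps_congrP).
Qed.
Lemma congr_psi c H H' m m' : FE H H' -> FE m m' -> FE (fpsi c H m) (fpsi c H' m').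
Proof.
move=> HH mm n; rewrite !fpsiE !fsum_coef.
apply: congr_sum => j _; apply: (congrZ EP).
case: j => j /= _; move: n; elim: j => //= k IH; exact: congr_fad.
Qed.
Lemma congr_shift f f' : FE f f' -> FE (fps_shift f) (fps_shift f').
Proof. by move=> ff [|n] /=; [exact: congr_refl|]. Qed.
Lemma congr_const x x' : E x x' -> FE (fps_const x) (fps_const x').
Proof. by move=> xx [|n] //=; exact: congr_refl. Qed.
Lemma congr_integ f f' : FE f f' -> FE (fps_integ f) (fps_integ f').
Proof. by move=> ff [|n] /=; [exact: congr_refl|exact: congrZ]. Qed.
Lemma congr_favg k f f' : FE f f' -> FE (favg k f) (favg k f').
Proof. by move=> ff n; apply: congrZ. Qed.
Lemma congr_magnus B B' : FE B B' -> FE (magnus B) (magnus B').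
Proof.
move=> BB n; rewrite /magnus /ffix.
have h j : FE (iter j (fun H : fps V => fps_integ (fpsi (dphi R) H B)) (fun=> 0))
   (iter j (fun H : fps V => fps_integ (fpsi (dphi R) H B')) (fun=> 0)).
  elim: j => [|j IH] /=; first by move=> ?; exact: congr_refl.
  by apply: congr_integ; apply: congr_psi.
exact: h.
Qed.
End Congruence.

Section RouviereSystem.
Variables (R : numFieldType) (V : algType R).
Implicit Types (X Y f : fps V).

(* The flow of [rouviere_formal] exists because its right-hand side is causal: coefficient [n]
   depends only on the coefficients of [X] and [Y] up to [n]. *)
Definition prefix_eq n f g := forall i, (i <= n)%N -> f i = g i.

Lemma prefix_congr n : alg_congr (prefix_eq n).
Proof.
split=> [f i _ //|f f' g g' ff gg i ile|f f' g g' ff gg i ile|a f f' ff i ile].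
- by rewrite !fps_addE ff ?gg.
- by apply: fps_mul_coef_eq => k ki; [apply: ff|apply: gg]; apply: leq_trans ile.
- by rewrite !fps_scaleE ff.
Qed.

Lemma congr_fsub n (f f' : fps (fps V)) : fps_congr (prefix_eq n) f f' ->
  prefix_eq n (fsub f) (fsub f').
Proof.
move=> ff i ile; rewrite !fsubE; apply: eq_bigr => j _; apply: ff.
by rewrite (leq_trans (leq_subr _ _)).
Qed.

Lemma prefix_shift n f f' : prefix_eq n f f' -> prefix_eq n (fps_shift f) (fps_shift f').
Proof. by move=> ff [|i] //= ile; apply: ff; apply: ltnW. Qed.
Lemma prefix_psi n c H H' m m' : prefix_eq n H H' -> prefix_eq n m m' ->
  prefix_eq n (fpsi c H m : fps V) (fpsi c H' m').
Proof.
move=> HH mm i ile; apply: fpsi_coef_eq => k ki; [apply: HH|apply: mm];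
  exact: leq_trans ile.
Qed.
Lemma prefix_fad n H H' m m' : prefix_eq n H H' -> prefix_eq n m m' ->
  prefix_eq n (fad H m : fps V) (fad H' m').
Proof.
move=> HH mm; have P := prefix_congr n.
apply: (congrD P); first exact: (congrM P).
by apply: (congrN P); apply: (congrM P).
Qed.

Section Causal.
Variables (n : nat) (X X' Y Y' : fps V).
Hypotheses (XX : prefix_eq n X X') (YY : prefix_eq n Y Y').
Let P := prefix_congr n.
Let FE := fps_congr (prefix_eq n).

Let tauXX : FE (tau X) (tau X').
Proof. by apply: (congr_shift P); apply: (congr_const P). Qed.
Let tauYY : FE (tau Y) (tau Y').
Proof. by apply: (congr_shift P); apply: (congr_const P). Qed.
Let BB : FE (inB X Y) (inB X' Y').
Proof.
apply: (congrD (fps_congrP P)); first exact: (congr_const P).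
by apply: (congr_psi P) => //; apply: (congr_const P).
Qed.
Let vv : FE (inv X Y) (inv X' Y').
Proof. by apply: (congr_psi P) => //; apply: (congr_magnus P). Qed.

Lemma prefix_rP : prefix_eq n (rP X Y) (rP X' Y').
Proof.
apply: congr_fsub; apply: (congr_favg P); apply: (congr_psi P) => //.
apply: (congrD (fps_congrP P)); first exact: (congr_const P).
by apply: (fps_congrN P); apply: (congr_psi P).
Qed.
Lemma prefix_rQ : prefix_eq n (rQ X Y) (rQ X' Y').
Proof.
by apply: congr_fsub; apply: (congr_favg P); apply: (congr_psi P).
Qed.
Lemma prefix_rSig : prefix_eq n (rSig X Y) (rSig X' Y').
Proof. by apply: prefix_psi; [apply: prefix_shift|exact: prefix_rQ]. Qed.
Lemma prefix_rRho : prefix_eq n (rRho X Y) (rRho X' Y').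
Proof.
apply: (congrD P); first apply: (congrD P) => //.
  by apply: (congrN P); apply: prefix_fad; [apply: prefix_shift|exact: prefix_rQ].
by apply: (congrN P); apply: prefix_psi; [apply: prefix_shift|exact: prefix_rP].
Qed.
End Causal.

Variables (a b : V).
Definition rSol : nat -> V * V := ffix (0, 0) (rSys a b).
Definition rX : fps V := fun n => (rSol n).1.
Definition rY : fps V := fun n => (rSol n).2.

Lemma rSys_causal (f g : nat -> V * V) n : (forall i, (i < n)%N -> f i = g i) ->
  rSys a b f n = rSys a b g n.
Proof.
case: n => // n fg; rewrite /rSys.
set X : fps V := fun n => (f n).1; set X' : fps V := fun n => (g n).1.
set Y : fps V := fun n => (f n).2; set Y' : fps V := fun n => (g n).2.
have XX : prefix_eq n X X' by move=> i ile; rewrite /X /X' fg.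
have YY : prefix_eq n Y Y' by move=> i ile; rewrite /Y /Y' fg.
congr (_ *: _, _ *: _).
  exact: (prefix_fad (prefix_rRho XX YY) XX (leqnn n)).
exact: (prefix_fad (prefix_rSig XX YY) YY (leqnn n)).
Qed.

Lemma rXE : rX 0%N = a /\ fps_deriv rX = fad (rRho rX rY) rX.
Proof.
have E := ffixE (0, 0) rSys_causal; rewrite -/rSol in E.
split; first by rewrite /rX -E.
apply/funext => n; rewrite /fps_deriv {1}/rX -E /= -scaler_nat scalerA.
by rewrite mulfV ?pnatr_eq0 // scale1r.
Qed.
Lemma rYE : rY 0%N = b /\ fps_deriv rY = fad (rSig rX rY) rY.
Proof.
have E := ffixE (0, 0) rSys_causal; rewrite -/rSol in E.
split; first by rewrite /rY -E.
apply/funext => n; rewrite /fps_deriv {1}/rY -E /= -scaler_nat scalerA.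
by rewrite mulfV ?pnatr_eq0 // scale1r.
Qed.
End RouviereSystem.

Section LinearOde.
Variables (R : numFieldType) (V : algType R).
Lemma fexp_magnusN_deriv (B : fps V) :
  fps_deriv (fexp (- magnus B)) = - (fexp (- magnus B) * B).
Proof.
set L := magnus B; have L0 : L 0%N = 0 by rewrite /L magnus0.
have h : fps_deriv (fexp L * fexp (- L)) = 0.
  by rewrite fexpN // (fps_deriv_const (1 : V)).
have e : fexp L * fps_deriv (fexp (- L)) = - (B * (fexp L * fexp (- L))).
  apply/eqP; rewrite -addr_eq0 addrC mulrA -fexp_magnus_deriv -fps_derivM.
  exact/eqP.
rewrite -[LHS]mul1r -(fexpNl L0) -mulrA e fexpN // mulr1.
by rewrite mulrN.
Qed.

(** The flows r and s are written as exponentials of their Magnus series, so that the conjugators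
    become exponentials of elements built from brackets. *)
Theorem rouviere_fexp (a b : V) :
  let L := magnus (rRho (rX a b) (rY a b)) in
  let M := magnus (rSig (rX a b) (rY a b)) in
  fexp (tau (a + b)) =
  fexp L * fexp (tau a) * fexp (- L) * (fexp M * fexp (tau b) * fexp (- M)).
Proof.
move=> L M; have [X0 dX] := rXE a b; have [Y0 dY] := rYE a b.
have z (B : fps V) : (- magnus B) 0%N = 0 by rewrite fps_oppE magnus0 oppr0.
apply: (rouviere_formal X0 dX Y0 dY).
all: rewrite ?fexp_coef0 ?magnus0 ?z //.
all: by [exact: fexp_magnus_deriv|exact: fexp_magnusN_deriv].
Qed.
End LinearOde.

(** * Convergence at t = 1 *)

Section Weights.
Variable R : realFieldType.

(* These weights are summable and submultiplicative under convolution ([wt_conv]), so bounds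
   [k * wt n] on coefficients propagate through products and give convergence at [t = 1]. *)
Definition wt (n : nat) : R := (8 * n.+1%:R ^+ 2)^-1.
Lemma wtE n : wt n = (8 * n.+1%:R ^+ 2)^-1.
Proof. by []. Qed.

Lemma wt_gt0 n : 0 < wt n.
Proof. by rewrite /wt invr_gt0 mulr_gt0 ?exprn_gt0 ?ltr0n. Qed.
Lemma wt_ge0 n : 0 <= wt n. Proof. exact/ltW/wt_gt0. Qed.

Lemma sum_inv_sq n : \sum_(i < n) (i.+1%:R ^+ 2)^-1 <= 2 :> R.
Proof.
suff h m : \sum_(i < m.+1) (i.+1%:R ^+ 2)^-1 <= 2 - m.+1%:R^-1 :> R.
  case: n => [|n]; first by rewrite big_ord0.
  by apply: le_trans (h n) _; rewrite gerBl invr_ge0 ler0n.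
elim: m => [|m IH]; first by rewrite big_ord_recl big_ord0 /= expr1n invr1; lra.
rewrite big_ord_recr /=; apply: le_trans (lerD IH (lexx _)) _.
have m0 : 0 < m.+1%:R :> R by rewrite ltr0n.
have -> : m.+2%:R = m.+1%:R + 1 :> R by rewrite -natr1.
move: (m.+1%:R : R) m0 => x x0; rewrite -subr_ge0.
have -> : 2 - (x + 1)^-1 - (2 - x^-1 + ((x + 1) ^+ 2)^-1) = (x * (x + 1) ^+ 2)^-1.
  by field; rewrite !gt_eqF ?addr_gt0.
by rewrite invr_ge0 mulr_ge0 ?exprn_ge0 ?addr_ge0 // ltW.
Qed.

(** With x + y = n + 2, the inequality (x + y)^2 <= 2 (x^2 + y^2) bounds 1 / (x y)^2 by 2 (x + y)^-2
    (x^-2 + y^-2), and each sum of inverse squares is at most 2. The resulting constant 8 is the one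
    in [wt]. *)
Lemma wt_conv n : \sum_(i < n.+1) wt i * wt (n - i) <= wt n.
Proof.
have N0 : 0 < n.+2%:R :> R by rewrite ltr0n.
have h (i : 'I_n.+1) : wt i * wt (n - i) <=
   (32 * n.+2%:R ^+ 2)^-1 * ((i.+1%:R ^+ 2)^-1 + ((n - i).+1%:R ^+ 2)^-1).
  have -> : n.+2%:R = i.+1%:R + (n - i).+1%:R :> R.
    by rewrite -natrD; congr (_%:R); have := ltn_ord i; lia.
  rewrite /wt; set x : R := i.+1%:R; set y : R := (n - i).+1%:R.
  have x0 : 0 < x by rewrite ltr0n.
  have y0 : 0 < y by rewrite ltr0n.
  clearbody x y; rewrite -subr_ge0.
  have -> : (32 * (x + y) ^+ 2)^-1 * ((x ^+ 2)^-1 + (y ^+ 2)^-1)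
     - (8 * x ^+ 2)^-1 * (8 * y ^+ 2)^-1 =
     (x - y) ^+ 2 * (64 * (x + y) ^+ 2 * x ^+ 2 * y ^+ 2)^-1.
    by field; rewrite !gt_eqF ?addr_gt0.
  apply: mulr_ge0; first exact: sqr_ge0.
  by rewrite invr_ge0; apply: mulr_ge0 (sqr_ge0 y); apply: mulr_ge0 (sqr_ge0 x); apply: mulr_ge0 (sqr_ge0 _).
apply: le_trans (ler_sum _ (fun i _ => h i)) _.
rewrite -mulr_sumr big_split /=.
have -> : \sum_(i < n.+1) ((n - i).+1%:R ^+ 2)^-1 = \sum_(i < n.+1) (i.+1%:R ^+ 2)^-1 :> R.
  rewrite (reindex_inj rev_ord_inj) /=; apply: eq_bigr => i _.
  by rewrite subSS subKn // -ltnS.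
apply: (@le_trans _ _ ((32 * n.+2%:R ^+ 2)^-1 * 4)).
  rewrite ler_wpM2l ?invr_ge0 ?mulr_ge0 ?sqr_ge0 //.
  by have := sum_inv_sq n.+1; lra.
rewrite /wt; have -> : n.+2%:R = n.+1%:R + 1 :> R by rewrite -natr1.
have x0 : 0 < n.+1%:R :> R by rewrite ltr0n.
move: (n.+1%:R : R) x0 => x x0.
have -> : (32 * (x + 1) ^+ 2)^-1 * 4 = (8 * (x + 1) ^+ 2)^-1.
  by field; rewrite !gt_eqF ?addr_gt0.
rewrite lef_pV2 ?posrE ?mulr_gt0 ?exprn_gt0 ?addr_gt0 //.
by rewrite ler_wpM2l // ler_pXn2r ?nnegrE ?addr_ge0 ?ltW ?ltrDl.
Qed.

Lemma wtS n : wt n <= 4 * wt n.+1.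
Proof.
rewrite /wt; have -> : n.+2%:R = n.+1%:R + 1 :> R by rewrite -natr1.
have x1 : 1 <= n.+1%:R :> R by rewrite ler1n.
move: (n.+1%:R : R) x1 => x x1.
have x0 : 0 < x by lra.
rewrite -subr_ge0.
have -> : 4 * (8 * (x + 1) ^+ 2)^-1 - (8 * x ^+ 2)^-1 =
  ((x - 1) * (3 * x + 1)) * (8 * (x + 1) ^+ 2 * x ^+ 2)^-1.
  by field; rewrite !gt_eqF ?addr_gt0.
rewrite mulr_ge0 //; first by apply: mulr_ge0; lra.
by rewrite invr_ge0; apply: mulr_ge0 (sqr_ge0 x); apply: mulr_ge0 (sqr_ge0 _).
Qed.

Lemma wt0 : wt 0 = 8^-1.
Proof. by rewrite /wt expr1n mulr1. Qed.

Lemma sum_geom_le (x : R) n : 0 <= x -> x <= 2^-1 -> \sum_(i < n) x ^+ i <= 2.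
Proof.
move=> x0 x2; suff h m : \sum_(i < m) x ^+ i <= 2 - 2 * 2^-1 ^+ m.
  by apply: le_trans (h n) _; rewrite gerBl mulr_ge0 ?exprn_ge0 ?invr_ge0.
elim: m => [|m IH]; first by rewrite big_ord0 expr0 mulr1 subrr.
rewrite big_ord_recr /= exprS.
have : x ^+ m <= 2^-1 ^+ m by rewrite lerXn2r // nnegrE ?invr_ge0.
lra.
Qed.
End Weights.

Section Gauge.
Variable R : realFieldType.

(* [G x k] reads: [x] lies in a Lie subalgebra and has norm at most [k]. Only brackets are
   bounded, so that membership in the subalgebra survives evaluation of the series. *)
Record gauge (V : algType R) (G : V -> R -> Prop) : Prop := Gauge {
  gauge0 : G 0 0;
  gaugeD : forall x y k l, G x k -> G y l -> G (x + y) (k + l);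
  gaugeZ : forall a x k, G x k -> G (a *: x) (`|a| * k);
  gauge_br : forall x y k l, G x k -> G y l -> G (x * y - y * x) (2 * k * l);
  gauge_le : forall x k l, G x k -> k <= l -> G x l;
  gauge_nneg : forall x k, G x k -> 0 <= k }.

Definition fgauge (V : algType R) (G : V -> R -> Prop) (f : fps V) (k : R) : Prop :=
  0 <= k /\ forall n, G (f n) (k * wt R n).

Section GaugeTheory.
Variables (V : algType R) (G : V -> R -> Prop) (GP : gauge G).

Lemma gaugeN x k : G x k -> G (- x) k.
Proof. by move=> /(gaugeZ GP (-1)); rewrite scaleN1r normrN1 mul1r. Qed.
Lemma gauge_sum I (r : seq I) (F : I -> V) (K : I -> R) :
  (forall i, G (F i) (K i)) -> G (\sum_(i <- r) F i) (\sum_(i <- r) K i).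
Proof.
move=> h; elim: r => [|i r IH]; rewrite ?(big_nil, big_cons); first exact: gauge0 GP.
exact: (gaugeD GP).
Qed.
Lemma gauge0_le k : 0 <= k -> G 0 k.
Proof. exact: (gauge_le GP (gauge0 GP)). Qed.

(** Reversing the summation in g * f pairs the terms of f * g - g * f into brackets of coefficients,
    so only brackets are used, and [wt_conv] closes the estimate. As the result is a gauge again,
    the lift can be iterated to series of series. *)
Lemma fgaugeP : gauge (fgauge G).
Proof.
split.
- by split=> // n; rewrite mul0r; exact: gauge0 GP.
- move=> f g k l [k0 fk] [l0 gl]; split=> [|n]; first exact: addr_ge0.
  by rewrite mulrDl; apply: (gaugeD GP).
- move=> a f k [k0 fk]; split=> [|n]; first exact: mulr_ge0.
  by rewrite -mulrA; apply: (gaugeZ GP).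
- move=> f g k l [k0 fk] [l0 gl]; split=> [|n]; first by rewrite !mulr_ge0.
  have -> : (f * g - g * f) n = \sum_(i < n.+1) (f i * g (n - i)%N - g (n - i)%N * f i).
    rewrite fps_addE fps_oppE !fps_mulE sumrB; congr (_ - _).
    rewrite (reindex_inj rev_ord_inj) /=; apply: eq_bigr => i _.
    by rewrite subSS subKn // -ltnS.
  apply: (gauge_le GP).
    by apply: gauge_sum => i; apply: (gauge_br GP); [exact: fk|exact: gl].
  have -> : \sum_(i < n.+1) 2 * (k * wt R i) * (l * wt R (n - i)) =
     2 * k * l * \sum_(i < n.+1) wt R i * wt R (n - i).
    by rewrite mulr_sumr; apply: eq_bigr => i _; ring.
  by rewrite ler_wpM2l ?wt_conv // !mulr_ge0.
- move=> f k l [k0 fk] kl; split=> [|n]; first exact: le_trans kl.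
  by apply: (gauge_le GP (fk n)); rewrite ler_wpM2r ?wt_ge0.
- by move=> f k [].
Qed.

Lemma fgauge_const x k : G x k -> fgauge G (fps_const x) (8 * k).
Proof.
move=> xk; have k0 := gauge_nneg GP xk; split=> [|[|n]] /=; first exact: mulr_ge0.
  by rewrite wt0 mulrAC mulfV ?mul1r // pnatr_eq0.
by apply: gauge0_le; rewrite !mulr_ge0 ?wt_ge0.
Qed.

Lemma fgauge_shift f k : fgauge G f k -> fgauge G (fps_shift f) (4 * k).
Proof.
move=> [k0 fk]; split=> [|[|n]] /=; first exact: mulr_ge0.
  by apply: gauge0_le; rewrite !mulr_ge0 ?wt_ge0.
apply: (gauge_le GP (fk n)); rewrite [4 * k]mulrC -mulrA.
by rewrite ler_wpM2l ?wtS.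
Qed.

Lemma fgauge_favg m f k : fgauge G f k -> fgauge G (favg m f) k.
Proof.
move=> [k0 fk]; split=> // n; rewrite /favg.
apply: (gauge_le GP (gaugeZ GP _ (fk n))); rewrite ler_piMl ?mulr_ge0 ?wt_ge0 //.
rewrite ger0_norm ?invr_ge0 ?ler0n //; case: (n + m)%N => [|l].
  by rewrite invr0.
by rewrite invf_le1 ?ltr0n // ler1n.
Qed.

Lemma fgauge_integ f k : fgauge G f k -> fgauge G (fps_integ f) (4 * k).
Proof. by move=> fk; rewrite favg_integ; apply/fgauge_shift/fgauge_favg. Qed.

(** Each ad H costs a factor 2 h and coefficient j at most 2^j, so the terms decay geometrically
    with ratio 4 h <= 1/2. *)
Lemma fgauge_psi c H m h l : (forall j, `|c j| <= 2 ^+ j) ->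
  fgauge G H h -> fgauge G m l -> h <= 8^-1 -> fgauge G (fpsi c H m) (2 * l).
Proof.
move=> c2 Hh ml h8; have [h0 _] := Hh; have [l0 _] := ml.
have it j : fgauge G (iter j (fad H) m) ((2 * h) ^+ j * l).
  elim: j => [|j IH]; first by rewrite expr0 mul1r.
  by rewrite exprS -mulrA; have := gauge_br fgaugeP Hh IH.
split=> [|n]; first exact: mulr_ge0.
rewrite fpsiE fsum_coef; apply: (gauge_le GP).
  apply: gauge_sum => j; rewrite fps_scaleE; apply: (gaugeZ GP).
  by have [_] := it j; apply.
apply: (@le_trans _ _ (\sum_(j < n.+1) (4 * h) ^+ j * (l * wt R n))).
  apply: ler_sum => j _; have -> : 4 * h = 2 * (2 * h) by ring.
  rewrite [X in _ <= X * _]exprMn -!mulrA ler_wpM2r ?c2 //.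
  by rewrite !mulr_ge0 ?exprn_ge0 ?mulr_ge0 ?wt_ge0.
rewrite -mulr_suml -mulrA ler_wpM2r ?mulr_ge0 ?wt_ge0 //.
by apply: sum_geom_le; lra.
Qed.

(** The ball of radius 8 b is stable under the iteration: 8 b <= 1/8 lets [fgauge_psi] give 2 b, and
    integration costs a factor 4. *)
Lemma fgauge_magnus B b : (forall j, `|dphi R j| <= 1) ->
  fgauge G B b -> b <= 64^-1 -> fgauge G (magnus B) (8 * b).
Proof.
move=> d1 Bb b64; have [b0 _] := Bb.
have P0 : fgauge G (0 : fps V) (8 * b).
  by apply: (gauge_le fgaugeP (gauge0 fgaugeP)); rewrite mulr_ge0.
have step (H : fps V) : fgauge G H (8 * b) ->
    fgauge G (fps_integ (fpsi (dphi R) H B)) (8 * b).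
  move=> Hb; have -> : 8 * b = 4 * (2 * b) by ring.
  apply/fgauge_integ/(fgauge_psi _ Hb Bb); last by lra.
  by move=> j; apply: le_trans (d1 j) _; rewrite exprn_ege1 // ler1n.
split=> [|n]; first by rewrite mulr_ge0.
by have [_] := @ffix_ind _ 0 _ (fun f : fps V => fgauge G f (8 * b)) P0 step n.+1; apply.
Qed.
End GaugeTheory.

Lemma fgauge_fsub (V : algType R) (G : V -> R -> Prop) (GP : gauge G) f k :
  fgauge (fgauge G) f k -> fgauge G (fsub f) k.
Proof.
move=> [k0 fk]; split=> // n; rewrite fsubE.
apply: (gauge_le GP).
  by apply: (gauge_sum GP) => j; have [_] := fk j; apply.
rewrite (eq_bigr (fun j : 'I_n.+1 => k * (wt R j * wt R (n - j)))) => [|j _].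
  by rewrite -mulr_sumr ler_wpM2l ?wt_conv.
by rewrite mulrA.
Qed.

Lemma pow2_le_fact j : 2 ^+ j <= (j.+1)`!%:R :> R.
Proof.
rewrite -natrX ler_nat; elim: j => // j IH; rewrite expnS factS.
by rewrite leq_mul.
Qed.

(** In the recursion [dphiE] the coefficients of [cphi] - 1 from degree 1 on are at most 1/2, 1/4,
    ..., of total at most 1. *)
Lemma dphi_le1 n : `|dphi R n| <= 1.
Proof.
elim: n {-2}n (leqnn n) => [|N IH] n.
  by rewrite leqn0 => /eqP ->; rewrite dphi0 normr1.
case: n => [|n] nN; first by rewrite dphi0 normr1.
rewrite dphiE fps_addE fps_oppE sub0r normrN fps_mulE big_ord_recl cphi0 mul0r add0r.
apply: le_trans (ler_norm_sum _ _ _) _.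
apply: (@le_trans _ _ (\sum_(i < n.+1) 2^-1 * 2^-1 ^+ i)); last first.
  rewrite -mulr_sumr; have := @sum_geom_le R 2^-1 n.+1; rewrite invr_ge0 => /(_ _ (lexx _)).
  by move=> /(_ (ler0n _ _)); lra.
apply: ler_sum => i _; rewrite normrM lift0 subSS.
rewrite -[X in _ <= X]mulr1 ler_pM ?normr_ge0 //; last by apply: IH; lia.
rewrite fps_addE fps_oppE /= oppr0 addr0 cphiE ger0_norm ?invr_ge0 //.
by rewrite -exprS exprVn lef_pV2 ?posrE ?exprn_gt0 ?ltr0n ?fact_gt0 // pow2_le_fact.
Qed.

Lemma ephi_le n : `|ephi R n| <= 2 ^+ n.
Proof.
rewrite /ephi fps_oppE normrN fps_mulE; apply: le_trans (ler_norm_sum _ _ _) _.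
apply: (@le_trans _ _ (\sum_(i < n.+1) 1)).
  apply: ler_sum => i _; rewrite normrM -[X in _ <= X]mulr1 ler_pM ?normr_ge0 //.
    exact: dphi_le1.
  exact: dphi_le1.
by rewrite sumr_const card_ord -natrX ler_nat ltn_expl.
Qed.

Lemma le1_pow2 (x : R) n : x <= 1 -> x <= 2 ^+ n.
Proof. by move=> x1; apply: le_trans x1 _; rewrite exprn_ege1 // ler1n. Qed.
Lemma invnat_le1 n : `|n%:R^-1 : R| <= 1.
Proof.
rewrite ger0_norm ?invr_ge0 //; case: n => [|n]; first by rewrite invr0.
by rewrite invf_le1 ?ltr0n // ler1n.
Qed.

Section RouviereBounds.
Variables (V : algType R) (G : V -> R -> Prop) (GP : gauge G).
Let G1P := fgaugeP GP.
Let G2P := fgaugeP G1P.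

(** The tightest requirement is 24 k <= 1/64 for the Magnus series of [inB]; 2048^-1 is a round
    bound below it. *)
Lemma fgauge_rPQ X Y k : fgauge G X k -> fgauge G Y k -> k <= 2048^-1 ->
  fgauge G (rP X Y) (208 * k) /\ fgauge G (rQ X Y) (96 * k).
Proof.
move=> Xk Yk k1; have [k0 _] := Xk.
have co j : `|cexpo R j| <= 2 ^+ j by apply/le1_pow2/invnat_le1.
have cp j : `|cphi R j| <= 2 ^+ j by apply/le1_pow2/invnat_le1.
have cX := fgauge_const G1P Xk; have cY := fgauge_const G1P Yk.
have tX := fgauge_shift G1P cX; have tY := fgauge_shift G1P cY.
rewrite -/(tau X) in tX; rewrite -/(tau Y) in tY.
have t8 : 4 * (8 * k) <= 8^-1 by lra.
have B : fgauge (fgauge G) (inB X Y) (24 * k).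
  have := gaugeD G2P cX (fgauge_psi G1P co tX cY t8).
  by rewrite (_ : _ + _ = 24 * k) //; ring.
have H : fgauge (fgauge G) (inH X Y) (8 * (24 * k)).
  by apply: (fgauge_magnus G1P dphi_le1 B); lra.
have v : fgauge (fgauge G) (inv X Y) (2 * (24 * k)).
  by apply: (fgauge_psi G1P ephi_le H B); lra.
have q : fgauge (fgauge G) (inq X Y) (2 * (2 * (24 * k))).
  exact: (fgauge_psi G1P cp tY v t8).
have p : fgauge (fgauge G) (inp X Y) (2 * (8 * k + 2 * (2 * (24 * k)))).
  apply: (fgauge_psi G1P cp tX _ t8).
  apply: (gaugeD G2P cY); apply: (gaugeN G2P).
  exact: (fgauge_psi G1P co tY v t8).
split.
  have -> : 208 * k = 2 * (8 * k + 2 * (2 * (24 * k))) by ring.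
  by apply: (fgauge_fsub GP); apply: (fgauge_favg G1P).
have -> : 96 * k = 2 * (2 * (24 * k)) by ring.
by apply: (fgauge_fsub GP); apply: (fgauge_favg G1P).
Qed.

Lemma fgauge_rSig_rRho X Y k : fgauge G X k -> fgauge G Y k -> k <= 2048^-1 ->
  fgauge G (rSig X Y) (192 * k) /\ fgauge G (rRho X Y) (418 * k).
Proof.
move=> Xk Yk k1; have [k0 _] := Xk; have [p q] := fgauge_rPQ Xk Yk k1.
have d2 j : `|dphi R j| <= 2 ^+ j by apply/le1_pow2/dphi_le1.
have tX := fgauge_shift GP Xk; have tY := fgauge_shift GP Yk.
have t8 : 4 * k <= 8^-1 by lra.
split.
  have -> : 192 * k = 2 * (96 * k) by ring.
  exact: (fgauge_psi GP d2 tY q t8).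
apply: (gauge_le G1P).
  apply: (gaugeD G1P); last by apply/(gaugeN G1P)/(fgauge_psi GP d2 tX p t8).
  by apply: (gaugeD G1P Yk); apply/(gaugeN G1P)/(gauge_br G1P tY q).
have : k * k <= k * 2048^-1 by rewrite ler_wpM2l.
lra.
Qed.

(** The initial value takes 8 k of the 16 k. The integrated bracket is quadratic, at most 4 * 2 *
    418 * 16 * 16 k^2, which is below the other 8 k for such k. *)
Lemma fgauge_rXY a b k : G a k -> G b k -> k <= (16 * 8192)^-1 ->
  fgauge G (rX a b) (16 * k) /\ fgauge G (rY a b) (16 * k).
Proof.
move=> ak bk k1; have k0 := gauge_nneg GP ak.
pose P (Z : nat -> V * V) := fgauge G ((fun n => (Z n).1) : fps V) (16 * k) /\
  fgauge G ((fun n => (Z n).2) : fps V) (16 * k).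
have P0 : P (fun=> (0, 0)).
  by split; apply: (gauge0_le G1P); rewrite mulr_ge0.
have kk : 0 <= k * ((16 * 8192)^-1 - k) by rewrite mulr_ge0 // subr_ge0.
have F (c : V) (Z eta : fps V) : G c k -> fgauge G Z (16 * k) ->
    fgauge G eta (418 * (16 * k)) ->
    fgauge G (fps_const c + fps_integ (fad eta Z)) (16 * k).
  move=> ck Zk ek; apply: (gauge_le G1P).
    apply: (gaugeD G1P (fgauge_const GP ck)).
    by apply: (fgauge_integ GP); apply: (gauge_br G1P ek Zk).
  lra.
have step Z : P Z -> P (rSys a b Z).
  move=> [Xk Yk]; have [s r] := fgauge_rSig_rRho Xk Yk ltac:(lra).
  split.
    have := F a _ _ ak Xk r; congr (fgauge G _ _); apply/funext => -[|n].
      by rewrite fps_addE /= addr0.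
    by rewrite fps_addE /= add0r.
  have s' : fgauge G (rSig (fun n => (Z n).1) (fun n => (Z n).2)) (418 * (16 * k)).
    by apply: (gauge_le G1P s); lra.
  have := F b _ _ bk Yk s'; congr (fgauge G _ _); apply/funext => -[|n].
    by rewrite fps_addE /= addr0.
  by rewrite fps_addE /= add0r.
have h n := ffix_ind P0 step n.
split; (split=> [|n]; first by rewrite mulr_ge0).
  by have [[_ X] _] := h n.+1; apply: X.
by have [_ [_ X]] := h n.+1; apply: X.
Qed.

(** 2^16 exceeds 8 * 418 * 16, and k <= 2^-20 makes 418 * 16 k at most 1/64, as [fgauge_magnus]
    asks. *)
Lemma fgauge_rouviere a b k : G a k -> G b k -> k <= 2 ^- 20 ->
  fgauge G (magnus (rRho (rX a b) (rY a b))) (2 ^+ 16 * k) /\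
  fgauge G (magnus (rSig (rX a b) (rY a b))) (2 ^+ 16 * k).
Proof.
move=> ak bk k1; have k0 := gauge_nneg GP ak.
have [X Y] := fgauge_rXY ak bk ltac:(lra).
have [s r] := fgauge_rSig_rRho X Y ltac:(lra).
split.
  by apply: (gauge_le G1P (fgauge_magnus GP dphi_le1 r _)); lra.
by apply: (gauge_le G1P (fgauge_magnus GP dphi_le1 s _)); lra.
Qed.
End RouviereBounds.
End Gauge.

From mathcomp Require Import all_reals all_analysis.
From mathcomp Require Import complex.

Import numFieldNormedType.Exports.

Local Open Scope classical_set_scope.
Local Open Scope ring_scope.
Local Open Scope complex_scope.

(** * Norms and limits in a C*-algebra *)

Section RealNorm.
Variables (R : realType) (A : cstarAlgType R).
Implicit Types (x y z : calg A) (u v : nat -> calg A).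

Lemma rnormE x : `|x| = (rnorm x)%:C.
Proof. by rewrite /rnorm RRe_real // ger0_real // normr_ge0. Qed.
Lemma rnorm_ge0 x : 0 <= rnorm x.
Proof. by rewrite -lecR -rnormE normr_ge0. Qed.
Lemma rnorm0 : rnorm (0 : calg A) = 0.
Proof. by apply: complexI; rewrite -rnormE normr0. Qed.
Lemma rnorm_eq0 x : (rnorm x == 0) = (x == 0).
Proof. by rewrite -(inj_eq (@complexI R)) -rnormE normr_eq0. Qed.
Lemma rnormD x y : rnorm (x + y) <= rnorm x + rnorm y.
Proof. by rewrite -lecR rmorphD /= -!rnormE ler_normD. Qed.
Lemma rnormN x : rnorm (- x) = rnorm x.
Proof. by rewrite /rnorm normrN. Qed.
Lemma rnormB x y : rnorm (x - y) <= rnorm x + rnorm y.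
Proof. by rewrite -(rnormN y); exact: rnormD. Qed.
Lemma rnormBC x y : rnorm (x - y) = rnorm (y - x).
Proof. by rewrite -rnormN opprB. Qed.
Lemma rnorm_tri z x y : rnorm (x - y) <= rnorm (x - z) + rnorm (z - y).
Proof. by rewrite -{1}[x](subrK z) -addrA; exact: rnormD. Qed.
Lemma rnormM x y : rnorm (x * y) <= rnorm x * rnorm y.
Proof. by rewrite -lecR rmorphM /= -!rnormE calg_normM. Qed.
Lemma rnormZ (a : R) x : rnorm (a%:C *: x) = `|a| * rnorm x.
Proof.
by apply: complexI; rewrite rmorphM /= -!rnormE normrZ normc_def /= expr0n addr0 sqrtr_sqr.
Qed.
Lemma rnormZc (a : R[i]) x : rnorm (a *: x) = complex.Re `|a| * rnorm x.
Proof.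
apply: complexI; rewrite [RHS]rmorphM /= -!rnormE normrZ; congr (_ * _).
Qed.
Lemma rnormCstar x : rnorm (star x * x) = rnorm x ^+ 2.
Proof. by apply: complexI; rewrite rmorphXn /= -!rnormE calg_norm_star. Qed.
Lemma rnorm_star x : rnorm (star x) = rnorm x.
Proof.
have h y : rnorm y <= rnorm (star y).
  have [->|y0] := eqVneq y 0; first by rewrite rnorm0 rnorm_ge0.
  have n0 : 0 < rnorm y by rewrite lt_neqAle rnorm_ge0 andbT eq_sym rnorm_eq0.
  by rewrite -(ler_pM2r n0) -expr2 -rnormCstar rnormM.
by apply/eqP; rewrite eq_le h andbT -[X in _ <= rnorm X]starK h.
Qed.
Lemma rnorm1 : rnorm (1 : calg A) = 1.
Proof.
have := rnormCstar 1; rewrite star1 mulr1 => /esym/eqP.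
rewrite expr2 -subr_eq0 -{3}[rnorm 1]mulr1 -mulrBr mulf_eq0 rnorm_eq0 oner_eq0 /=.
by rewrite subr_eq0 => /eqP.
Qed.
Lemma rnorm_sum I (r : seq I) (P : pred I) (F : I -> calg A) :
  rnorm (\sum_(i <- r | P i) F i) <= \sum_(i <- r | P i) rnorm (F i).
Proof.
elim/big_rec2: _ => [|i x y _ h]; first by rewrite rnorm0.
by apply: le_trans (rnormD _ _) _; rewrite lerD2l.
Qed.
Lemma rnormX x n : rnorm (x ^+ n) <= rnorm x ^+ n.
Proof.
elim: n => [|n IH]; first by rewrite !expr0 rnorm1.
rewrite !exprS; apply: le_trans (rnormM _ _) _.
by rewrite ler_wpM2l ?rnorm_ge0.
Qed.
Lemma rnorm_unitary x : unitary x -> rnorm x = 1.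
Proof.
move=> [h _]; have := rnormCstar x; rewrite h rnorm1 => /esym/eqP.
by rewrite sqrf_eq1 // ; have := rnorm_ge0 x; move=> x0 /orP[/eqP//|/eqP h']; lra.
Qed.
Lemma star0 : star (0 : calg A) = 0.
Proof. by rewrite -[X in star X](scale0r (0 : calg A)) starZ rmorph0 scale0r. Qed.
Lemma starN x : star (- x) = - star x.
Proof. by rewrite -scaleN1r starZ rmorphN rmorph1 scaleN1r. Qed.
Lemma starB x y : star (x - y) = star x - star y.
Proof. by rewrite starD starN. Qed.
Lemma starZr (a : R) x : star (a%:C *: x) = a%:C *: star x.
Proof. rewrite starZ; congr (_ *: _). exact: conjc_real. Qed.
Lemma star_sum I (r : seq I) (P : pred I) (F : I -> calg A) :
  star (\sum_(i <- r | P i) F i) = \sum_(i <- r | P i) star (F i).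
Proof. exact: (big_morph _ (@starD _ _) star0). Qed.
Lemma starX x n : star (x ^+ n) = star x ^+ n.
Proof. by elim: n => [|n IH]; rewrite ?expr0 ?star1 // exprS starM IH exprSr. Qed.

Definition rcvg u l := forall e : R, 0 < e -> exists N, forall n, (N <= n)%N -> rnorm (u n - l) < e.

Lemma rcvgP u l : rcvg u l <-> u @ \oo --> l.
Proof.
split=> [h|h].
  apply/cvgrPdist_lt => e e0.
  have er : e = (complex.Re e)%:C by rewrite RRe_real // gtr0_real.
  have [N hN] := h (complex.Re e) ltac:(by rewrite -ltcR -er).
  exists N => // n /= Nn; rewrite distrC (rnormE (u n - l)) er ltcR.
  exact: hN.
move=> e e0; have e0' : 0 < e%:C by rewrite ltcR.
have [N _ hN] := (@cvgrPdist_lt _ _ _ _ _ _ _).1 h _ e0'.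
exists N => n Nn; rewrite -ltcR -rnormE distrC; exact: hN.
Qed.

Lemma rcvg_lim u l : rcvg u l -> limn u = l.
Proof. by move=> /rcvgP/cvg_lim; apply; exact: norm_hausdorff. Qed.

Lemma rcvg_complete u :
  (forall e : R, 0 < e -> exists N, forall n m, (N <= n)%N -> (n <= m)%N -> rnorm (u m - u n) < e) ->
  exists l, rcvg u l.
Proof.
move=> h; suff c : cvgn u by exists (limn u); apply/rcvgP.
apply: cauchy_cvg; apply/cauchy_exP => e e0.
have er : e = (complex.Re e)%:C by rewrite RRe_real // gtr0_real.
have [N hN] := h (complex.Re e) ltac:(by rewrite -ltcR -er).
exists (u N); exists N => // n /= Nn.
by rewrite -ball_normE /= er distrC (rnormE (u n - u N)) ltcR hN.
Qed.

Lemma rcvg_unique u l l' : rcvg u l -> rcvg u l' -> l = l'.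
Proof. by move=> /rcvg_lim <- /rcvg_lim <-. Qed.

Lemma rcvg_cst x : rcvg (fun=> x) x.
Proof. by move=> e e0; exists 0%N => n _; rewrite subrr rnorm0. Qed.

Lemma rcvg_ext u v l : (forall n, u n = v n) -> rcvg u l -> rcvg v l.
Proof. by move=> /funext ->. Qed.

Lemma rcvgD u v l m : rcvg u l -> rcvg v m -> rcvg (fun n => u n + v n) (l + m).
Proof. by move=> /rcvgP ul /rcvgP vm; apply/rcvgP; exact: cvgD. Qed.
Lemma rcvgMl x u l : rcvg u l -> rcvg (fun n => x * u n) (x * l).
Proof.
move=> ul e e0; have x0 := rnorm_ge0 x.
have p : 0 < rnorm x + 1 by lra.
have [N hN] := ul (e / (rnorm x + 1)) (divr_gt0 e0 p).
exists N => n Nn; rewrite -mulrBr; apply: le_lt_trans (rnormM _ _) _.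
have := hN n Nn; rewrite ltr_pdivlMr // => h.
have := rnorm_ge0 (u n - l); nra.
Qed.
Lemma rcvgMr x u l : rcvg u l -> rcvg (fun n => u n * x) (l * x).
Proof.
move=> ul e e0; have x0 := rnorm_ge0 x.
have p : 0 < rnorm x + 1 by lra.
have [N hN] := ul (e / (rnorm x + 1)) (divr_gt0 e0 p).
exists N => n Nn; rewrite -mulrBl; apply: le_lt_trans (rnormM _ _) _.
have := hN n Nn; rewrite ltr_pdivlMr // => h.
have := rnorm_ge0 (u n - l); nra.
Qed.
Lemma rcvg_star u l : rcvg u l -> rcvg (fun n => star (u n)) (star l).
Proof.
move=> ul e e0; have [N hN] := ul e e0; exists N => n Nn.
by rewrite -starB rnorm_star hN.
Qed.
Lemma rcvgN u l : rcvg u l -> rcvg (fun n => - u n) (- l).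
Proof.
move=> ul e e0; have [N hN] := ul e e0; exists N => n Nn.
by rewrite -opprD rnormN hN.
Qed.
Lemma rcvg_dist u v l : rcvg u l -> (forall e : R, 0 < e -> exists N, forall n, (N <= n)%N -> rnorm (u n - v n) < e) ->
  rcvg v l.
Proof.
move=> ul uv e e0; have e2 : 0 < e / 2 by lra.
have [N hN] := ul _ e2; have [M hM] := uv _ e2; exists (maxn N M) => n.
rewrite geq_max => /andP[Nn Mn]; have := hN n Nn; have := hM n Mn.
by have := rnorm_tri (u n) (v n) l; rewrite (rnormBC (v n) (u n)); lra.
Qed.
Lemma rcvg_closed (F : set (calg A)) u l : closed F -> rcvg u l -> (forall n, F (u n)) -> F l.
Proof.
move=> cF /rcvgP ul Fu; apply: (closed_cvg F cF _ _ ul).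
by apply: nearW.
Qed.
Lemma rcvg_le u l (k : R) : rcvg u l -> (forall n, rnorm (u n) <= k) -> rnorm l <= k.
Proof.
move=> ul uk; rewrite leNgt; apply/negP => kl.
have p : 0 < rnorm l - k by rewrite subr_gt0.
have [N /(_ N (leqnn _))] := ul _ p.
have := uk N; have := rnorm_tri (u N) l 0; rewrite !subr0 (rnormBC l (u N)); lra.
Qed.
End RealNorm.

(** * Evaluation of power series *)

(* [A] as an algebra over the reals, to which the formal identities apply *)
Definition ralg (R : realType) (A : cstarAlgType R) : Type := calg A.

Module RealAlgebra.
Section RealAlgebra.
Variables (R : realType) (A : cstarAlgType R).
HB.instance Definition _ := GRing.NzRing.copy (ralg A) (calg A).
Definition rscale (a : R) (x : ralg A) : ralg A := (a%:C *: (x : calg A)).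
Fact rscaleA a b x : rscale a (rscale b x) = rscale (a * b) x.
Proof. by rewrite /rscale scalerA rmorphM. Qed.
Fact rscale1 : left_id 1 rscale.
Proof. by move=> x; rewrite /rscale rmorph1 scale1r. Qed.
Fact rscaleDr : right_distributive rscale +%R.
Proof. by move=> a x y; rewrite /rscale scalerDr. Qed.
Fact rscaleDl x : {morph rscale^~ x : a b / a + b}.
Proof. by move=> a b; rewrite /rscale rmorphD scalerDl. Qed.
HB.instance Definition _ := GRing.Zmodule_isLmodule.Build R (ralg A)
  rscaleA rscale1 rscaleDr rscaleDl.
Fact rscaleAl a (x y : ralg A) : a *: (x * y) = (a *: x) * y.
Proof. exact: (@scalerAl _ (calg A)). Qed.
HB.instance Definition _ := GRing.Lmodule_isLalgebra.Build R (ralg A) rscaleAl.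
Fact rscaleAr a (x y : ralg A) : a *: (x * y) = x * (a *: y).
Proof. exact: (@scalerAr _ (calg A)). Qed.
HB.instance Definition _ := GRing.Lalgebra_isAlgebra.Build R (ralg A) rscaleAr.
Lemma rscaleE a (x : ralg A) : a *: x = a%:C *: (x : calg A). Proof. by []. Qed.
End RealAlgebra.
End RealAlgebra.
Import RealAlgebra.

Section RealBounds.
Variable R : realType.
Local Notation wt := (wt R).

Lemma sum_wt_le m n : \sum_(m <= i < n) wt i <= 1.
Proof.
apply: (@le_trans _ _ (\sum_(0 <= i < n) wt i)).
  have [mn|nm] := leqP m n; last by rewrite big_geq ?sumr_ge0 1?ltnW // => i _; exact: wt_ge0.
  by rewrite [leRHS](@big_cat_nat _ _ _ m) //= lerDr sumr_ge0 // => i _; exact: wt_ge0.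
rewrite big_mkord (eq_bigr (fun i : 'I_n => 8^-1 * (i.+1%:R ^+ 2)^-1)).
  by rewrite -mulr_sumr; have := sum_inv_sq R n; lra.
by move=> i _; rewrite wtE invfM.
Qed.

Lemma tail_wt (e : R) : 0 < e -> exists N, forall m n, (N <= m)%N -> \sum_(m <= i < n) wt i < e.
Proof.
move=> e0; pose f := fun n => \sum_(0 <= i < n) wt i.
have nd : nondecreasing_seq f.
  by apply/nondecreasing_seqP => n; rewrite /f big_nat_recr //= lerDl wt_ge0.
have cf : cvgn f.
  apply: nondecreasing_is_cvgn => //; exists 1 => _ [n _ <-]; exact: sum_wt_le.
have /cvgrPdist_lt/(_ e e0)[N _ hN] := cf; exists N => m n Nm.
have [mn|nm] := leqP m n; last by rewrite big_geq // ltnW.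
have -> : \sum_(m <= i < n) wt i = f n - f m.
  by rewrite /f (@big_cat_nat _ _ _ m 0 n) //= addrAC subrr add0r.
have := hN m Nm; rewrite /= ger0_norm; first by have := nondecreasing_cvgn_le nd cf n; lra.
by rewrite subr_ge0; exact: nondecreasing_cvgn_le.
Qed.

Lemma tail_exp (h e : R) : 0 <= h -> 0 < e ->
  exists N, forall m n, (N <= m)%N -> \sum_(m <= i < n) i`!%:R^-1 * h ^+ i < e.
Proof.
move=> h0 e0; pose f := series (exp_coeff h).
have c0 i : 0 <= exp_coeff h i by rewrite /exp_coeff /= divr_ge0 ?exprn_ge0.
have nd : nondecreasing_seq f.
  by apply/nondecreasing_seqP => n; rewrite /f /series /= big_nat_recr //= lerDl.
have cf : cvgn f by exact: is_cvg_series_exp_coeff.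
have /cvgrPdist_lt/(_ e e0)[N _ hN] := cf; exists N => m n Nm.
have [mn|nm] := leqP m n; last by rewrite big_geq // ltnW.
have -> : \sum_(m <= i < n) i`!%:R^-1 * h ^+ i = f n - f m.
  rewrite /f /series /= (@big_cat_nat _ _ _ m 0 n) //= addrAC subrr add0r.
  by apply: eq_bigr => i _; rewrite /exp_coeff /= mulrC.
have := hN m Nm; rewrite /= ger0_norm; first by have := nondecreasing_cvgn_le nd cf n; lra.
by rewrite subr_ge0; exact: nondecreasing_cvgn_le.
Qed.

Lemma sum_exp_le (h : R) m n : 0 <= h -> \sum_(m <= i < n) i`!%:R^-1 * h ^+ i <= expR h.
Proof.
move=> h0; pose f := series (exp_coeff h).
have c0 i : 0 <= exp_coeff h i by rewrite /exp_coeff /= divr_ge0 ?exprn_ge0.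
have nd : nondecreasing_seq f.
  by apply/nondecreasing_seqP => k; rewrite /f /series /= big_nat_recr //= lerDl.
have cf : cvgn f by exact: is_cvg_series_exp_coeff.
have fE : f n = \sum_(0 <= i < n) i`!%:R^-1 * h ^+ i.
  by rewrite /f /series /=; apply: eq_bigr => i _; rewrite /exp_coeff /= mulrC.
apply: (@le_trans _ _ (f n)); last exact: nondecreasing_cvgn_le.
have p i : 0 <= i`!%:R^-1 * h ^+ i by rewrite mulr_ge0 ?exprn_ge0.
rewrite fE; have [mn|nm] := leqP m n; last by rewrite big_geq ?sumr_ge0 1?ltnW.
by rewrite [leRHS](@big_cat_nat _ _ _ m) //= lerDr sumr_ge0.
Qed.
End RealBounds.

Section Evaluation.
Variables (R : realType) (A : cstarAlgType R).
Local Notation V := (ralg A).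
Local Notation wt := (wt R).
Implicit Types (f g H : fps V) (a b x : calg A).
Local Notation nrm := (@rnorm R A).

Definition fbound f (k : R) := forall n, nrm (f n) <= k * wt n.
Definition fev f a := rcvg (fun n => \sum_(0 <= i < n) (f i : calg A)) a.

Lemma fbound_ge0 f k : fbound f k -> 0 <= k.
Proof.
move=> /(_ 0%N) h; have := le_trans (rnorm_ge0 _) h.
by rewrite pmulr_lge0 ?wt_gt0.
Qed.

Lemma fbound_sum f k m n : fbound f k ->
  nrm (\sum_(m <= i < n) (f i : calg A)) <= k * \sum_(m <= i < n) wt i.
Proof.
move=> fk; apply: le_trans (rnorm_sum _ _ _) _; rewrite mulr_sumr.
by apply: ler_sum => i _.
Qed.

Lemma fev_ex f k : fbound f k -> exists a, fev f a.
Proof.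
move=> fk; have k0 := fbound_ge0 fk; apply: rcvg_complete => e e0.
have p : 0 < e / (k + 1) by rewrite divr_gt0 //; lra.
have [N hN] := tail_wt p; exists N => n m Nn nm.
rewrite (@big_cat_nat _ _ _ n 0 m) //= addrAC subrr add0r.
apply: le_lt_trans (fbound_sum _ _ fk) _; have := hN n m Nn.
rewrite ltr_pdivlMr; last lra.
have : 0 <= \sum_(n <= i < m) wt i by apply: sumr_ge0 => i _; exact: wt_ge0.
nra.
Qed.

Lemma fev_unique f a b : fev f a -> fev f b -> a = b.
Proof. exact: rcvg_unique. Qed.

Lemma fev_le f k a : fbound f k -> fev f a -> nrm a <= k.
Proof.
move=> fk fa; have k0 := fbound_ge0 fk; apply: (rcvg_le fa) => n.
by apply: le_trans (fbound_sum _ _ fk) _; rewrite ler_piMr ?sum_wt_le.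
Qed.

Lemma fev_closed (F : set (calg A)) f a : closed F -> F 0 ->
  (forall x y, F x -> F y -> F (x + y)) -> (forall n, F (f n)) -> fev f a -> F a.
Proof.
move=> cF F0 FD Ff fa; apply: (rcvg_closed cF fa) => n.
by elim/big_ind: _ => // x y; exact: FD.
Qed.

Lemma fevD f g a b : fev f a -> fev g b -> fev (f + g) (a + b).
Proof.
move=> fa gb; apply: (rcvg_ext _ (rcvgD fa gb)) => n /=.
by rewrite -big_split.
Qed.
Lemma fevN f a : fev f a -> fev (- f) (- a).
Proof. by move=> fa; apply: (rcvg_ext _ (rcvgN fa)) => n /=; rewrite -sumrN. Qed.
Lemma fevZ (c : R) f a : fev f a -> fev (c *: f) (c%:C *: a).
Proof.
move=> fa; rewrite -[a]mul1r scalerAl.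
apply: (rcvg_ext _ (rcvgMl _ fa)) => n /=.
rewrite mulr_sumr; apply: eq_bigr => i _.
by rewrite -scalerAl mul1r.
Qed.
Lemma fev_fin f N : (forall i, (N <= i)%N -> f i = 0) ->
  fev f (\sum_(0 <= i < N) (f i : calg A)).
Proof.
move=> fN e e0; exists N => n Nn.
rewrite (@big_cat_nat _ _ _ N 0 n) //= addrAC subrr add0r.
by rewrite big_nat_cond big1 ?rnorm0 // => i /andP[/andP[/fN ->]].
Qed.
Lemma fev1 : fev 1 1.
Proof. by have := @fev_fin 1 1%N; rewrite big_nat1; apply; case. Qed.
Lemma fev_tau x : fev (tau (x : V)) x.
Proof.
have := @fev_fin (tau (x : V)) 2%N; rewrite big_nat_recr //= big_nat1 /= add0r; apply.
by case=> [|[|i]].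
Qed.

Lemma fboundM f g k l : fbound f k -> fbound g l -> fbound (f * g) (k * l).
Proof.
move=> fk gl n; have k0 := fbound_ge0 fk; have l0 := fbound_ge0 gl.
rewrite fps_mulE; apply: le_trans (rnorm_sum _ _ _) _.
apply: (@le_trans _ _ (\sum_(i < n.+1) k * l * (wt i * wt (n - i)))).
  apply: ler_sum => i _; apply: le_trans (rnormM _ _) _.
  by rewrite mulrACA ler_pM ?rnorm_ge0.
by rewrite -mulr_sumr ler_wpM2l ?mulr_ge0 ?wt_conv.
Qed.

(** The product of the n-th partial sums is the full sum of the product of the truncations. Its
    first n coefficients are those of f * g, and the others form a tail with the same weighted
    bound, because truncating does not spoil bounds. *)
Lemma fevM f g k l a b : fbound f k -> fbound g l -> fev f a -> fev g b -> fev (f * g) (a * b).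
Proof.
move=> fk gl fa gb; have k0 := fbound_ge0 fk; have l0 := fbound_ge0 gl.
pose Q n : calg A := (\sum_(0 <= i < n) (f i : calg A)) * (\sum_(0 <= i < n) (g i : calg A)).
apply: (@rcvg_dist _ _ Q).
  apply: (@rcvg_dist _ _ (fun n => (\sum_(0 <= i < n) (f i : calg A)) * b)).
    exact: rcvgMr.
  move=> e e0; have p : 0 < e / (k + 1) by rewrite divr_gt0 //; lra.
  have [N hN] := gb _ p; exists N => n Nn; rewrite /Q -mulrBr.
  apply: le_lt_trans (rnormM _ _) _; have := hN n Nn.
  rewrite ltr_pdivlMr; last by lra.
  rewrite rnormBC; have := rnorm_ge0 (b - \sum_(0 <= i < n) (g i : calg A)).
  have : nrm (\sum_(0 <= i < n) (f i : calg A)) <= k.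
    by apply: le_trans (fbound_sum _ _ fk) _; rewrite ler_piMr ?sum_wt_le.
  have := rnorm_ge0 (\sum_(0 <= i < n) (f i : calg A)); nra.
move=> e e0; have p : 0 < e / (k * l + 1) by rewrite divr_gt0 // ltr_wpDl ?mulr_ge0.
have [N hN] := tail_wt p; exists N => n Nn.
pose tr (f : fps V) : fps V := fun i => if (i < n)%N then f i else 0.
pose P (f : fps V) : {poly calg A} := \poly_(i < n) (f i : calg A).
have trb h c : 0 <= c -> fbound h c -> fbound (tr h) c.
  by move=> c0 hc i; rewrite /tr; case: ifP => // _; rewrite rnorm0 mulr_ge0 ?wt_ge0.
have coefP h i : (P h)`_i = tr h i by rewrite coef_poly.
have coefPM i : (P f * P g)`_i = (tr f * tr g : fps V) i.
  by rewrite coefM fps_mulE; apply: eq_bigr => j _; rewrite !coefP.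
have P1 h : (P h).[1] = \sum_(0 <= i < n) (h i : calg A).
  rewrite horner_poly big_mkord; apply: eq_bigr => i _.
  by rewrite expr1n mulr1.
have -> : Q n = \sum_(0 <= i < n + n) (tr f * tr g : fps V) i.
  rewrite /Q -!P1 -hornerM_comm; last by rewrite /comm_poly mulr1 mul1r.
  rewrite (@horner_coef_wide _ (n + n)).
    rewrite big_mkord; apply: eq_bigr => i _.
    by rewrite expr1n mulr1 coefPM.
  apply: leq_trans (size_polyMleq _ _) _; apply: leq_trans (leq_pred _) _.
  by apply: leq_add; exact: size_poly.
rewrite (@big_cat_nat _ _ _ n 0 (n + n)) ?leq_addr //=.
have -> : \sum_(0 <= i < n) (tr f * tr g : fps V) i = \sum_(0 <= i < n) ((f * g) i : calg A).
  rewrite big_nat_cond [RHS]big_nat_cond; apply: eq_bigr => i /andP[/andP[_ ilt] _].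
  by apply: fps_mul_coef_eq => j ji; rewrite /tr (leq_ltn_trans ji).
rewrite addrAC subrr add0r.
apply: le_lt_trans (fbound_sum _ _ (fboundM (trb _ _ k0 fk) (trb _ _ l0 gl))) _.
have := hN n (n + n)%N Nn; rewrite ltr_pdivlMr; last by rewrite ltr_wpDl ?mulr_ge0.
have : 0 <= \sum_(n <= i < n + n) wt i by apply: sumr_ge0 => i _; exact: wt_ge0.
have : 0 <= k * l by rewrite mulr_ge0.
nra.
Qed.

Lemma fbound1 : fbound 1 8.
Proof.
case=> [|n]; rewrite fps_1E /= ?rnorm0 ?mulr_ge0 ?wt_ge0 //.
by rewrite rnorm1 wt0 mulfV ?pnatr_eq0.
Qed.
Lemma fboundX f k n : fbound f k -> fbound (f ^+ n) (8 * k ^+ n).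
Proof.
move=> fk; elim: n => [|n IH]; first by rewrite !expr0 mulr1; exact: fbound1.
rewrite !exprS mulrCA; exact: fboundM.
Qed.
Lemma fevX f k n a : fbound f k -> fev f a -> fev (f ^+ n) (a ^+ n).
Proof.
move=> fk fa; elim: n => [|n IH]; first by rewrite !expr0; exact: fev1.
by rewrite !exprS; apply: fevM fk (fboundX n fk) fa IH.
Qed.

Lemma fexp_tail H h M i : H 0%N = 0 -> fbound H h ->
  nrm (fexp H i - (\sum_(0 <= n < M) cexpo R n *: H ^+ n : fps V) i) <=
  8 * (\sum_(M <= n < maxn i.+1 M) n`!%:R^-1 * h ^+ n) * wt i.
Proof.
move=> H0 Hh.
have -> : fexp H i = \sum_(0 <= n < maxn i.+1 M) (cexpo R n *: H ^+ n : fps V) i.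
  rewrite fexpE (@fsumE _ _ _ i (maxn i.+1 M)) ?big_mkord //; first exact: ford_pow.
  by rewrite leq_maxl.
rewrite fps_sumE (@big_cat_nat _ _ _ M 0 (maxn i.+1 M)) ?leq_maxr //= addrAC subrr add0r.
apply: le_trans (rnorm_sum _ _ _) _; rewrite mulr_sumr mulr_suml.
apply: ler_sum => n _; rewrite fps_scaleE rscaleE rnormZ ger0_norm ?invr_ge0 //.
by have := fboundX n Hh i; rewrite /cexpo => h1;
  rewrite mulrCA -!mulrA ler_wpM2l ?invr_ge0 // !mulrA.
Qed.

Lemma fbound_exp H h : H 0%N = 0 -> fbound H h -> fbound (fexp H) (8 * expR h).
Proof.
move=> H0 Hh i; have := @fexp_tail H h 0 i H0 Hh; rewrite big_geq // subr0 => le1.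
apply: le_trans le1 _; rewrite ler_wpM2r ?wt_ge0 // ler_wpM2l // sum_exp_le //.
exact: fbound_ge0 Hh.
Qed.

(** Two limits are exchanged: the series T of the first M powers evaluates to a partial sum of the
    exponential series of a, and [fexp_tail] bounds all coefficients of the difference uniformly. *)
Lemma fev_exp_cvg H h a : H 0%N = 0 -> fbound H h -> fev H a ->
  exists2 b, fev (fexp H) b &
    rcvg (fun n => \sum_(0 <= i < n) i`!%:R^-1%:C *: a ^+ i) b.
Proof.
move=> H0 Hh Ha; have h0 := fbound_ge0 Hh.
have [b fb] := fev_ex (fbound_exp H0 Hh); exists b => // e e0.
have e8 : 0 < e / 16 by rewrite divr_gt0.
have [N hN] := tail_exp h0 e8; exists N => M NM.
pose T : fps V := \sum_(0 <= n < M) cexpo R n *: H ^+ n.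
have TM : fev T (\sum_(0 <= i < M) i`!%:R^-1%:C *: a ^+ i).
  rewrite /T; elim: M {NM T} => [|m IH].
    by rewrite !big_geq //; have := @fev_fin 0 0%N; rewrite big_geq //; exact.
  rewrite !big_nat_recr //=; apply: fevD => //; apply: fevZ.
  exact: fevX Hh Ha.
have D : fbound (fexp H - T) (e / 2).
  move=> i; rewrite fps_addE fps_oppE; apply: le_trans (fexp_tail M i H0 Hh) _.
  rewrite ler_wpM2r ?wt_ge0 //; have := hN M (maxn i.+1 M) NM; lra.
have := fev_le D (fevD fb (fevN TM)); rewrite rnormBC; lra.
Qed.

Lemma fev_exp H h a : H 0%N = 0 -> fbound H h -> fev H a -> fev (fexp H) (cexp a).
Proof.
move=> H0 Hh Ha; have [b fb cb] := fev_exp_cvg H0 Hh Ha.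
rewrite /cexp (rcvg_lim (u := series _) (l := b)) //.
apply: (rcvg_ext _ cb) => n; rewrite /series /=; apply: eq_bigr => i _.
by rewrite fmorphV rmorph_nat.
Qed.

Lemma fbound_tau x : fbound (tau (x : V)) (32 * nrm x).
Proof.
have x0 := rnorm_ge0 x.
case=> [|[|n]] /=; rewrite ?rnorm0 ?mulr_ge0 ?wt_ge0 //.
have -> : wt 1 = 32^-1 by rewrite wtE; congr (_^-1); ring.
by rewrite mulrAC mulfV ?mul1r // pnatr_eq0.
Qed.

Lemma fev_exp_tau x : fev (fexp (tau (x : V))) (cexp x).
Proof. exact: fev_exp (fbound_tau x) (fev_tau x). Qed.

Lemma cexp_cvg x : rcvg (fun n => \sum_(0 <= i < n) i`!%:R^-1%:C *: x ^+ i) (cexp x).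
Proof.
have [b fb cb] := fev_exp_cvg (tau0 (x : V)) (fbound_tau x) (fev_tau x).
by rewrite (fev_unique (fev_exp_tau x) fb).
Qed.

Lemma cexpD x y : x * y = y * x -> cexp (x + y) = cexp x * cexp y.
Proof.
move=> xy; apply: (fev_unique (fev_exp_tau _)).
have -> : fexp (tau (x + y : V)) = fexp (tau (x : V)) * fexp (tau (y : V)).
  rewrite tauD fexpD // /GRing.comm /tau !fps_shiftMl !fps_shiftMr.
  congr (fps_shift (fps_shift _)); apply/funext => n.
  by rewrite !fconst_mulE; case: n => [|n] /=; rewrite ?mulr0 //; exact: xy.
apply: fevM (fev_exp_tau _) (fev_exp_tau _).
  exact: fbound_exp (fbound_tau x).
exact: fbound_exp (fbound_tau y).
Qed.
Lemma cexp0 : cexp (0 : calg A) = 1.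
Proof.
apply: (rcvg_unique (cexp_cvg 0)); move=> e e0; exists 1%N => -[//|n] _.
rewrite big_nat_recl //= expr0 invr1 scale1r big1 ?addr0 ?subrr ?rnorm0 //.
by move=> i _; rewrite exprS mul0r scaler0.
Qed.
Lemma cexpN x : cexp x * cexp (- x) = 1.
Proof. by rewrite -cexpD ?subrr ?cexp0 // mulrN mulNr. Qed.
Lemma cexpNl x : cexp (- x) * cexp x = 1.
Proof. by have := cexpN (- x); rewrite opprK. Qed.
Lemma cexp_star x : star (cexp x) = cexp (star x).
Proof.
apply: (rcvg_unique (rcvg_star (cexp_cvg x))).
apply: (rcvg_ext _ (cexp_cvg (star x))) => n; rewrite star_sum.
by apply: eq_bigr => i _; rewrite starZr starX.
Qed.
Lemma cexp_conj u v x : u * v = 1 -> v * u = 1 -> u * cexp x * v = cexp (u * x * v).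
Proof.
move=> uv vu; apply: (rcvg_unique (rcvgMr v (rcvgMl u (cexp_cvg x)))).
have pw n : (u * x * v) ^+ n = u * x ^+ n * v.
  elim: n => [|n IH]; first by rewrite !expr0 mulr1.
  by rewrite exprS IH exprS !mulrA -[_ * v * u]mulrA vu mulr1.
apply: (rcvg_ext _ (cexp_cvg (u * x * v))) => n.
rewrite mulr_sumr mulr_suml; apply: eq_bigr => i _.
by rewrite pw -scalerAr -scalerAl.
Qed.

Section LieSubspace.
Variable K : set (calg A).
Hypothesis K_closed : closed K.
Hypothesis K0 : K 0.
Hypothesis KD : forall x y, K x -> K y -> K (x + y).
Hypothesis KZ : forall (c : R) x, K x -> K (c%:C *: x).
Hypothesis K_br : forall x y, K x -> K y -> K (x * y - y * x).

Definition lie_gauge (x : V) (k : R) := K x /\ nrm x <= k.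

Lemma lie_gaugeP : gauge lie_gauge.
Proof.
split.
- by split=> //; rewrite rnorm0.
- move=> x y k l [Kx xk] [Ky yl]; split; first exact: KD.
  by apply: le_trans (rnormD _ _) _; exact: lerD.
- move=> c x k [Kx xk]; split; first exact: KZ.
  by rewrite rscaleE rnormZ ler_wpM2l.
- move=> x y k l [Kx xk] [Ky yl]; split; first exact: K_br.
  apply: le_trans (rnormB _ _) _.
  have h : nrm x * nrm y <= k * l by rewrite ler_pM ?rnorm_ge0.
  have h1 := rnormM x y; have h2 := rnormM y x; rewrite [nrm y * _]mulrC in h2.
  by rewrite -mulrA; lra.
- by move=> x k l [Kx xk] kl; split=> //; apply: le_trans kl.
- by move=> x k [_]; apply: le_trans (rnorm_ge0 _).
Qed.

Lemma fgauge_bound f k : fgauge lie_gauge f k -> fbound f k.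
Proof. by move=> [_ h] n; case: (h n). Qed.
Lemma fgauge_ev f k a : fgauge lie_gauge f k -> fev f a -> K a /\ nrm a <= k.
Proof.
move=> fk fa; split; last exact: fev_le (fgauge_bound fk) fa.
by apply: (fev_closed K_closed K0 KD _ fa) => n; case: fk => _ /(_ n) [].
Qed.

Lemma rouviere a b (k : R) : K a -> K b -> nrm a <= k -> nrm b <= k -> k <= 2 ^- 20 ->
  exists l m, [/\ K l, K m &
    cexp (a + b) = cexp l * cexp a * cexp (- l) * (cexp m * cexp b * cexp (- m))].
Proof.
move=> Ka Kb ak bk k1.
have [L M] := @fgauge_rouviere _ _ _ lie_gaugeP (a : V) (b : V) k (conj Ka ak) (conj Kb bk) k1.
have := @rouviere_fexp R V a b; cbv zeta.
set l := magnus (rRho _ _) in L *; set m := magnus (rSig _ _) in M *.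
have l0 : l 0%N = 0 by rewrite /l magnus0.
have m0 : m 0%N = 0 by rewrite /m magnus0.
have nl0 : (- l) 0%N = 0 by rewrite fps_oppE l0 oppr0.
have nm0 : (- m) 0%N = 0 by rewrite fps_oppE m0 oppr0.
have Lb := fgauge_bound L; have Mb := fgauge_bound M.
have NLb : fbound (- l) (2 ^+ 16 * k) by move=> n; rewrite fps_oppE rnormN.
have NMb : fbound (- m) (2 ^+ 16 * k) by move=> n; rewrite fps_oppE rnormN.
have [el le] := fev_ex Lb; have [em me] := fev_ex Mb.
have [Kl _] := fgauge_ev L le; have [Km _] := fgauge_ev M me.
move=> E; exists el, em; split=> //.
apply: (fev_unique (fev_exp_tau _)); rewrite E.
have Bl := fbound_exp l0 Lb; have Bnl := fbound_exp nl0 NLb.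
have Bm := fbound_exp m0 Mb; have Bnm := fbound_exp nm0 NMb.
have Ba := fbound_exp (tau0 (a : V)) (fbound_tau a).
have Bb := fbound_exp (tau0 (b : V)) (fbound_tau b).
have ea := fev_exp l0 Lb le; have ena := fev_exp nl0 NLb (fevN le).
have eb := fev_exp m0 Mb me; have enb := fev_exp nm0 NMb (fevN me).
have e1 := fevM (fboundM Bl Ba) Bnl (fevM Bl Ba ea (fev_exp_tau a)) ena.
have e2 := fevM (fboundM Bm Bb) Bnm (fevM Bm Bb eb (fev_exp_tau b)) enb.
exact: fevM (fboundM (fboundM Bl Ba) Bnl) (fboundM (fboundM Bm Bb) Bnm) e1 e2.
Qed.

(** The logarithm is the Magnus series [inH] evaluated at 1; 192 is 8 times the bound 24 for
    [inB]. *)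
Lemma bch a b (k : R) : K a -> K b -> nrm a <= k -> nrm b <= k -> k <= 2 ^- 20 ->
  exists l, [/\ K l, nrm l <= 192 * k & cexp a * cexp b = cexp l].
Proof.
move=> Ka Kb ak bk k1; have k0 := le_trans (rnorm_ge0 _) ak.
have GP := lie_gaugeP.
have cX := fgauge_const GP (conj Ka ak : lie_gauge (a : V) k).
have cY := fgauge_const GP (conj Kb bk : lie_gauge (b : V) k).
have tX := fgauge_shift GP cX; rewrite -/(tau _) in tX.
have co j : `|cexpo R j| <= 2 ^+ j by apply/le1_pow2/invnat_le1.
have t8 : 4 * (8 * k) <= 8^-1 by lra.
have B : fgauge lie_gauge (inB (a : V) (b : V)) (24 * k).
  have := gaugeD (fgaugeP GP) cX (fgauge_psi GP co tX cY t8).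
  by rewrite (_ : _ + _ = 24 * k) //; ring.
have H : fgauge lie_gauge (inH (a : V) (b : V)) (8 * (24 * k)).
  by apply: (fgauge_magnus GP (@dphi_le1 R) B); lra.
have [l le] := fev_ex (fgauge_bound H); have [Kl nl] := fgauge_ev H le.
exists l; split=> //; first by lra.
have e := fev_exp (inH0 (a : V) (b : V)) (fgauge_bound H) le.
rewrite fexp_inH in e; apply: (fev_unique _ e).
apply: fevM (fev_exp_tau a) (fev_exp_tau b).
  exact: fbound_exp (fbound_tau a).
exact: fbound_exp (fbound_tau b).
Qed.
End LieSubspace.
End Evaluation.

(** * Fixed points of contractions and sequential closedness *)

Section Contraction.
Variables (R : realType) (A : cstarAlgType R).
Implicit Types (x y : calg A).

Lemma contraction (F : set (calg A)) (T : calg A -> calg A) x0 :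
  closed F -> F x0 -> (forall x, F x -> F (T x)) ->
  (forall x y, F x -> F y -> rnorm (T x - T y) <= rnorm (x - y) / 2) ->
  exists2 x, F x & T x = x.
Proof.
move=> cF F0 FT Tc; pose u n := iter n T x0.
have Fu n : F (u n) by elim: n => //= n; apply: FT.
pose c := rnorm (T x0 - x0); have c0 : 0 <= c by exact: rnorm_ge0.
have stepn n : rnorm (u n.+1 - u n) <= c * 2^-1 ^+ n.
  elim: n => [|n IH]; first by rewrite expr0 mulr1.
  have h : rnorm (u n.+2 - u n.+1) <= rnorm (u n.+1 - u n) / 2 := Tc _ _ (Fu n.+1) (Fu n).
  apply: le_trans h _.
  by rewrite exprSr mulrA ler_wpM2r ?invr_ge0.
have dist n k : rnorm (u (n + k)%N - u n) <= 2 * c * 2^-1 ^+ n - 2 * c * 2^-1 ^+ (n + k).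
  elim: k => [|k IH]; first by rewrite addn0 !subrr rnorm0.
  rewrite addnS; have := rnorm_tri (u (n + k)%N) (u (n + k).+1) (u n).
  have := stepn (n + k)%N; rewrite [2^-1 ^+ (n + k).+1]exprS; lra.
have [x ux] : exists x, rcvg u x.
  apply: rcvg_complete => e e0.
  have [N hN] : exists N, forall n, (N <= n)%N -> 2 * c * 2^-1 ^+ n < e.
    have h : (fun n => 2 * c * 2^-1 ^+ n : R) @ \oo --> (0 : R).
      rewrite -(mulr0 (2 * c)); apply: cvgMr; apply: cvg_expr.
      by rewrite ger0_norm ?invr_ge0 // invf_lt1 // ltr1n.
    have /cvgrPdist_lt/(_ e e0)[N _ hN] := h; exists N => n Nn.
    have := hN n Nn; rewrite /= sub0r normrN ger0_norm // !mulr_ge0 // exprn_ge0 //.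
  exists N => n m Nn nm; rewrite -(subnKC nm).
  have := dist n (m - n)%N; have := hN n Nn.
  have : 0 <= 2 * c * 2^-1 ^+ (n + (m - n)) :> R by rewrite !mulr_ge0 // exprn_ge0 // invr_ge0.
  lra.
have Fx : F x by exact: (rcvg_closed cF ux).
exists x => //; apply: (@rcvg_unique _ _ (fun n => T (u n))).
  move=> e e0; have [N hN] := ux e e0; exists N => n Nn.
  apply: le_lt_trans (Tc _ _ (Fu _) Fx) _.
  have := hN n Nn; have := rnorm_ge0 (u n - x); lra.
by move=> e e0; have [N hN] := ux e e0; exists N => n Nn; apply: (hN n.+1); rewrite leqW.
Qed.

Lemma closedP_rcvg (F : set (calg A)) :
  (forall u l, (forall n, F (u n)) -> rcvg u l -> F l) -> closed F.
Proof.
move=> h x xF.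
have /boolp.choice[u hu] : forall n : nat, exists y : calg A, F y /\ rnorm (y - x) < n.+1%:R^-1.
  move=> n.
  have e0 : 0 < (n.+1%:R^-1)%:C :> R[i] by rewrite ltcR invr_gt0 ltr0n.
  have [y [Fy xy]] := xF _ (nbhsx_ballx x _ e0); exists y; split=> //.
  by move: xy; rewrite -ball_normE /= distrC rnormE ltcR.
apply: (h u) => [n|e e0]; first by case: (hu n).
have [N _ hN] := near_infty_natSinv_lt (PosNum e0).
exists N => n Nn; have [_ h1] := hu n; apply: lt_trans h1 _.
by have := hN n Nn.
Qed.
Lemma closed_ball (r : R) : closed [set x : calg A | rnorm x <= r].
Proof. by apply: closedP_rcvg => u l ur ul; apply: (rcvg_le ul) => n; exact: ur. Qed.
End Contraction.

(** * The operator sinh (ad p) / ad p and its inversion *)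

Section SinhAd.
Variables (R : realType) (A : cstarAlgType R).
Local Notation V := (ralg A).
Implicit Types (x y p q : calg A).
Definition adj p x : calg A := p * x - x * p.

Lemma iter_adjD p x y n : iter n (adj p) (x + y) = iter n (adj p) x + iter n (adj p) y.
Proof. by elim: n => //= n ->; rewrite /adj mulrDr mulrDl opprD addrACA. Qed.
Lemma iter_adjB p x y n : iter n (adj p) (x - y) = iter n (adj p) x - iter n (adj p) y.
Proof.
rewrite iter_adjD; congr (_ + _); elim: n => //= n ->.
by rewrite /adj mulrN mulNr opprB opprK addrC.
Qed.
Lemma iter_adjN p x n : iter n (adj (- p)) x = (-1) ^+ n *: iter n (adj p) x.
Proof.
elim: n => [|n IH]; first by rewrite expr0 scale1r.
rewrite iterS IH /adj exprS -scalerA scaleN1r -scalerAr -scalerAl -scalerBr -scalerN.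
by rewrite mulNr mulrN opprK addrC opprB.
Qed.
Lemma rnorm_adj p x : rnorm (adj p x) <= 2 * rnorm p * rnorm x.
Proof.
apply: le_trans (rnormB _ _) _; have := rnormM p x; have := rnormM x p.
by rewrite [rnorm x * _]mulrC; lra.
Qed.
Lemma rnorm_iter_adj p x n : rnorm (iter n (adj p) x) <= (2 * rnorm p) ^+ n * rnorm x.
Proof.
elim: n => [|n IH]; first by rewrite expr0 mul1r.
rewrite iterS; apply: le_trans (rnorm_adj _ _) _.
by rewrite exprS -[leRHS]mulrA ler_wpM2l ?mulr_ge0 ?rnorm_ge0.
Qed.

Lemma fpsi_tau_const (c : fps R) p x n :
  fpsi c (tau (p : V)) (fps_const (x : V)) n = c n *: (iter n (adj p) x : V).
Proof.
have it j : iter j (fad (tau (p : V))) (fps_const (x : V)) =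
    (fun n => if n == j then iter j (adj p) x else 0) :> fps V.
  elim: j => [|j IH]; first by apply/funext => -[].
  rewrite iterS IH fad_tau; apply/funext => -[|m] //=.
  rewrite /fad fps_addE fps_oppE fconst_mulE fmul_constE eqSS.
  by case: ifP => // _; rewrite mulr0 mul0r subrr.
rewrite fpsiE fsum_coef big_ord_recr /= big1 ?add0r.
  by rewrite fps_scaleE it eqxx.
by move=> j _; rewrite fps_scaleE it gtn_eqF ?scaler0.
Qed.

Lemma le_pow_wt (d : R) n : 0 <= d -> d ^+ n <= 8 * (4 * d) ^+ n * wt R n.
Proof.
move=> d0; elim: n => [|n IH]; first by rewrite !expr0 wt0 mulr1 mulfV // pnatr_eq0.
rewrite exprS; apply: le_trans (ler_wpM2l d0 IH) _.
have := wtS R n; rewrite [(4 * d) ^+ n.+1]exprS.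
have : 0 <= 8 * d * (4 * d) ^+ n by rewrite !mulr_ge0 // exprn_ge0 // mulr_ge0.
move: (wt R n) (wt R n.+1) ((4 * d) ^+ n) => u v w h1 h2; nra.
Qed.

(** The series of sinh x / x, so [sinhc_ad p] is sinh (ad p) / ad p. The limit defining it is known
    to exist for small p, by [sinhc_adE]. *)
Definition csinh : fps R := fun n => if odd n then 0 else n.+1`!%:R^-1.
Definition sinhc_ad p x : calg A :=
  limn (fun n => \sum_(0 <= i < n) (fpsi csinh (tau (p : V)) (fps_const (x : V)) i : calg A)).

Variable p : calg A.
Hypothesis p_small : rnorm p <= 64^-1.

Lemma fbound_iter_adj (c : fps R) x : (forall n, `|c n| <= 1) ->
  fbound (fpsi c (tau (p : V)) (fps_const (x : V))) (8 * rnorm x).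
Proof.
move=> c1 n; rewrite fpsi_tau_const rscaleE rnormZ.
apply: le_trans (ler_piMl (rnorm_ge0 _) (c1 n)) _.
apply: le_trans (rnorm_iter_adj _ _ _) _.
have d0 : 0 <= 2 * rnorm p by have := rnorm_ge0 p; have := p_small; lra.
have := le_pow_wt n d0.
have : (4 * (2 * rnorm p)) ^+ n <= 1.
  have := p_small; have := rnorm_ge0 p; move: (rnorm p) => y y0 y1.
  by rewrite exprn_ile1 //; lra.
have := rnorm_ge0 x; have := wt_ge0 R n; have := exprn_ge0 n d0.
move: ((2 * rnorm p) ^+ n) ((4 * _) ^+ n) (wt R n) (rnorm x) => a b w y a0 w0 y0 b1 ab.
have h : a <= 8 * w by nra.
nra.
Qed.

Lemma csinh_le1 n : `|csinh n| <= 1.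
Proof. by rewrite /csinh; case: ifP => _; rewrite ?normr0 // invnat_le1. Qed.

Lemma sinhc_adE x : fev (fpsi csinh (tau (p : V)) (fps_const (x : V))) (sinhc_ad p x).
Proof.
have [a fa] := fev_ex (fbound_iter_adj x csinh_le1).
by rewrite /sinhc_ad (rcvg_lim fa).
Qed.

Lemma sinhc_adB x y : sinhc_ad p (x - y) = sinhc_ad p x - sinhc_ad p y.
Proof.
apply: (fev_unique (sinhc_adE _)); have := fevD (sinhc_adE x) (fevN (sinhc_adE y)).
congr (fev _ _); apply/funext => n; rewrite fps_addE fps_oppE !fpsi_tau_const.
by rewrite iter_adjB scalerBr.
Qed.

(** The degree 0 term is x, the degree 1 term is absent by parity, and the later ones carry a factor
    (8 |p|)^2 <= 1/64. *)
Lemma sinhc_ad_near x : rnorm (sinhc_ad p x - x) <= rnorm x / 2.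
Proof.
have f1 : fev (fps_const (x : V)) x.
  by have := @fev_fin _ _ (fps_const (x : V)) 1; rewrite big_nat1; apply; case.
apply: (fev_le _ (fevD (sinhc_adE x) (fevN f1))) => n.
have x0 := rnorm_ge0 x; have w0 := wt_ge0 R n.
rewrite fps_addE fps_oppE fpsi_tau_const.
case: n w0 => [|n] w0 /=.
  by rewrite /csinh /= invr1 scale1r subrr rnorm0 !mulr_ge0.
rewrite subr0; case: n w0 => [|n] w0.
  by rewrite /csinh /= scale0r rnorm0 !mulr_ge0.
rewrite rscaleE rnormZ; apply: le_trans (ler_piMl (rnorm_ge0 _) (csinh_le1 _)) _.
apply: le_trans (rnorm_iter_adj _ _ n.+2) _.
have d0 : 0 <= 2 * rnorm p by have := rnorm_ge0 p; have := p_small; lra.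
have := le_pow_wt n.+2 d0.
have h1 : (4 * (2 * rnorm p)) ^+ n.+2 <= 64^-1.
  have := p_small; have := rnorm_ge0 p; move: (rnorm p) => y y0 y1.
  rewrite !exprS mulrA; have : (4 * (2 * y)) ^+ n <= 1 by rewrite exprn_ile1 //; lra.
  have : 0 <= (4 * (2 * y)) ^+ n by rewrite exprn_ge0 //; lra.
  have : (4 * (2 * y)) * (4 * (2 * y)) <= 64^-1 by nra.
  have : 0 <= (4 * (2 * y)) * (4 * (2 * y)) by nra.
  move: (_ ^+ n) (_ * _) => u v; nra.
have := exprn_ge0 n.+2 d0.
move: ((2 * rnorm p) ^+ _) ((4 * _) ^+ _) (wt R _) (rnorm x) h1 w0 x0 => a b w y b1 w0 y0 a0 ab.
have h : a <= 8^-1 * w by nra.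
nra.
Qed.

(** Ad (exp p) - Ad (exp (- p)) is 2 sinh (ad p): the even powers of ad p cancel. Read backwards, it
    makes a bracket with p a sum of two conjugates. *)
Lemma sinh_adE x : cexp p * x * cexp (- p) - cexp (- p) * x * cexp p =
  2%:R *: adj p (sinhc_ad p x).
Proof.
have e1 q : rnorm q <= 64^-1 ->
    fev (fpsi (cexpo R) (tau (q : V)) (fps_const (x : V))) (cexp q * x * cexp (- q)).
  move=> qs; have q0 := rnorm_ge0 q.
  rewrite fpsi_exp // -tauN.
  have fx : fev (fps_const (x : V)) x.
    by have := @fev_fin _ _ (fps_const (x : V)) 1; rewrite big_nat1; apply; case.
  have bx : fbound (fps_const (x : V)) (8 * rnorm x).
    case=> [|n] /=; last by rewrite rnorm0 !mulr_ge0 ?rnorm_ge0 ?wt_ge0.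
    by rewrite wt0 mulrAC mulfV ?mul1r // pnatr_eq0.
  have b1 := fbound_exp (tau0 (q : V)) (fbound_tau q).
  have b2 := fbound_exp (tau0 (- q : V)) (fbound_tau (- q)).
  exact: fevM (fboundM b1 bx) b2 (fevM b1 bx (fev_exp_tau q) fx) (fev_exp_tau _).
have E1 := e1 p p_small; have E2 := e1 (- p); rewrite rnormN opprK in E2.
apply: (fev_unique (fevD E1 (fevN (E2 p_small)))).
have S := sinhc_adE x; have Sb := fbound_iter_adj x csinh_le1.
have T1 := fevM (fbound_tau p) Sb (fev_tau p) S.
have T2 := fevM Sb (fbound_tau p) S (fev_tau p).
have := fevZ 2 (fevD T1 (fevN T2)).
rewrite rmorph_nat; congr (fev _ _); apply/funext => n.
rewrite -[_ - _]/(fad _ _) -fpsi_shift // fps_scaleE fps_addE fps_oppE !fpsi_tau_const.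
rewrite iter_adjN; case: n => [|n] /=; first by rewrite scale0r scaler0 expr0 scale1r subrr.
rewrite /csinh /cexpo !rscaleE !scalerA -rmorphM /=.
apply: etrans (congr1 (fun c : R[i] => c *: (adj p (iter n (adj p) x) : calg A)) _) (@scalerBl _ (calg A) _ _ _).
rewrite -signr_odd /=; case: (odd n) => /=.
  by rewrite expr0 mulr1 subrr mulr0 rmorph0.
by rewrite expr1 mulrN1 opprK rmorphM rmorph_nat mulr_natl mulr2n.
Qed.

(** The solution is the fixed point of x |-> q - (sinhc_ad p x - x). As sinh x / x is even, K need
    only be stable under the double bracket; for off-diagonal elements a single bracket would leave
    K. *)
Lemma sinhc_ad_onto (K : set (calg A)) q : closed K -> K 0 ->
  (forall x y, K x -> K y -> K (x + y)) -> (forall (c : R) x, K x -> K (c%:C *: x)) ->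
  (forall x, K x -> K (adj p (adj p x))) -> K q ->
  exists x, [/\ K x, rnorm x <= 2 * rnorm q & sinhc_ad p x = q].
Proof.
move=> cK K0 KD KZ Kad Kq; have q0 := rnorm_ge0 q.
have KN x : K x -> K (- x).
  by move=> Kx; have := KZ (-1) _ Kx; rewrite rmorphN rmorph1 scaleN1r.
have KM x : K x -> K (sinhc_ad p x).
  move=> Kx; apply: (fev_closed cK K0 KD _ (sinhc_adE x)) => n.
  rewrite fpsi_tau_const /csinh; case: ifP => [_|/negbT on]; first by rewrite scale0r.
  rewrite rscaleE; apply: KZ; rewrite -[n]odd_double_half (negbTE on) add0n.
  elim: n./2 => [|m IH] //; rewrite doubleS !iterS; exact: Kad.
pose T x := q - (sinhc_ad p x - x).
pose F := K `&` [set x | rnorm x <= 2 * rnorm q].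
have [x [Kx xq] Tx] : exists2 x, F x & T x = x.
  apply: (@contraction _ _ _ _ 0).
  - apply: closedI => //; exact: closed_ball.
  - by split=> //=; rewrite rnorm0 mulr_ge0.
  - move=> x [Kx /= xq]; split.
      exact: KD Kq (KN _ (KD _ _ (KM _ Kx) (KN _ Kx))).
    rewrite /=; apply: le_trans (rnormB _ _) _.
    by have := sinhc_ad_near x; lra.
  - move=> x y _ _; rewrite /T.
    have -> : q - (sinhc_ad p x - x) - (q - (sinhc_ad p y - y)) =
       - (sinhc_ad p (x - y) - (x - y)) by rewrite sinhc_adB; nc_ring.
    by rewrite rnormN; exact: sinhc_ad_near.
exists x; split=> //; move: Tx; rewrite /T => /eqP.
by rewrite subr_eq addrC subrK eq_sym => /eqP.
Qed.
End SinhAd.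

(** * Functional calculus of a unitary *)

Section ComplexModulus.
Variable R : realType.
Implicit Types (z w : R[i]) (x : R).

Definition cabs z : R := complex.Re `|z|.
Lemma cabsE z : `|z| = (cabs z)%:C.
Proof. by rewrite /cabs RRe_real // ger0_real // normr_ge0. Qed.
Lemma cabs_ge0 z : 0 <= cabs z. Proof. by rewrite -lecR -cabsE normr_ge0. Qed.
Lemma cabsM z w : cabs (z * w) = cabs z * cabs w.
Proof. by apply: complexI; rewrite [RHS]rmorphM /= -!cabsE normrM. Qed.
Lemma cabsD z w : cabs (z + w) <= cabs z + cabs w.
Proof. by rewrite -lecR rmorphD /= -!cabsE ler_normD. Qed.
Lemma cabsN z : cabs (- z) = cabs z. Proof. by rewrite /cabs normrN. Qed.
Lemma cabsBC z w : cabs (z - w) = cabs (w - z). Proof. by rewrite /cabs distrC. Qed.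
Lemma cabsB z w : cabs (z - w) <= cabs z + cabs w.
Proof. by rewrite -(cabsN w); exact: cabsD. Qed.
Lemma cabsR x : cabs x%:C = `|x|.
Proof. by rewrite /cabs normc_def /= expr0n addr0 sqrtr_sqr. Qed.
Lemma cabs0 : cabs 0 = 0. Proof. by rewrite -[0]/((0 : R)%:C) cabsR normr0. Qed.
Lemma cabs1 : cabs 1 = 1. Proof. by rewrite -[1]/((1 : R)%:C) cabsR normr1. Qed.
Lemma cabsJ z : cabs z^* = cabs z. Proof. by rewrite /cabs norm_conjC. Qed.
Lemma cabsX z n : cabs (z ^+ n) = cabs z ^+ n.
Proof. by elim: n => [|n IH]; rewrite ?expr0 ?cabs1 // !exprS cabsM IH. Qed.
Definition circ z := z * z^* = 1.
Lemma cabs_circ z : circ z -> cabs z = 1.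
Proof.
move=> h; have : cabs z ^+ 2 = 1 by apply: complexI; rewrite rmorphXn /= -cabsE normCK h.
move/eqP; rewrite sqrf_eq1 => /orP[/eqP //|/eqP h1]; have := cabs_ge0 z; lra.
Qed.
Lemma circ1 : circ 1. Proof. by rewrite /circ rmorph1 mulr1. Qed.
Lemma circN z : circ z -> circ (- z). Proof. by rewrite /circ rmorphN mulrNN. Qed.
Lemma circ_sqrt z : circ z -> exists2 w, circ w & w ^+ 2 = z.
Proof.
move=> h; exists (sqrtC z); last exact: sqrtCK.
have h1 : `|sqrtC z| = 1.
  apply/eqP; rewrite -(@pexpr_eq1 _ _ 2) ?normr_ge0 // -normrX sqrtCK cabsE cabs_circ //.
by rewrite /circ -normCK h1 expr1n.
Qed.

(** Cauchy's estimate without integrals. Write p z as e (z^2) + z o (z^2); the values at w and - w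
    bound e and o at w^2 by M, and every point of the circle is such a square. The degree halves. *)
Lemma coef_bound (p : {poly R[i]}) (M : R) j :
  (forall z, circ z -> cabs p.[z] <= M) -> cabs p`_j <= M.
Proof.
elim: {p}(size p) {-2}p (leqnn (size p)) j => [|n IH] p sp j pM.
  have M0 : 0 <= M by apply: le_trans (pM 1 circ1); exact: cabs_ge0.
  by rewrite nth_default ?cabs0 // (leq_trans sp).
have [s1|s1] := leqP (size p) 1.
  have M1 := pM 1 circ1; rewrite (size1_polyC s1) hornerC in M1 *.
  by rewrite coefC; case: ifP => // _; rewrite cabs0; apply: le_trans M1; exact: cabs_ge0.
have eo := poly_even_odd p.
have ev z : circ z -> p.[z] = (even_poly p).[z ^+ 2] + (odd_poly p).[z ^+ 2] * z.
  by move=> _; rewrite -{1}eo !hornerE !horner_comp !hornerE.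
have half (a b : R[i]) : cabs (a + b) <= M -> cabs (a - b) <= M -> cabs a <= M /\ cabs b <= M.
  move=> h1 h2; have A2 : cabs (2 * a) <= 2 * M.
    have -> : 2 * a = (a + b) + (a - b) by ring.
    by apply: le_trans (cabsD _ _) _; lra.
  have B2 : cabs (2 * b) <= 2 * M.
    have -> : 2 * b = (a + b) - (a - b) by ring.
    by apply: le_trans (cabsB _ _) _; lra.
  have c2 : cabs 2 = 2 by rewrite -(rmorph_nat (real_complex R)) cabsR ger0_norm.
  by rewrite !cabsM c2 !ler_pM2l in A2 B2.
have eoM z : circ z -> cabs (even_poly p).[z] <= M /\ cabs (odd_poly p).[z] <= M.
  move=> /circ_sqrt[w cw <-].
  have h1 := pM _ cw; have h2 := pM _ (circN cw).
  rewrite ev // in h1; rewrite ev ?sqrrN ?mulrN in h2; last exact: circN.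
  by have [-> ] := half _ _ h1 h2; rewrite cabsM (cabs_circ cw) mulr1.
have -> : p`_j = if odd j then (odd_poly p)`_j./2 else (even_poly p)`_j./2.
  rewrite coef_even_poly coef_odd_poly -{1}[j]odd_double_half.
  by case: (odd j) => /=; rewrite ?add1n ?add0n.
case: ifP => _; apply: IH; try by move=> z /eoM[].
  by apply: leq_trans (size_odd_poly _) _; lia.
apply: leq_trans (size_even_poly _) _; rewrite uphalfE leq_half_double -addnn; lia.
Qed.
End ComplexModulus.

Section RealPower.
Variable R : realType.
Lemma bernoulli_le (u : R) n : 0 <= u -> 1 + n%:R * u <= (1 + u) ^+ n.
Proof.
move=> u0; elim: n => [|n IH]; first by rewrite mul0r addr0 expr0.
rewrite exprS; have : 0 <= n%:R :> R by [].
have := IH; rewrite -natr1; move: (n%:R : R) ((1 + u) ^+ n) => m y; nra.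
Qed.

(** If a > M, then (a / M)^(2^k) outgrows any linear function of 2^k: Bernoulli's inequality,
    squared, already gives a quadratic lower bound. *)
Lemma le_of_pow_le (a M : R) (s : nat) : 0 <= a -> 0 <= M ->
  (forall k, a ^+ (2 ^ k) <= (2 ^ k * s + 1)%:R * M ^+ (2 ^ k)) -> a <= M.
Proof.
move=> a0 M0 h; rewrite leNgt; apply/negP => aM.
have [M00|Mp] : M = 0 \/ 0 < M by move: M0; rewrite le_eqVlt => /orP[/eqP|]; auto.
  by have := h 0%N; rewrite M00 !expr1 mulr0; lra.
pose u := a / M - 1; have u0 : 0 < u by rewrite subr_gt0 ltr_pdivlMr // mul1r.
have aE : a = M * (1 + u) by rewrite /u addrCA subrr addr0 mulrC divfK // gt_eqF.
have {}h k : (1 + u) ^+ (2 ^ k) <= (2 ^ k * s + 1)%:R.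
  have := h k; rewrite {1}aE exprMn mulrC ler_pM2r // exprn_gt0 //.
have [k hk] : exists k, (2 * (s + 1))%:R < (2 ^ k)%:R * u ^+ 2 :> R.
  have p : 0 < u ^+ 2 by rewrite exprn_gt0.
  have [m hm] : exists m, (2 * (s + 1))%:R / u ^+ 2 < m%:R :> R.
    by exists (Num.bound ((2 * (s + 1))%:R / u ^+ 2)); rewrite archi_boundP // divr_ge0 // ltW.
  exists m; rewrite -ltr_pdivrMr //; apply: lt_trans hm _.
  by rewrite ltr_nat ltn_expl.
have := h k.+1; rewrite expnSr exprM.
have := @bernoulli_le u (2 ^ k) (ltW u0).
have N1 : 1 <= (2 ^ k)%:R :> R by rewrite ler1n expn_gt0.
rewrite natrD !natrM; rewrite natrM natrD in hk.
move: ((1 + u) ^+ _) ((2 ^ k)%:R : R) (s%:R : R) hk N1 (ler0n R s) => t N S hk N1 S0 h1 h2.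
have t0 : 0 <= 1 + N * u by nra.
have h3 : (1 + N * u) ^+ 2 <= t ^+ 2 by rewrite lerXn2r // nnegrE; lra.
have h4 : N * (2 * (S + 1)) <= N * (N * u ^+ 2) by rewrite ler_wpM2l; lra.
nra.
Qed.
End RealPower.

Section Calculus.
Variables (R : realType) (A : cstarAlgType R) (g : calg A).
Hypothesis g_unit : unitary g.
Implicit Types (x y : calg A) (f : R[i] -> R[i]) (p : {poly R[i]}).

(* Laurent polynomial functions of [g]; on the spectrum, [star g] is [z^-1 = z^*]. *)
Inductive lpoly : (R[i] -> R[i]) -> calg A -> Prop :=
| lpoly_const c : lpoly (fun=> c) c%:A
| lpoly_id : lpoly id g
| lpoly_conj : lpoly (fun z => z^*) (star g)
| lpolyD f1 f2 x1 x2 : lpoly f1 x1 -> lpoly f2 x2 -> lpoly (fun z => f1 z + f2 z) (x1 + x2)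
| lpolyM f1 f2 x1 x2 : lpoly f1 x1 -> lpoly f2 x2 -> lpoly (fun z => f1 z * f2 z) (x1 * x2).

Let gs : star g * g = 1. Proof. by case: g_unit. Qed.
Let sg : g * star g = 1. Proof. by case: g_unit. Qed.
Let ng : rnorm g = 1. Proof. exact: rnorm_unitary. Qed.
Let pw n : star g ^+ n * g ^+ n = 1.
Proof. by rewrite -exprMn_comm ?gs ?expr1n // /GRing.comm gs sg. Qed.

Lemma norm_normal_pow x k : star x * x = x * star x -> rnorm (x ^+ (2 ^ k)) = rnorm x ^+ (2 ^ k).
Proof.
move=> nx; elim: k => [|k IH]; first by rewrite !expr1.
have sq y : star y * y = y * star y -> rnorm (y ^+ 2) = rnorm y ^+ 2.
  move=> ny; have sa z : star z = z -> rnorm (z ^+ 2) = rnorm z ^+ 2.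
    by move=> sz; rewrite -rnormCstar sz.
  apply/eqP; rewrite -(@eqrXn2 _ 2) ?exprn_ge0 ?rnorm_ge0 //.
  rewrite -(rnormCstar (y ^+ 2)) starX -exprMn_comm // sa ?starM ?starK //.
  by rewrite rnormCstar.
rewrite expnS mulnC !exprM sq ?IH // starX; apply: commrX; apply: commr_sym.
by apply: commrX; rewrite /GRing.comm nx.
Qed.

Local Notation ev p := (horner_alg g p).

Lemma ev_sum p : ev p = \sum_(i < size p) p`_i *: g ^+ i.
Proof.
rewrite /horner_alg /horner_morph /= horner_coef size_map_poly; apply: eq_bigr => i _.
by rewrite coef_map /= mulr_algl.
Qed.
Lemma ev_comm p : ev p * star g = star g * ev p.
Proof.
rewrite ev_sum mulr_suml mulr_sumr; apply: eq_bigr => i _.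
rewrite -scalerAl -scalerAr; congr (_ *: _); apply: commr_sym; apply: commrX.
by rewrite /GRing.comm gs sg.
Qed.

Lemma ev_normal p : star (ev p) * ev p = ev p * star (ev p).
Proof.
have c n : ev p * star g ^+ n = star g ^+ n * ev p by apply: commrX; exact: ev_comm.
have -> : star (ev p) = \sum_(i < size p) star (p`_i *: g ^+ i) by rewrite {1}ev_sum star_sum.
rewrite mulr_suml mulr_sumr.
by apply: eq_bigr => i _; rewrite !starZ starX -scalerAl -scalerAr c.
Qed.

(* Spectral theory is avoided: [rnorm (x ^+ 2^k) = rnorm x ^+ 2^k] for normal [x], and the
   norm of [ev (p ^+ 2^k)] is at most the sum of its coefficients, each at most [M ^+ 2^k];
   the number of coefficients grows only linearly in [2^k]. *)
Lemma ev_bound p (M : R) : (forall z, circ z -> cabs p.[z] <= M) -> rnorm (ev p) <= M.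
Proof.
move=> pM; have M0 : 0 <= M by apply: le_trans (pM 1 (circ1 R)); exact: cabs_ge0.
apply: (@le_of_pow_le _ _ _ (size p)) => // [|k]; first exact: rnorm_ge0.
rewrite -norm_normal_pow; last exact: ev_normal.
have -> : ev p ^+ (2 ^ k) = ev (p ^+ (2 ^ k)) by rewrite rmorphXn.
rewrite ev_sum; apply: le_trans (rnorm_sum _ _ _) _.
apply: (@le_trans _ _ (\sum_(i < size (p ^+ (2 ^ k))) M ^+ (2 ^ k))).
  apply: ler_sum => i _; rewrite rnormZc -/(cabs _).
  have gn : rnorm (g ^+ i) <= 1 by apply: le_trans (rnormX _ _) _; rewrite ng expr1n.
  rewrite -[leRHS]mulr1 ler_pM ?cabs_ge0 ?rnorm_ge0 //; apply: coef_bound => z cz.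
  by rewrite horner_exp cabsX lerXn2r ?nnegrE ?cabs_ge0 ?pM.
rewrite sumr_const card_ord -[leLHS]mulr_natl ler_wpM2r ?exprn_ge0 // ler_nat.
have [->|p0] := eqVneq p 0; first by rewrite expr0n expn_eq0 /= size_poly0.
by apply: leq_trans (size_exp_leq _ _) _; rewrite addn1 ltnS mulnC leq_mul // leq_pred.
Qed.

(** Negative powers are cleared by a factor [star g ^+ d], which has modulus 1 on the circle and
    norm at most 1, so bounds for polynomials carry over. *)
Lemma lpoly_poly f x : lpoly f x -> exists d p,
  (forall z, circ z -> f z = (z^*) ^+ d * p.[z]) /\ x = star g ^+ d * ev p.
Proof.
have cc n z : circ z -> (z^*) ^+ n * z ^+ n = 1.
  by move=> cz; rewrite -exprMn mulrC cz expr1n.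
elim=> {f x} [c|||f1 f2 x1 x2 _ [d1 [p1 [h1 ->]]] _ [d2 [p2 [h2 ->]]]|
    f1 f2 x1 x2 _ [d1 [p1 [h1 ->]]] _ [d2 [p2 [h2 ->]]]].
- exists 0%N, c%:P; split=> [z _|]; first by rewrite hornerC mul1r.
  by rewrite mul1r horner_algC.
- exists 0%N, 'X; split=> [z _|]; first by rewrite hornerX mul1r.
  by rewrite mul1r horner_algX.
- exists 1%N, 1; split=> [z _|]; first by rewrite hornerC mulr1 expr1.
  by rewrite rmorph1 mulr1 expr1.
- exists (d1 + d2)%N, ('X^d2 * p1 + 'X^d1 * p2); split=> [z cz|].
    rewrite h1 // h2 // hornerD !hornerM !hornerXn exprD mulrDr; congr (_ + _).
      by rewrite -mulrA [z^* ^+ d2 * _]mulrA cc // mul1r.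
    by rewrite [_ ^+ d1 * _ ^+ d2]mulrC -mulrA [z^* ^+ d1 * _]mulrA cc // mul1r.
  rewrite rmorphD !rmorphM !rmorphXn /= horner_algX mulrDr !exprD; congr (_ + _).
    by rewrite -mulrA [star g ^+ d2 * _]mulrA pw mul1r.
  have -> : star g ^+ d1 * star g ^+ d2 = star g ^+ d2 * star g ^+ d1 by rewrite -!exprD addnC.
  by rewrite -mulrA [star g ^+ d1 * _]mulrA pw mul1r.
- exists (d1 + d2)%N, (p1 * p2); split=> [z cz|].
    by rewrite h1 // h2 // hornerM exprD mulrACA.
  rewrite rmorphM exprD -!mulrA; congr (_ * _); rewrite mulrA [RHS]mulrA; congr (_ * _).
  by apply: commrX; exact: ev_comm.
Qed.

Lemma lpoly_le f x (M : R) : lpoly f x -> (forall z, circ z -> cabs (f z) <= M) -> rnorm x <= M.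
Proof.
move=> /lpoly_poly[d [p [fE ->]]] fM; apply: le_trans (rnormM _ _) _.
have : rnorm (star g ^+ d) <= 1.
  by apply: le_trans (rnormX _ _) _; rewrite rnorm_star ng expr1n.
have : rnorm (ev p) <= M.
  apply: ev_bound => z cz; have := fM z cz; rewrite fE // cabsM cabsX cabsJ.
  by rewrite cabs_circ // expr1n mul1r.
have := rnorm_ge0 (ev p); have := rnorm_ge0 (star g ^+ d); nra.
Qed.
Lemma lpoly_bounded f x : lpoly f x -> exists M, forall z, circ z -> cabs (f z) <= M.
Proof.
elim=> {f x} [c|||f1 f2 x1 x2 _ [M1 h1] _ [M2 h2]|f1 f2 x1 x2 _ [M1 h1] _ [M2 h2]].
- by exists (cabs c).
- by exists 1 => z /cabs_circ ->.
- by exists 1 => z cz; rewrite cabsJ cabs_circ.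
- by exists (M1 + M2) => z cz; apply: le_trans (cabsD _ _) _; apply: lerD; auto.
- exists (M1 * M2) => z cz; rewrite cabsM ler_pM ?cabs_ge0 //; auto.
Qed.
Lemma lpoly_star f x : lpoly f x -> lpoly (fun z => (f z)^*) (star x).
Proof.
have eq h h' y y' : lpoly h y -> h =1 h' -> y = y' -> lpoly h' y'.
  by move=> hy /funext <- <-.
elim=> {f x} [c|||f1 f2 x1 x2 _ h1 _ h2|f1 f2 x1 x2 _ h1 _ h2].
- by apply: eq (lpoly_const c^*) _ _ => //; rewrite starZ star1.
- exact: lpoly_conj.
- by apply: eq lpoly_id _ _ => [z|]; [rewrite /= conjcK|rewrite starK].
- by apply: eq (lpolyD h1 h2) _ _ => [z|]; [rewrite /= rmorphD|rewrite starD].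
- apply: eq (lpolyM h2 h1) _ _ => [z|]; last by rewrite starM.
  by rewrite /= rmorphM mulrC.
Qed.
Lemma lpoly_comm f x : lpoly f x -> x * g = g * x.
Proof.
elim=> {f x} [c|||f1 f2 x1 x2 _ h1 _ h2|f1 f2 x1 x2 _ h1 _ h2] //.
- by rewrite -scalerAl -scalerAr mul1r mulr1.
- by rewrite gs sg.
- by rewrite mulrDl mulrDr h1 h2.
- by rewrite -mulrA h2 !mulrA h1.
Qed.
End Calculus.

(** * Uniform limits of Laurent polynomials on the unit circle *)

Section UniformCalculus.
Variables (R : realType) (A : cstarAlgType R) (g : calg A).
Hypothesis g_unit : unitary g.
Implicit Types (x y : calg A) (f : R[i] -> R[i]) (u v : R[i] -> R).

(** The graph of the continuous functional calculus, on the whole circle instead of the spectrum.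
    The function determines x ([fc_eq]), but functions differing on the circle may share their x. *)
Definition fc f x := forall e : R, 0 < e -> exists f0 x0,
  [/\ lpoly g f0 x0, forall z, circ z -> cabs (f0 z - f z) <= e & rnorm (x0 - x) <= e].

Lemma fc_lpoly f x : lpoly g f x -> fc f x.
Proof.
by move=> fx e e0; exists f, x; split=> // [z _|]; rewrite subrr ?cabs0 ?rnorm0 ltW.
Qed.

Lemma le_addeps (a b c : R) : 0 <= c -> (forall e, 0 < e -> a <= b + c * e) -> a <= b.
Proof.
move=> c0 h; rewrite leNgt; apply/negP => ba.
have p : 0 < (a - b) / (2 * (c + 1)) by rewrite divr_gt0 ?subr_gt0 // mulr_gt0 //; lra.
have := h _ p; set e := (a - b) / _ in p *.
have : a - b = e * (2 * (c + 1)) by rewrite /e divfK // gt_eqF // mulr_gt0 //; lra.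
nra.
Qed.

Lemma fc_le f x (M : R) : fc f x -> (forall z, circ z -> cabs (f z) <= M) -> rnorm x <= M.
Proof.
move=> fx fM; apply: (@le_addeps _ _ 2) => // e e0.
have [f0 [x0 [p0 f0f x0x]]] := fx e e0.
have h : rnorm x0 <= M + e.
  apply: (lpoly_le g_unit p0) => z cz; have := cabsD (f0 z - f z) (f z).
  by rewrite subrK; have := f0f z cz; have := fM z cz; lra.
have := rnorm_tri x0 x 0; rewrite !subr0 rnormBC; lra.
Qed.

Lemma fc_bounded f x : fc f x -> exists M, forall z, circ z -> cabs (f z) <= M.
Proof.
move=> fx; have [f0 [x0 [p0 f0f _]]] := fx 1 ltr01.
have [M hM] := lpoly_bounded p0; exists (M + 1) => z cz.
have := cabsD (f z - f0 z) (f0 z); rewrite subrK cabsBC.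
have := f0f z cz; have := hM z cz; lra.
Qed.

Lemma fcD f1 f2 x1 x2 : fc f1 x1 -> fc f2 x2 -> fc (fun z => f1 z + f2 z) (x1 + x2).
Proof.
move=> h1 h2 e e0; have e2 : 0 < e / 2 by lra.
have [f [x [p pf px]]] := h1 _ e2; have [f' [x' [p' pf' px']]] := h2 _ e2.
exists (fun z => f z + f' z), (x + x'); split=> [|z cz|]; first exact: lpolyD.
  rewrite opprD addrACA; apply: le_trans (cabsD _ _) _.
  by have := pf z cz; have := pf' z cz; lra.
by rewrite opprD addrACA; apply: le_trans (rnormD _ _) _; lra.
Qed.
Lemma fc_const c : fc (fun=> c) c%:A. Proof. exact/fc_lpoly/lpoly_const. Qed.

Lemma fcM f1 f2 x1 x2 : fc f1 x1 -> fc f2 x2 -> fc (fun z => f1 z * f2 z) (x1 * x2).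
Proof.
move=> h1 h2; have [M1 b1] := fc_bounded h1; have [M2 b2] := fc_bounded h2.
have n1 := fc_le h1 b1; have n2 := fc_le h2 b2.
have M10 := le_trans (rnorm_ge0 _) n1; have M20 := le_trans (rnorm_ge0 _) n2.
move=> e e0; pose K := M1 + M2 + 1.
have K0 : 0 < K by rewrite /K; lra.
pose d := Num.min 1 (e / K).
have d0 : 0 < d by rewrite lt_min ltr01 divr_gt0.
have d1 : d <= 1 by rewrite ge_min lexx.
have dK : d * K <= e by rewrite -ler_pdivlMr // ge_min lexx orbT.
have [f [x [p pf px]]] := h1 _ d0; have [f' [x' [p' pf' px']]] := h2 _ d0.
exists (fun z => f z * f' z), (x * x'); split=> [|z cz|]; first exact: lpolyM.
  have -> : f z * f' z - f1 z * f2 z = (f z - f1 z) * (f' z - f2 z)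
     + (f z - f1 z) * f2 z + f1 z * (f' z - f2 z) by ring.
  apply: le_trans (cabsD _ _) _; apply: le_trans (lerD (cabsD _ _) (lexx _)) _.
  rewrite !cabsM; have td := pf z cz; have sd := pf' z cz; have bM := b1 z cz; have aM := b2 z cz.
  have t0 := cabs_ge0 (f z - f1 z); have s0 := cabs_ge0 (f' z - f2 z).
  have b0 := cabs_ge0 (f1 z); have a0 := cabs_ge0 (f2 z).
  rewrite /K in dK.
  have m1 : cabs (f z - f1 z) * cabs (f' z - f2 z) <= d * 1.
    by apply: ler_pM => //; apply: le_trans sd d1.
  have m2 : cabs (f z - f1 z) * cabs (f2 z) <= d * M2 by apply: ler_pM.
  have m3 : cabs (f1 z) * cabs (f' z - f2 z) <= M1 * d by apply: ler_pM.
  lra.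
have -> : x * x' - x1 * x2 = (x - x1) * (x' - x2) + (x - x1) * x2 + x1 * (x' - x2) by nc_ring.
apply: le_trans (rnormD _ _) _; apply: le_trans (lerD (rnormD _ _) (lexx _)) _.
have m1 : rnorm ((x - x1) * (x' - x2)) <= d * 1.
  apply: le_trans (rnormM _ _) _; apply: ler_pM; rewrite ?rnorm_ge0 //.
  exact: le_trans px' d1.
have m2 : rnorm ((x - x1) * x2) <= d * M2.
  by apply: le_trans (rnormM _ _) _; apply: ler_pM; rewrite ?rnorm_ge0.
have m3 : rnorm (x1 * (x' - x2)) <= M1 * d.
  by apply: le_trans (rnormM _ _) _; apply: ler_pM; rewrite ?rnorm_ge0.
rewrite /K in dK; lra.
Qed.

Lemma fcZ c f x : fc f x -> fc (fun z => c * f z) (c *: x).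
Proof. by move=> fx; have := fcM (fc_const c) fx; rewrite mulr_algl. Qed.

Lemma fc_ext f f' x : fc f x -> (forall z, circ z -> f z = f' z) -> fc f' x.
Proof.
move=> fx ff e e0; have [f0 [x0 [p h1 h2]]] := fx e e0; exists f0, x0; split=> // z cz.
by rewrite -ff // h1.
Qed.

Lemma fcB f1 f2 x1 x2 : fc f1 x1 -> fc f2 x2 -> fc (fun z => f1 z - f2 z) (x1 - x2).
Proof.
move=> h1 h2; rewrite -(scaleN1r x2).
by apply: fc_ext (fcD h1 (fcZ (-1) h2)) _ => z _; rewrite mulN1r.
Qed.

Lemma fc_eq f f' x x' : fc f x -> fc f' x' -> (forall z, circ z -> f z = f' z) -> x = x'.
Proof.
move=> fx fx' ff; apply/eqP; rewrite -subr_eq0 -rnorm_eq0 eq_le rnorm_ge0 andbT.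
by apply: (fc_le (fcB fx fx')) => z cz; rewrite ff // subrr cabs0.
Qed.

Lemma fc_star f x : fc f x -> fc (fun z => (f z)^*) (star x).
Proof.
move=> fx e e0; have [f0 [x0 [p h1 h2]]] := fx e e0.
exists (fun z => (f0 z)^*), (star x0); split=> [|z cz|]; first exact: lpoly_star.
  by rewrite -rmorphB cabsJ h1.
by rewrite -starB rnorm_star.
Qed.

Lemma fc_comm f x : fc f x -> x * g = g * x.
Proof.
move=> fx; apply/eqP; rewrite -subr_eq0 -rnorm_eq0 eq_le rnorm_ge0 andbT.
apply: (@le_addeps _ _ 2) => // e e0; rewrite add0r.
have [f0 [x0 [p _ h2]]] := fx e e0; have c := lpoly_comm g_unit p.
have -> : x * g - g * x = (x - x0) * g - g * (x - x0).
  rewrite mulrBl mulrBr c; nc_ring.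
apply: le_trans (rnormB _ _) _.
have := rnormM (x - x0) g; have := rnormM g (x - x0).
by rewrite (rnorm_unitary g_unit) mul1r mulr1 rnormBC; lra.
Qed.

Lemma fc_lim f : (forall e : R, 0 < e -> exists f' x',
    fc f' x' /\ forall z, circ z -> cabs (f' z - f z) <= e) -> exists x, fc f x.
Proof.
move=> h.
have i0 n : 0 < n.+1%:R^-1 :> R by rewrite invr_gt0 ltr0n.
have /boolp.choice[F hF] : forall n : nat, exists fx : (R[i] -> R[i]) * calg A,
    fc fx.1 fx.2 /\ forall z, circ z -> cabs (fx.1 z - f z) <= n.+1%:R^-1.
  by move=> n; have [f' [x' hx]] := h _ (i0 n); exists (f', x').
pose X n := (F n).2.
have small (e : R) : 0 < e -> exists N, forall n, (N <= n)%N -> n.+1%:R^-1 < e.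
  move=> e0; have [N _ hN] := near_infty_natSinv_lt (PosNum e0).
  by exists N => n Nn; exact: hN.
have dist n m : rnorm (X n - X m) <= n.+1%:R^-1 + m.+1%:R^-1.
  have [a1 a2] := hF n; have [b1 b2] := hF m; apply: (fc_le (fcB a1 b1)) => z cz.
  have -> : (F n).1 z - (F m).1 z = ((F n).1 z - f z) - ((F m).1 z - f z) by ring.
  by apply: le_trans (cabsB _ _) _; apply: lerD; auto.
have [x Xx] : exists x, rcvg X x.
  apply: rcvg_complete => e e0; have [N hN] := small (e / 2) ltac:(lra).
  exists N => n m Nn nm; apply: le_lt_trans (dist _ _) _.
  have := hN n Nn; have := hN m (leq_trans Nn nm).
  move: (n.+1%:R^-1 : R) (m.+1%:R^-1 : R) => a b; lra.
exists x => e e0; have e4 : 0 < e / 4 by lra.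
have [N hN] := small _ e4; have [M hM] := Xx _ e4.
pose k := maxn N M; have [Fk Fk2] := hF k.
have [f0 [x0 [p h1 h2]]] := Fk _ e4; exists f0, x0; split=> // [z cz|].
  have -> : f0 z - f z = (f0 z - (F k).1 z) + ((F k).1 z - f z) by ring.
  apply: le_trans (cabsD _ _) _; have := h1 z cz; have := Fk2 z cz.
  have := hN k (leq_maxl _ _); move: (k.+1%:R^-1 : R) => a; lra.
have := rnorm_tri (X k) x0 x; have := hM k (leq_maxr _ _); rewrite -/(X k) in h2; lra.
Qed.

Definition adm u := exists x, fc (fun z => (u z)%:C) x.

Lemma adm_const (c : R) : adm (fun=> c).
Proof. by exists (c%:C)%:A; exact: fc_const. Qed.
Lemma admD u v : adm u -> adm v -> adm (fun z => u z + v z).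
Proof.
move=> [x hx] [y hy]; exists (x + y); apply: fc_ext (fcD hx hy) _ => z _.
by rewrite rmorphD.
Qed.
Lemma admM u v : adm u -> adm v -> adm (fun z => u z * v z).
Proof.
move=> [x hx] [y hy]; exists (x * y); apply: fc_ext (fcM hx hy) _ => z _.
by rewrite rmorphM.
Qed.
Lemma admZ c u : adm u -> adm (fun z => c * u z).
Proof. by move=> hu; apply: admM hu; exact: adm_const. Qed.
Lemma admB u v : adm u -> adm v -> adm (fun z => u z - v z).
Proof.
move=> hu hv; have := admD hu (admZ (-1) hv); rewrite (_ : (fun z => _) = (fun z => u z - v z)) //.
by apply/funext => z; rewrite mulN1r.
Qed.
Lemma adm_bounded u : adm u -> exists2 M, 0 < M & forall z, circ z -> `|u z| <= M.
Proof.
move=> [x /fc_bounded[M hM]]; exists (`|M| + 1) => [|z cz].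
  by have := normr_ge0 M; lra.
have := hM z cz; rewrite cabsR => h; apply: le_trans h _.
by have := ler_norm M; lra.
Qed.
Lemma adm_lim u : (forall e : R, 0 < e -> exists v, adm v /\
    forall z, circ z -> `|v z - u z| <= e) -> adm u.
Proof.
move=> h; apply: fc_lim => e e0; have [v [[x vx] hv]] := h e e0.
by exists (fun z => (v z)%:C), x; split=> // z cz; rewrite -rmorphB cabsR hv.
Qed.

(* Converges uniformly to [`|u|] from below when [`|u| <= 1]. *)
Fixpoint sqrt_iter u (n : nat) (z : R[i]) : R :=
  if n is m.+1 then sqrt_iter u m z + (u z ^+ 2 - sqrt_iter u m z ^+ 2) / 2 else 0.

Lemma sqrt_iterP u n z : `|u z| <= 1 ->
  0 <= sqrt_iter u n z /\ 0 <= `|u z| - sqrt_iter u n z <= `|u z| * (1 - `|u z| / 2) ^+ n.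
Proof.
move=> u1; have t0 := normr_ge0 (u z); elim: n => [|n [IH0 /andP[IH1 IH2]]] /=.
  by rewrite subr0 expr0 mulr1 t0 !lexx.
rewrite -(real_normK (num_real (u z))).
move: (sqrt_iter u n z) IH0 IH1 IH2 => w; move: (`|u z|) u1 t0 => t t1 t0 w0 tw h.
have wt : w <= t by lra.
have e : t - (w + (t ^+ 2 - w ^+ 2) / 2) = (t - w) * (1 - (t + w) / 2) by ring.
rewrite e; split; first by nra.
apply/andP; split; first by apply: mulr_ge0 => //; lra.
apply: (@le_trans _ _ ((t - w) * (1 - t / 2))); first by rewrite ler_wpM2l //; lra.
by rewrite exprSr mulrA ler_wpM2r //; lra.
Qed.

Lemma adm_abs1 u : adm u -> (forall z, circ z -> `|u z| <= 1) -> adm (fun z => `|u z|).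
Proof.
move=> hu u1; apply: adm_lim => e e0.
have [n hn] : exists n : nat, 2 / e < n%:R.
  by exists (Num.bound (2 / e)); rewrite archi_boundP // divr_ge0 // ltW.
exists (sqrt_iter u n); split.
  elim: n {hn} => [|n IH] /=; first exact: adm_const.
  apply: admD => //; have -> : (fun z => (u z ^+ 2 - sqrt_iter u n z ^+ 2) / 2) =
      (fun z => 2^-1 * (u z * u z - sqrt_iter u n z * sqrt_iter u n z)).
    by apply/funext => z; ring.
  by apply: admZ; apply: admB; apply: admM.
move=> z cz; have [_ /andP[h1 h2]] := sqrt_iterP n (u1 z cz).
rewrite distrC ger0_norm //; apply: le_trans h2 _.
have t0 := normr_ge0 (u z); have := u1 z cz; move: (`|u z|) t0 => t t0 t1.
have n0 : 0 < n%:R :> R by apply: le_lt_trans hn; rewrite divr_ge0 // ltW.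
rewrite ltr_pdivrMr // in hn.
(* Bernoulli gives t (1 - t / 2)^n <= 2 / n, a bound uniform in t although the convergence is not
   geometric near t = 0. *)
have B : (1 + n%:R * (t / 2)) * (1 - t / 2) ^+ n <= 1.
  have h : 1 + n%:R * (t / 2) <= (1 + t / 2) ^+ n by apply: bernoulli_le; lra.
  apply: (@le_trans _ _ ((1 + t / 2) ^+ n * (1 - t / 2) ^+ n)).
    by rewrite ler_wpM2r // exprn_ge0 //; lra.
  rewrite -exprMn; apply: exprn_ile1; nra.
have s0 : 0 <= (1 - t / 2) ^+ n by rewrite exprn_ge0 //; lra.
move: ((1 - t / 2) ^+ n) (n%:R : R) B s0 n0 hn => s m B s0 m0 em.
have : m * (t * s) <= 2 by nra.
move: (t * s) => q mq; nra.
Qed.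

Lemma adm_abs u : adm u -> adm (fun z => `|u z|).
Proof.
move=> hu; have [M M0 hM] := adm_bounded hu.
have -> : (fun z => `|u z|) = (fun z => M * `|M^-1 * u z|).
  apply/funext => z; rewrite normrM gtr0_norm ?invr_gt0 // mulrA mulfV ?mul1r //.
  by rewrite gt_eqF.
apply: admZ; apply: adm_abs1; first exact: admZ.
move=> z cz; rewrite normrM gtr0_norm ?invr_gt0 // mulrC ler_pdivrMr // mul1r.
exact: hM.
Qed.

(** max 0 (min 1 t), written with absolute values because [adm] is closed under these. *)
Definition clamp (t : R) : R := (1 + `|t| - `|t - 1|) / 2.
Lemma clamp0 t : t <= 0 -> clamp t = 0.
Proof. by move=> t0; rewrite /clamp !ler0_norm //; lra. Qed.
Lemma clamp1 t : 1 <= t -> clamp t = 1.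
Proof. by move=> t0; rewrite /clamp !ger0_norm //; lra. Qed.
Lemma clamp01 t : 0 <= clamp t <= 1.
Proof.
have [t0|t0] := leP t 0; first by rewrite clamp0 // lexx ler01.
have [t1|t1] := leP 1 t; first by rewrite clamp1 // lexx ler01.
have n1 : `|t| = t by rewrite ger0_norm // ltW.
have n2 : `|t - 1| = 1 - t by rewrite ltr0_norm ?opprB // subr_lt0.
by rewrite /clamp n1 n2; apply/andP; split; lra.
Qed.
Lemma adm_clamp u : adm u -> adm (fun z => clamp (u z)).
Proof.
move=> hu; rewrite /clamp; have -> : (fun z => (1 + `|u z| - `|u z - 1|) / 2) =
   (fun z => 2^-1 * ((1 + `|u z|) - `|u z - 1|)) by apply/funext => z; ring.
apply: admZ; apply: admB; first by apply: admD; [exact: adm_const|exact: adm_abs].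
by apply: adm_abs; apply: admB => //; exact: adm_const.
Qed.

(** The Neumann series of 1 / u in powers of 1 - u / s, which lies in [0, 1 - r / s], converges
    uniformly. *)
Lemma adm_inv u (r s : R) : 0 < r -> adm u -> (forall z, circ z -> r <= u z <= s) ->
  adm (fun z => (u z)^-1).
Proof.
move=> r0 hu us; have s0 : 0 < s.
  by have /andP[h1 h2] := us 1 (circ1 R); lra.
pose q z := 1 - s^-1 * u z.
have hq : adm q by apply: admB; [exact: adm_const|exact: admZ].
pose v n z := s^-1 * \sum_(0 <= i < n) q z ^+ i.
have hv n : adm (v n).
  apply: admZ; elim: n => [|n IH].
    by rewrite (_ : (fun _ => _) = (fun=> 0)); [exact: adm_const|apply/funext => z; rewrite big_geq].
  have -> : (fun z => \sum_(0 <= i < n.+1) q z ^+ i) =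
      (fun z => \sum_(0 <= i < n) q z ^+ i + q z ^+ n).
    by apply/funext => z; rewrite big_nat_recr.
  apply: admD => //; elim: n {IH} => [|n IH]; first exact: adm_const.
  by have := admM hq IH; congr adm; apply/funext => z; rewrite exprS.
apply: adm_lim => e e0.
pose k := 1 - r / s; have rs : r <= s.
  by have /andP[h1 h2] := us 1 (circ1 R); lra.
have k01 : 0 <= k < 1.
  rewrite /k subr_ge0 ler_pdivrMr // mul1r rs /= gtrBl divr_gt0 //.
have [n hn] : exists n, k ^+ n < e * r.
  have /andP[k0 k1] := k01; have er : 0 < e * r by rewrite mulr_gt0.
  have h : (fun n => k ^+ n : R) @ \oo --> (0 : R) by apply: cvg_expr; rewrite ger0_norm.
  have /cvgrPdist_lt/(_ _ er)[N _ hN] := h; exists N.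
  by have := hN N (leqnn _); rewrite /= sub0r normrN ger0_norm // exprn_ge0.
exists (v n); split=> // z cz; have /andP[u1 u2] := us z cz.
have uz : 0 < u z by lra.
have q01 : 0 <= q z <= k.
  rewrite /q /k subr_ge0 mulrC ler_pdivrMr // mul1r u2 /= lerD2l lerN2.
  by rewrite ler_wpM2r // invr_ge0 ltW.
have -> : v n z - (u z)^-1 = - (q z ^+ n / u z).
  have : (1 - q z) * \sum_(0 <= i < n) q z ^+ i = 1 - q z ^+ n.
    elim: n {hn hv} => [|n IH]; first by rewrite big_geq // expr0 mulr0 subrr.
    by rewrite big_nat_recr //= mulrDr IH exprS; ring.
  rewrite /v {1}/q opprB addrCA subrr addr0; move: (\sum_(_ <= _ < _) _) (q z ^+ n) => S Q h.
  apply: (@mulfI _ (u z)); first by rewrite gt_eqF.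
  by rewrite mulrBr mulfV ?gt_eqF // mulrA [u z * _]mulrC h; field; rewrite gt_eqF.
have /andP[q0 qk] := q01.
rewrite normrN ger0_norm ?divr_ge0 ?exprn_ge0 ?(ltW uz) // ler_pdivrMr //.
apply: (@le_trans _ _ (k ^+ n)).
  have /andP[k0 _] := k01; exact: lerXn2r.
by apply: le_trans (ltW hn) _; rewrite ler_wpM2l // ltW.
Qed.
End UniformCalculus.

(** * Cutoffs around a point of the spectrum *)

(* [n i] are cutoffs of [g] near the spectral point [lam], at scales growing with [i];
   [kap i] inverts [lam *: star g - 1] on the range of [1 - n i.+1], and [cut_near] says
   that its norm is small compared with the inverse of the scale of [n i]. *)
Record cutoffs (R : realType) (A : cstarAlgType R) (g : calg A) (L : nat) (lam : R[i])
    (n kap : nat -> calg A) : Prop := Cutoffs {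
  cut_lam : circ lam;
  cut_sa : forall i, star (n i) = n i;
  cut_comm : forall i, n i * g = g * n i;
  cut_mul : forall i j, (i < j)%N -> n j * n i = n i;
  cut_norm : forall i, rnorm (n i) <= 1;
  cut_near : forall i, rnorm ((g - lam%:A) * n i) * rnorm (kap i) <= 16^-1;
  cut_kapg : forall i, kap i * g = g * kap i;
  cut_kapn : forall i j, kap i * n j = n j * kap i;
  cut_kap : forall i, kap i * (lam *: star g - 1) * (1 - n i.+1) = 1 - n i.+1;
  cut_neq0 : n 0%N <> 0;
  cut_neq1 : n L <> 1 }.

Section Cutoffs.
Variables (R : realType) (A : cstarAlgType R) (g : calg A).
Hypothesis g_unit : unitary g.

Lemma fc_id : fc g id g. Proof. exact/fc_lpoly/lpoly_id. Qed.
Lemma fc_conj : fc g (fun z => z^*) (star g). Proof. exact/fc_lpoly/lpoly_conj. Qed.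

Lemma adm_Re : adm g (fun z => complex.Re z).
Proof.
exists (2^-1 *: (g + star g)); apply: fc_ext (fcZ g_unit _ (fcD fc_id fc_conj)) _ => z _.
by rewrite ReJ_add mulrC.
Qed.
Lemma adm_Im : adm g (fun z => complex.Im z).
Proof.
exists ((2 * 'i)^-1 *: (g - star g)).
apply: fc_ext (fcZ g_unit _ (fcB g_unit fc_id fc_conj)) _ => -[a b] _.
have -> : ((a +i* b) - (a +i* b)^*)%C = (2 * 'i) * (b%:C).
  by apply/eqP; rewrite eq_complex /=; apply/andP; split; apply/eqP; rewrite /=; ring.
by rewrite mulKf // mulf_neq0 ?pnatr_eq0 // neq0Ci.
Qed.

Definition sqdist (lam z : R[i]) : R := cabs (z - lam) ^+ 2.
Lemma sqdistE lam z : (sqdist lam z)%:C = (z - lam) * (z - lam)^*.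
Proof. by rewrite /sqdist rmorphXn /= -cabsE normCK. Qed.
Lemma fc_subc lam : fc g (fun z => z - lam) (g - lam%:A).
Proof. by apply: fcB => //; [exact: fc_id|exact: fc_const]. Qed.
Lemma adm_sqdist lam : adm g (sqdist lam).
Proof.
exists ((g - lam%:A) * star (g - lam%:A)).
apply: fc_ext (fcM g_unit (fc_subc lam) (fc_star (fc_subc lam))) _ => z _.
by rewrite sqdistE.
Qed.

Lemma fc_sum0 m (f : nat -> R[i] -> R[i]) : (forall j, fc g (f j) 0) ->
  fc g (fun z => \sum_(0 <= j < m) f j z) 0.
Proof.
move=> h; elim: m => [|m IH].
  have := @fc_const R A g 0; rewrite scale0r => h0.
  by apply: (fc_ext h0) => z _; rewrite big_geq.
have := fcD IH (h m); rewrite addr0 => h1; apply: (fc_ext h1) => z _.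
by rewrite big_nat_recr.
Qed.

(** Tent functions on [j, j + 2], written as differences so that their sum telescopes. *)
Definition hat (t : R) (j : nat) : R := clamp (t - j%:R) - clamp (t - j.+1%:R).
Lemma sum_hat (t : R) m : 1 <= t -> t <= m%:R -> \sum_(0 <= j < m) hat t j = 1.
Proof.
move=> t1 tm; have h k : \sum_(0 <= j < k) hat t j = clamp t - clamp (t - k%:R).
  elim: k => [|k IH]; first by rewrite big_geq // subr0 subrr.
  by rewrite big_nat_recr //= IH /hat addrA subrK.
by rewrite h clamp1 // clamp0 ?subr0 // subr_le0.
Qed.
Lemma hat_neq0 (t : R) j : hat t j != 0 -> j%:R < t < j%:R + 2.
Proof.
move=> h; apply/andP; split; rewrite ltNge; apply: contra h => h; rewrite /hat -natr1.
  by rewrite !clamp0 ?subrr //; lra.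
by rewrite !clamp1 ?subrr //; lra.
Qed.
Lemma adm_hat (u : R[i] -> R) j : adm g u -> adm g (fun z => hat (u z) j).
Proof.
by move=> hu; apply: admB => //; apply: adm_clamp => //; apply: admB => //; exact: adm_const.
Qed.

Lemma Re_Im_le1 (z : R[i]) : circ z -> `|complex.Re z| <= 1 /\ `|complex.Im z| <= 1.
Proof.
case: z => a b /(congr1 (@complex.Re R)) /= h.
have h2 : a * a + b * b = 1 by rewrite -h; ring.
by rewrite !ler_norml; split; apply/andP; split; nra.
Qed.

(** A partition of unity on the circle into pieces of small diameter has sum 1 at g, so not every
    piece vanishes at g. For a surviving piece, any point where its function is nonzero can be
    lam. *)
Lemma spectral_point (rho : R) : 0 < rho -> exists (lam : R[i]) (h : R[i] -> R) x,
  [/\ circ lam, fc g (fun z => (h z)%:C) x, x <> 0 &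
      forall z, circ z -> h z != 0 -> sqdist lam z <= rho ^+ 2].
Proof.
move=> rho0; pose N := (Num.bound (3 / rho)).+1; pose n : R := N%:R.
have n0 : 0 < n by rewrite ltr0n.
have nr : 3 <= n * rho.
  rewrite -ler_pdivrMr //; apply: (@le_trans _ _ (Num.bound (3 / rho))%:R).
    by apply/ltW; rewrite archi_boundP // divr_ge0 // ltW.
  by rewrite ler_nat.
(* The real and imaginary parts are rescaled to [1, 2 n + 1], where the first 2 N + 1 hats sum to 1.
   Two points of one piece differ by at most 2 / n in each coordinate, hence 8 / n^2 <= rho^2 from n
   rho >= 3. *)
pose T z := n * complex.Re z + (n + 1); pose S z := n * complex.Im z + (n + 1).
have aT : adm g T by apply: admD; [apply: admZ => //; exact: adm_Re|exact: adm_const].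
have aS : adm g S by apply: admD; [apply: admZ => //; exact: adm_Im|exact: adm_const].
pose h j k z := hat (T z) j * hat (S z) k.
pose m := (2 * N + 1)%N.
have mE : m%:R = 2 * n + 1 :> R by rewrite natrD natrM.
have [j [k [x [hx x0]]]] : exists j k x, fc g (fun z => (h j k z)%:C) x /\ x <> 0.
  apply: contrapT => nex.
  have z0 j k : fc g (fun z => (h j k z)%:C) 0.
    have [x hx] : adm g (h j k) by apply: admM => //; apply: adm_hat.
    by have [<-//|xn] := pselect (x = 0); exfalso; apply: nex; exists j, k, x.
  have F := fc_sum0 m (fun j => fc_sum0 m (z0 j)).
  have : (0 : calg A) = 1%:A.
    apply: (fc_eq g_unit F (fc_const g 1)) => z cz.
    have [hr hi] := Re_Im_le1 cz; move: hr hi; rewrite !ler_norml => /andP[r1 r2] /andP[i1 i2].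
    rewrite (eq_bigr (fun j => (\sum_(0 <= k < m) h j k z)%:C)); last first.
      by move=> j _; rewrite rmorph_sum.
    rewrite -rmorph_sum (eq_bigr (fun j => hat (T z) j)) ?sum_hat //.
    - by rewrite /T; nra.
    - by rewrite /T mE; nra.
    - move=> j _; rewrite /h -mulr_sumr sum_hat ?mulr1 //; first by rewrite /S; nra.
      by rewrite /S mE; nra.
  by rewrite scale1r => /eqP; rewrite eq_sym oner_eq0.
have [lam [cl hl]] : exists lam, circ lam /\ h j k lam != 0.
  apply: contrapT => nex; apply: x0.
  have := fc_const g (0 : R[i]); rewrite scale0r => f0.
  apply: (fc_eq g_unit hx f0) => z cz; have [->//|hz] := eqVneq (h j k z) 0.
  by exfalso; apply: nex; exists z.
exists lam, (h j k), x; split=> // z cz hz.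
move: hl hz; rewrite /h !mulf_eq0 !negb_or => /andP[/hat_neq0/andP[a1 a2] /hat_neq0/andP[b1 b2]].
move=> /andP[/hat_neq0/andP[c1 c2] /hat_neq0/andP[d1 d2]].
move: a1 a2 b1 b2 c1 c2 d1 d2; rewrite /T /S; case: z {cz} => p q; case: lam {cl} => p' q' /=.
move=> a1 a2 b1 b2 c1 c2 d1 d2.
have -> : sqdist (p' +i* q')%C (p +i* q)%C = (p - p') ^+ 2 + (q - q') ^+ 2.
  apply: complexI; rewrite sqdistE; apply/eqP; rewrite eq_complex /=.
  by apply/andP; split; apply/eqP; ring.
have e1 : `|n * (p - p')| <= 2 by rewrite ler_norml; apply/andP; split; lra.
have e2 : `|n * (q - q')| <= 2 by rewrite ler_norml; apply/andP; split; lra.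
have sq (t : R) : `|t| <= 2 -> t ^+ 2 <= 4.
  by move=> t2; rewrite -real_normK ?num_real //; have := normr_ge0 t; nra.
have := sq _ e1; have := sq _ e2; rewrite !exprMn.
have n2 : 0 < n ^+ 2 by rewrite exprn_gt0.
have nr2 : 9 <= n ^+ 2 * rho ^+ 2 by rewrite -exprMn; nra.
move: ((p - p') ^+ 2) ((q - q') ^+ 2) (rho ^+ 2) nr2 => P Q r nr2 h1 h2.
by rewrite -(ler_pM2l n2); lra.
Qed.

Lemma cutoffs_exist (w : calg A) L : g * w <> w * g -> exists lam n kap,
  cutoffs g L lam n kap.
Proof.
move=> gw; pose c := rnorm (g * w - w * g).
have c0 : 0 < c.
  by rewrite lt_neqAle rnorm_ge0 andbT eq_sym rnorm_eq0 subr_eq0; apply/eqP.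
pose W := rnorm w + 1; have W0 : 0 < W by have := rnorm_ge0 w; rewrite /W; lra.
(* If n L were 1, g would be within 2 rho L of lam, making the commutator with w at most 4 rho L
   |w|, less than 8 rho L W = c. The ratio 32 of successive scales yields 2 rho i / rho i.+1 = 1/16
   for [cut_near]. *)
pose rho i : R := c / (8 * W) / 32 ^+ L * 32 ^+ i.
have rho0 i : 0 < rho i by rewrite !mulr_gt0 ?invr_gt0 ?exprn_gt0 ?mulr_gt0.
have rhoS i : rho i.+1 = 32 * rho i by rewrite /rho exprS mulrCA.
have rho_lt i j : (i < j)%N -> 2 * rho i ^+ 2 <= rho j ^+ 2.
  move=> ij; have : 32 * rho i <= rho j.
    rewrite -rhoS /rho ler_wpM2l ?ler_weXn2l ?ler1n //.
    by rewrite ltW // !mulr_gt0 ?invr_gt0 ?exprn_gt0 ?mulr_gt0.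
  have := rho0 i; nra.
have rhoL : rho L * (8 * W) = c.
  by rewrite /rho divfK ?divfK // gt_eqF ?exprn_gt0 ?mulr_gt0.
have [lam [h [x [cl hx x0 hd]]]] := spectral_point (rho0 0%N).
pose d := sqdist lam; have d0 z : 0 <= d z by rewrite /d /sqdist exprn_ge0 ?cabs_ge0.
pose b i z := clamp (2 - (rho i ^- 2) * d z).
have r2 i : 0 < rho i ^+ 2 by rewrite exprn_gt0.
have b1 i z : d z <= rho i ^+ 2 -> b i z = 1.
  move=> dz; rewrite /b clamp1 //; have : rho i ^- 2 * d z <= 1 by rewrite mulrC ler_pdivrMr // mul1r.
  lra.
have b0 i z : 2 * rho i ^+ 2 <= d z -> b i z = 0.
  move=> dz; rewrite /b clamp0 //; have : 2 <= rho i ^- 2 * d z by rewrite mulrC ler_pdivlMr.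
  lra.
have ab i : adm g (b i).
  apply: adm_clamp => //; apply: admB => //; first exact: adm_const.
  by apply: admZ => //; exact: adm_sqdist.
have /boolp.choice[n hn] : forall i, exists y, fc g (fun z => (b i z)%:C) y by [].
(* The maximum of d and rho i.+1 ^+ 2: invertible even at lam, and equal to d wherever 1 - b i.+1 is
   nonzero. *)
pose m i z := 2^-1 * (d z + rho i.+1 ^+ 2 + `|d z - rho i.+1 ^+ 2|).
have am i : adm g (m i).
  apply: admZ => //; apply: admD; first by apply: admD; [exact: adm_sqdist|exact: adm_const].
  by apply: adm_abs => //; apply: admB => //; [exact: adm_sqdist|exact: adm_const].
have md i z : d z <= m i z.
  by rewrite /m; have := ler_norm (d z - rho i.+1 ^+ 2); lra.
have mr i z : rho i.+1 ^+ 2 <= m i z.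
  by rewrite /m; have := ler_norm (- (d z - rho i.+1 ^+ 2)); rewrite normrN; lra.
have mE i z : rho i.+1 ^+ 2 <= d z -> m i z = d z.
  by move=> h1; rewrite /m ger0_norm ?subr_ge0 //; lra.
have ai i : adm g (fun z => (m i z)^-1).
  have [M M0 hM] := adm_bounded (am i).
  apply: (adm_inv g_unit (r2 i.+1) (am i) (s := M)) => z cz.
  by rewrite mr /=; apply: le_trans (hM z cz); exact: ler_norm.
(* On the circle, lam times the conjugate of z, minus 1, has squared modulus d; its inverse is
   therefore its conjugate over d, and d is replaced by m. *)
pose k i z := (lam^* * z - 1) * (m i z)^-1%:C.
have /boolp.choice[kap hk] : forall i, exists y, fc g (k i) y.
  move=> i; have [y hy] := ai i; eexists; apply: fcM hy => //.
  apply: fcB => //; last exact: fc_const.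
  by apply: fcZ => //; exact: fc_id.
have near i z : circ z -> cabs ((z - lam) * (b i z)%:C) <= 2 * rho i.
  move=> cz; rewrite cabsM cabsR.
  have /andP[bz0 bz1] : 0 <= b i z <= 1 by exact: clamp01.
  rewrite ger0_norm //; have [dz|dz] := leP (2 * rho i ^+ 2) (d z).
    by rewrite b0 // mulr0 mulr_ge0 // ltW.
  have : cabs (z - lam) <= 2 * rho i.
    have := cabs_ge0 (z - lam); have := rho0 i; rewrite /d /sqdist in dz; nra.
  have := cabs_ge0 (z - lam); nra.
have kn i z : circ z -> cabs (k i z) <= (rho i.+1)^-1.
  move=> cz; rewrite /k cabsM cabsR.
  have mp : 0 < m i z by apply: lt_le_trans (mr i z).
  rewrite gtr0_norm ?invr_gt0 // ler_pdivrMr //.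
  have -> : cabs (lam^* * z - 1) = cabs (z - lam).
    have -> : z - lam = lam * (lam^* * z - 1) by rewrite mulrBr mulrA cl mul1r mulr1.
    by rewrite cabsM (cabs_circ cl) mul1r.
  rewrite mulrC ler_pdivlMr //.
  have := md i z; have := mr i z; rewrite /d /sqdist.
  have := cabs_ge0 (z - lam); have := rho0 i.+1; nra.
(* b 0 is 1 wherever h is nonzero, so n 0 * x = x, while x <> 0. *)
have neq0 : n 0%N <> 0.
  move=> n0; apply: x0; rewrite -[RHS](mul0r x) -n0.
  apply: (fc_eq g_unit hx (fcM g_unit (hn 0%N) hx)) => z cz.
  have [->|hz] := eqVneq (h z) 0; first by rewrite rmorph0 mulr0.
  by rewrite b1 ?mul1r // hd.
have nearn i : rnorm ((g - lam%:A) * n i) <= 2 * rho i.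
  by apply: (fc_le g_unit (fcM g_unit (fc_subc lam) (hn i))) => z; exact: near.
exists lam, n, kap; split=> //.
- move=> i; apply: (fc_eq g_unit (fc_star (hn i)) (hn i)) => z cz.
  exact: conjc_real.
- by move=> i; exact: fc_comm (hn i).
- move=> i j ij; apply: (fc_eq g_unit (fcM g_unit (hn j) (hn i)) (hn i)) => z cz.
  have [dz|dz] := leP (2 * rho i ^+ 2) (d z); first by rewrite (b0 i) // rmorph0 mulr0.
  by rewrite (b1 j) ?mul1r //; apply: le_trans (ltW dz) (rho_lt i j ij).
- move=> i; apply: (fc_le g_unit (hn i)) => z cz; rewrite cabsR.
  have /andP[h1 h2] : 0 <= b i z <= 1 := clamp01 _.
  by rewrite ger0_norm.
- move=> i; apply: (@le_trans _ _ (2 * rho i * (rho i.+1)^-1)).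
    apply: ler_pM; rewrite ?rnorm_ge0 //.
    by apply: (fc_le g_unit (hk i)) => z; exact: kn.
  rewrite rhoS; move: (rho i) (rho0 i) => r r0.
  by have -> : 2 * r * (32 * r)^-1 = 16^-1 by field; rewrite gt_eqF.
- by move=> i; exact: fc_comm (hk i).
- move=> i j; apply: (fc_eq g_unit (fcM g_unit (hk i) (hn j)) (fcM g_unit (hn j) (hk i))) => z _.
  by rewrite mulrC.
- move=> i; have f1 : fc g (fun=> 1) 1 by have := fc_const g 1; rewrite scale1r.
  have fb := fcB g_unit f1 (hn i.+1).
  have fl := fcB g_unit (fcZ g_unit lam fc_conj) f1.
  apply: (fc_eq g_unit (fcM g_unit (fcM g_unit (hk i) fl) fb) fb) => z cz.
  have [dz|dz] := leP (d z) (rho i.+1 ^+ 2); first by rewrite b1 // subrr mulr0.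
  rewrite -[RHS]mul1r; congr (_ * _); rewrite /k mE ?ltW //.
  have dp : 0 < d z by apply: lt_trans dz.
  have -> : (lam^* * z - 1) * (d z)^-1%:C * (lam * z^* - 1) =
     (d z)^-1%:C * ((lam^* * z - 1) * (lam * z^* - 1)) by ring.
  have -> : (lam^* * z - 1) * (lam * z^* - 1) = (d z)%:C.
    rewrite sqdistE rmorphB.
    have -> : (lam^* * z - 1) * (lam * z^* - 1) =
       (lam * lam^*) * (z * z^*) - lam^* * z - lam * z^* + 1 by ring.
    have -> : (z - lam) * (z^* - lam^*) = z * z^* - lam^* * z - lam * z^* + lam * lam^* by ring.
    by rewrite cz cl mulr1.
  by rewrite -rmorphM mulVf ?rmorph1 // gt_eqF.
- move=> n1; have := nearn L; rewrite n1 mulr1 => gl.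
  have : c <= 2 * (2 * rho L) * rnorm w.
    rewrite /c; have -> : g * w - w * g = adj (g - lam%:A) w.
      by rewrite /adj mulrBl mulrBr mulr_algl mulr_algr opprB addrA subrK.
    apply: le_trans (rnorm_adj _ _) _; have := rnorm_ge0 w; have := rnorm_ge0 (g - lam%:A); nra.
  have := rho0 L; move: rhoL; rewrite /W; have := rnorm_ge0 w; nra.
Qed.
End Cutoffs.

(** * Small off-diagonal exponentials are products of two conjugates *)

Section ExpEstimates.
Variables (R : realType) (A : cstarAlgType R).
Implicit Types (x y z J : calg A).

Lemma cexp_intertwine J x y : J * x = y * J -> J * cexp x = cexp y * J.
Proof.
move=> Jx; apply: (rcvg_unique (rcvgMl J (cexp_cvg x))).
apply: (rcvg_ext _ (rcvgMr J (cexp_cvg y))) => n.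
rewrite mulr_suml mulr_sumr; apply: eq_bigr => i _.
rewrite -scalerAl -scalerAr; congr (_ *: _).
elim: i => [|i IH]; first by rewrite !expr0 mul1r mulr1.
by rewrite !exprS mulrA Jx -mulrA IH mulrA.
Qed.

Lemma mul_lip x y x' y' :
  rnorm (x * y - x' * y') <= rnorm x * rnorm (y - y') + rnorm (x - x') * rnorm y'.
Proof.
have -> : x * y - x' * y' = x * (y - y') + (x - x') * y' by nc_ring.
by apply: le_trans (rnormD _ _) _; apply: lerD; exact: rnormM.
Qed.

Lemma mul_lip_le x y x' y' (k a b m : R) : rnorm x <= k -> rnorm (x - x') <= a ->
  rnorm (y - y') <= b -> rnorm y' <= m -> rnorm (x * y - x' * y') <= k * b + a * m.
Proof.
move=> xk xa yb ym; apply: le_trans (mul_lip _ _ _ _) _.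
by apply: lerD; apply: ler_pM; rewrite ?rnorm_ge0.
Qed.

(** Without the linear term the exponential has a Lipschitz constant of order r; this is what makes
    the nonlinear part of the later fixed-point equation contract. *)
Lemma exp_lip x y (r : R) : rnorm x <= r -> rnorm y <= r -> r <= 2^-1 ->
  rnorm ((cexp x - x) - (cexp y - y)) <= 2 * r * rnorm (x - y).
Proof.
move=> xr yr r2; have r0 := le_trans (rnorm_ge0 _) xr.
have pwr n : rnorm (x ^+ n.+1 - y ^+ n.+1) <= n.+1%:R * r ^+ n * rnorm (x - y).
  elim: n => [|n IH]; first by rewrite !expr1 expr0 mulr1 mul1r.
  rewrite (exprS x) (exprS y); apply: le_trans (mul_lip _ _ _ _) _.
  have h1 : rnorm x * rnorm (x ^+ n.+1 - y ^+ n.+1) <= r * (n.+1%:R * r ^+ n * rnorm (x - y)).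
    by apply: ler_pM; rewrite ?rnorm_ge0.
  have h2 : rnorm (y ^+ n.+1) <= r ^+ n.+1.
    by apply: le_trans (rnormX _ _) _; rewrite lerXn2r ?nnegrE ?rnorm_ge0.
  have h3 : rnorm (x - y) * rnorm (y ^+ n.+1) <= rnorm (x - y) * r ^+ n.+1.
    by rewrite ler_wpM2l ?rnorm_ge0.
  apply: le_trans (lerD h1 h3) _; rewrite exprS; have -> : n.+2%:R = n.+1%:R + 1 :> R by rewrite -natr1.
  by move: (n.+1%:R : R) (r ^+ n) (rnorm _) => a b c; rewrite le_eqVlt; apply/orP; left; apply/eqP; ring.
have cx := rcvgD (cexp_cvg x) (rcvgN (@rcvg_cst _ _ x)).
have cy := rcvgD (cexp_cvg y) (rcvgN (@rcvg_cst _ _ y)).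
have := rcvgD cx (rcvgN cy) => /= cxy.
suff h n : (2 <= n)%N -> rnorm (\sum_(0 <= i < n) i`!%:R^-1%:C *: x ^+ i - x -
    (\sum_(0 <= i < n) i`!%:R^-1%:C *: y ^+ i - y)) <= 2 * r * rnorm (x - y).
  have c2 : rcvg (fun n => \sum_(0 <= i < n.+2) i`!%:R^-1%:C *: x ^+ i - x -
    (\sum_(0 <= i < n.+2) i`!%:R^-1%:C *: y ^+ i - y)) (cexp x - x - (cexp y - y)).
    move=> e e0; have [N hN] := cxy e e0; exists N => n Nn.
    by apply: (hN n.+2); rewrite (leq_trans Nn) // leqW.
  by apply: (rcvg_le c2) => n; exact: h.
case: n => [//|[//|n]] _.
rewrite !big_nat_recl //= !expr0 !expr1 !invr1 !rmorph1 !scale1r.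
have -> : forall a b : calg A, 1 + (x + a) - x - (1 + (y + b) - y) = a - b by move=> a b; nc_ring.
rewrite -sumrB; apply: le_trans (rnorm_sum _ _ _) _.
apply: (@le_trans _ _ (\sum_(0 <= i < n) r * r ^+ i * rnorm (x - y))).
  apply: ler_sum => i _; rewrite -scalerBr rnormZ ger0_norm ?invr_ge0 //.
  have f0 : 0 < (i.+1)`!%:R :> R by rewrite ltr0n fact_gt0.
  apply: le_trans (ler_wpM2l _ (pwr i.+1)) _; first by rewrite invr_ge0.
  have F1 : (i.+2)`!%:R^-1 * i.+2%:R <= 1 :> R.
    rewrite factS natrM invfM mulrAC mulVf ?pnatr_eq0 // mul1r invf_le1 //.
    by rewrite ler1n fact_gt0.
  rewrite !mulrA ler_wpM2r ?rnorm_ge0 // -exprS -[leRHS]mul1r.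
  by rewrite ler_wpM2r // exprn_ge0.
rewrite -mulr_suml ler_wpM2r ?rnorm_ge0 // -mulr_sumr big_mkord mulrC ler_wpM2r //.
exact: sum_geom_le.
Qed.

Lemma exp_near x (r : R) : rnorm x <= r -> r <= 2^-1 -> rnorm (cexp x - 1 - x) <= 2 * r * rnorm x.
Proof.
move=> xr r2; have r0 := le_trans (rnorm_ge0 _) xr.
have := @exp_lip x 0 r xr; rewrite rnorm0 cexp0 !subr0 => /(_ r0 r2).
by rewrite (_ : cexp x - x - 1 = cexp x - 1 - x) //; nc_ring.
Qed.

(** When the squares agree, 2 (x - y) = - ((x - 1) (x - y) + (x - y) (y - 1)), whose norm is at most
    |x - y| / 2. *)
Lemma sqr_near1_inj x y : x * x = y * y -> rnorm (x - 1) <= 4^-1 -> rnorm (y - 1) <= 4^-1 -> x = y.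
Proof.
move=> xy x1 y1; apply/eqP; rewrite -subr_eq0 -rnorm_eq0.
have e : (x - y) + (x - y) = - ((x - 1) * (x - y) + (x - y) * (y - 1)).
  apply/eqP; rewrite -subr_eq0; have -> : (x - y) + (x - y) - - ((x - 1) * (x - y) + (x - y) * (y - 1)) =
    x * x - y * y by nc_ring.
  by rewrite xy subrr.
have d0 := rnorm_ge0 (x - y).
have : rnorm (- ((x - 1) * (x - y) + (x - y) * (y - 1))) <= 2^-1 * rnorm (x - y).
  rewrite rnormN; apply: le_trans (rnormD _ _) _.
  have := rnormM (x - 1) (x - y); have := rnormM (x - y) (y - 1); nra.
rewrite -e -mulr2n -scaler_nat -(rmorph_nat (real_complex R)) rnormZ ger0_norm //.
by rewrite eq_le d0 andbT; lra.
Qed.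
End ExpEstimates.

Section OffDiagonal.
Variables (R : realType) (A : cstarAlgType R) (P Q : calg A).
Hypotheses (sP : star P = P) (sQ : star Q = Q) (PQ : P * Q = 0).
Implicit Types (x y z : calg A).

(* The skew-adjoint elements whose only blocks are [P x Q] and [Q x P]. *)
Definition offdiag : set (calg A) :=
  [set x | [/\ star x = - x, (P + Q) * x = x & (P - Q) * x = - (x * (P - Q))]].

Let QP : Q * P = 0.
Proof. by rewrite -[Q]sQ -[X in _ * X]sP -starM PQ star0. Qed.

Lemma offdiag_r x : offdiag x -> x * (P + Q) = x.
Proof.
move=> [sx s _]; rewrite -[RHS]opprK -sx -{2}s starM starD sP sQ sx mulNr opprK //.
Qed.
Lemma offdiag_PQ x : offdiag x -> P * x = x * Q.
Proof.
move=> xo; have r := offdiag_r xo; have [sx s j] := xo.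
have h : (P * x) *+ 2 = (x * Q) *+ 2.
  have e1 : P * x + Q * x = x by rewrite -mulrDl.
  have e2 : x * P + x * Q = x by rewrite -mulrDr.
  have e3 : P * x - Q * x = x * Q - x * P by rewrite -mulrBl j mulrBr opprB.
  have e : (P * x + Q * x) + (P * x - Q * x) = (x * P + x * Q) + (x * Q - x * P).
    by rewrite e1 e2 e3.
  have l (a b : calg A) : (a + b) + (a - b) = a + a by nc_ring.
  have l' (c d : calg A) : (c + d) + (d - c) = d + d by nc_ring.
  by rewrite l l' in e; rewrite !mulr2n.
exact: (@mulrn_inj R[i] (calg A) _ _ 1 h).
Qed.

Lemma offdiag_corner z : P * z = z -> z * Q = z -> offdiag (z - star z).
Proof.
move=> Pz zQ; have zP : z * P = 0 by rewrite -zQ -mulrA QP mulr0.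
have Qz : Q * z = 0 by rewrite -Pz mulrA QP mul0r.
have szP : star z * P = star z by rewrite -[in RHS]Pz starM sP.
have Qsz : Q * star z = star z by rewrite -[in RHS]zQ starM sQ.
have Psz : P * star z = 0 by rewrite -[P]sP -starM zP star0.
have szQ : star z * Q = 0 by rewrite -[Q]sQ -starM Qz star0.
split; first by rewrite starB starK opprB.
  rewrite mulrDl !mulrBr Pz Psz Qz Qsz; nc_ring.
rewrite mulrBl !mulrBr !mulrBl Pz Psz Qz Qsz zP szP zQ szQ; nc_ring.
Qed.

(** P and Q are not assumed idempotent, but they act on the corners of x as projections would. *)
Lemma offdiag_split x : offdiag x ->
  [/\ P * (P * x) = P * x, (P * x) * Q = P * x & x = P * x - star (P * x)].
Proof.
move=> xo; have h := offdiag_PQ xo; have [sx s j] := xo.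
have r := offdiag_r xo.
split.
- by rewrite -{2}s mulrDl mulrDr [P * (Q * x)]mulrA PQ mul0r addr0.
- by rewrite h -{2}r mulrDr mulrDl -[x * P * Q]mulrA PQ mulr0 add0r.
- by rewrite starM sP sx mulNr opprK h -mulrDr addrC.
Qed.

Lemma offdiag0 : offdiag 0.
Proof. by split; rewrite ?mulr0 ?mul0r ?star0 ?oppr0. Qed.
Lemma offdiagD x y : offdiag x -> offdiag y -> offdiag (x + y).
Proof.
move=> [a b c] [a' b' c']; split; first by rewrite starD a a' opprD.
  by rewrite mulrDr b b'.
by rewrite mulrDr c c' -opprD -mulrDl.
Qed.
Lemma offdiagZ (k : R) x : offdiag x -> offdiag (k%:C *: x).
Proof.
move=> [a b c]; split; first by rewrite starZr a scalerN.
  by rewrite -scalerAr b.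
by rewrite -scalerAr c -scalerAl scalerN.
Qed.
Lemma offdiagN x : offdiag x -> offdiag (- x).
Proof. by move=> /(offdiagZ (-1)); rewrite rmorphN rmorph1 scaleN1r. Qed.
Lemma offdiag_closed : closed offdiag.
Proof.
apply: closedP_rcvg => u l hu ul; split.
- apply: (rcvg_unique (rcvg_star ul)); apply: (rcvg_ext _ (rcvgN ul)) => n.
  by have [-> _ _] := hu n.
- apply: (rcvg_unique (rcvgMl _ ul)); apply: (rcvg_ext _ ul) => n.
  by have [_ -> _] := hu n.
- apply: (rcvg_unique (rcvgMl _ ul)); apply: (rcvg_ext _ (rcvgN (rcvgMr _ ul))) => n.
  by have [_ _ ->] := hu n.
Qed.
End OffDiagonal.

Section SmallExp.
Variables (R : realType) (A : cstarAlgType R) (g P Q kap : calg A) (lam : R[i]).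
Hypotheses (g_unit : unitary g) (sP : star P = P) (sQ : star Q = Q) (PQ : P * Q = 0).
Hypotheses (Pg : P * g = g * P) (Qg : Q * g = g * Q) (P1 : rnorm P <= 1).
Hypotheses (kQ : kap * Q = Q * kap) (kapE : kap * (lam *: star g - 1) * Q = Q).
Hypothesis near : rnorm ((g - lam%:A) * P) * rnorm kap <= 16^-1.
Implicit Types (x y z a b c : calg A).
Local Notation OD := (offdiag P Q).
Local Notation s := (P + Q).
Local Notation J := (P - Q).

Let gs : star g * g = 1. Proof. by case: g_unit. Qed.
Let sg : g * star g = 1. Proof. by case: g_unit. Qed.
Let ng : rnorm g = 1. Proof. exact: rnorm_unitary. Qed.

Lemma comm_starg x : star x = x -> x * g = g * x -> x * star g = star g * x.
Proof. by move=> sx /(congr1 (@star R A)); rewrite !starM sx => ->. Qed.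

Definition half x : calg A := (2^-1 : R)%:C *: x.
Lemma half_add x : half x + half x = x.
Proof. by rewrite /half -scalerDl -rmorphD /= [X in X%:C](_ : _ = 1) ?rmorph1 ?scale1r //; lra. Qed.
Lemma rnorm_half x : rnorm (half x) = rnorm x / 2.
Proof. by rewrite /half rnormZ ger0_norm ?invr_ge0 // mulrC. Qed.
Lemma halfD x y : half (x + y) = half x + half y. Proof. exact: scalerDr. Qed.
Lemma halfN x : half (- x) = - half x. Proof. exact: scalerN. Qed.
Lemma half_inj x y : x + x = y + y -> x = y.
Proof. by move=> h; rewrite -(half_add x) -(half_add y) -!halfD h. Qed.

Definition conjg x : calg A := g * x * star g.
Lemma conjgB x y : conjg (x - y) = conjg x - conjg y.
Proof. by rewrite /conjg mulrBr mulrBl. Qed.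
Lemma conjgN x : conjg (- x) = - conjg x.
Proof. by rewrite /conjg mulrN mulNr. Qed.
Lemma rnorm_conjg x : rnorm (conjg x) <= rnorm x.
Proof.
rewrite /conjg; apply: le_trans (rnormM _ _) _; rewrite rnorm_star ng mulr1.
by apply: le_trans (rnormM _ _) _; rewrite ng mul1r.
Qed.
Lemma conjg_cexp x : g * cexp x * star g = cexp (conjg x).
Proof. exact: cexp_conj. Qed.

(* A product of two conjugates of [g] and [g^-1], symmetrised so that its inverse is
   [Fexp (- a)]; this makes the odd part [fodd a] off-diagonal. *)
Definition Fexp a : calg A := cexp (- half a) * cexp (conjg a) * cexp (- half a).
Definition fodd a : calg A := half (Fexp a - Fexp (- a)).
Definition lin a : calg A := conjg a - a.

Lemma FexpN a : Fexp a * Fexp (- a) = 1.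
Proof.
rewrite /Fexp conjgN halfN opprK !mulrA -[_ * cexp (- half a) * cexp (half a)]mulrA.
by rewrite cexpNl mulr1 -[_ * cexp (conjg a) * _]mulrA cexpN mulr1 cexpNl.
Qed.
Lemma FexpNl a : Fexp (- a) * Fexp a = 1.
Proof. by have := FexpN (- a); rewrite opprK. Qed.

Section LipschitzRemainder.
Variable r : R.
Hypothesis r4 : r <= 4^-1.
Definition rem a : calg A := Fexp a - 1 - lin a.

(** Writing the factors of [Fexp] as 1 + u, 1 + v, 1 + u, the linear remainders contribute 1 + 2 and
    the products 4 + 4 + 2 + 2 to the constant, 15 in all. *)
Lemma rem_lip a b : rnorm a <= r -> rnorm b <= r -> rnorm (rem a - rem b) <= 16 * r * rnorm (a - b).
Proof.
move=> ar br; have r0 := le_trans (rnorm_ge0 _) ar.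
have r4' : r <= 4^-1 := r4.
have r6 : 6 * r <= 2 by lra.
set d := rnorm (a - b); have d0 : 0 <= d by exact: rnorm_ge0.
pose u x := cexp (- half x) - 1; pose v x := cexp (conjg x) - 1.
have remE x : rem x = ((u x + half x) + (u x + half x)) + (v x - conjg x) +
    (u x * v x + v x * u x + u x * u x + u x * v x * u x).
  rewrite /rem /Fexp /lin; have -> : cexp (- half x) = 1 + u x by rewrite /u addrC subrK.
  have -> : cexp (conjg x) = 1 + v x by rewrite /v addrC subrK.
  rewrite -[X in conjg x - X](half_add x); nc_ring.
have hr : r / 2 <= 2^-1 by lra.
have U1 : rnorm ((u a + half a) - (u b + half b)) <= r * d / 2.
  have ha : rnorm (- half a) <= r / 2 by rewrite rnormN rnorm_half; lra.
  have hb : rnorm (- half b) <= r / 2 by rewrite rnormN rnorm_half; lra.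
  have := exp_lip ha hb hr; rewrite !opprK.
  have -> : - half a + half b = - half (a - b) by rewrite halfD halfN opprB addrC.
  rewrite rnormN rnorm_half -/d.
  have -> : cexp (- half a) + half a - (cexp (- half b) + half b) =
    u a + half a - (u b + half b) by rewrite /u; nc_ring.
  by lra.
have cr x : rnorm x <= r -> rnorm (conjg x) <= r by apply: le_trans; exact: rnorm_conjg.
have V1 : rnorm ((v a - conjg a) - (v b - conjg b)) <= 2 * r * d.
  have := exp_lip (cr _ ar) (cr _ br) ltac:(lra).
  have -> : cexp (conjg a) - conjg a - (cexp (conjg b) - conjg b) =
    v a - conjg a - (v b - conjg b) by rewrite /v; nc_ring.
  move=> h; apply: le_trans h _; rewrite -conjgB ler_wpM2l ?mulr_ge0 //; exact: rnorm_conjg.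
have U2 : rnorm (u a - u b) <= d.
  have -> : u a - u b = (u a + half a - (u b + half b)) - half (a - b).
    by rewrite halfD halfN; nc_ring.
  apply: le_trans (rnormB _ _) _; rewrite rnorm_half -/d; nra.
have V2 : rnorm (v a - v b) <= 2 * d.
  have -> : v a - v b = (v a - conjg a - (v b - conjg b)) + conjg (a - b).
    by rewrite conjgB; nc_ring.
  apply: le_trans (rnormD _ _) _; have := rnorm_conjg (a - b); rewrite -/d; nra.
have Un x : rnorm x <= r -> rnorm (u x) <= r.
  move=> xr; have hx : rnorm (- half x) <= r / 2 by rewrite rnormN rnorm_half; lra.
  have := exp_near hx hr; rewrite opprK rnormN rnorm_half => h.
  have -> : u x = (cexp (- half x) - 1 + half x) - half x by rewrite /u; nc_ring.
  by apply: le_trans (rnormB _ _) _; rewrite rnorm_half; have := rnorm_ge0 x; nra.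
have Vn x : rnorm x <= r -> rnorm (v x) <= 2 * r.
  move=> xr; have := exp_near (cr _ xr) ltac:(lra) => h.
  have -> : v x = (cexp (conjg x) - 1 - conjg x) + conjg x by rewrite /v; nc_ring.
  by apply: le_trans (rnormD _ _) _; have := cr _ xr; have := rnorm_ge0 (conjg x); nra.
have ua := Un _ ar; have ub := Un _ br; have va := Vn _ ar; have vb := Vn _ br.
have rd0 : 0 <= r * d by rewrite mulr_ge0.
have UV : rnorm (u a * v a - u b * v b) <= 4 * r * d.
  by apply: le_trans (mul_lip_le ua U2 V2 vb) _; rewrite (_ : _ + _ = 4 * r * d) //; ring.
have VU : rnorm (v a * u a - v b * u b) <= 4 * r * d.
  by apply: le_trans (mul_lip_le va V2 U2 ub) _; rewrite (_ : _ + _ = 4 * r * d) //; ring.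
have UU : rnorm (u a * u a - u b * u b) <= 2 * r * d.
  by apply: le_trans (mul_lip_le ua U2 U2 ub) _; rewrite (_ : _ + _ = 2 * r * d) //; ring.
have UVU : rnorm (u a * v a * u a - u b * v b * u b) <= 2 * r * d.
  have uv : rnorm (u a * v a) <= r * (2 * r).
    by apply: le_trans (rnormM _ _) _; apply: ler_pM; rewrite ?rnorm_ge0.
  apply: le_trans (mul_lip_le uv UV U2 ub) _.
  have -> : r * (2 * r) * d + 4 * r * d * r = (6 * r) * (r * d) by ring.
  have -> : 2 * r * d = 2 * (r * d) by ring.
  by rewrite ler_wpM2r.
rewrite !remE.
set X := u a + half a in U1 *; set Y := u b + half b in U1 *.
set X2 := v a - conjg a in V1 *; set Y2 := v b - conjg b in V1 *.
move: U1 V1 UV VU UU UVU; clearbody X Y X2 Y2; move: (u a * v a * u a) (u b * v b * u b) => q q'.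
move: (u a * v a) (u b * v b) (v a * u a) (v b * u b) (u a * u a) (u b * u b) => m m' k k' l l'.
move=> U1 V1 h1 h2 h3 h4.
have -> : X + X + X2 + (m + k + l + q) - (Y + Y + Y2 + (m' + k' + l' + q')) =
  (X - Y) + (X - Y) + (X2 - Y2) + (m - m') + (k - k') + (l - l') + (q - q') by nc_ring.
apply: le_trans (rnormD _ _) _; apply: le_trans (lerD (rnormD _ _) (lexx _)) _.
apply: le_trans (lerD (lerD (rnormD _ _) (lexx _)) (lexx _)) _.
apply: le_trans (lerD (lerD (lerD (rnormD _ _) (lexx _)) (lexx _)) (lexx _)) _.
have h5 := rnormD (X - Y + (X - Y)) (X2 - Y2); have h6 := rnormD (X - Y) (X - Y).
lra.
Qed.
End LipschitzRemainder.

Let QP : Q * P = 0.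
Proof. by rewrite -[Q]sQ -[X in _ * X]sP -starM PQ star0. Qed.
Let Psg : P * star g = star g * P. Proof. exact: comm_starg. Qed.
Let Qsg : Q * star g = star g * Q. Proof. exact: comm_starg. Qed.

Lemma offdiag_conjg a : OD a -> OD (conjg a).
Proof.
have cx (x : calg A) : x * g = g * x -> x * star g = star g * x -> forall y, x * conjg y = conjg (x * y) /\ conjg y * x = conjg (y * x).
  by move=> xg xsg y; rewrite /conjg; split; [rewrite !mulrA xg|rewrite -mulrA -xsg !mulrA].
have sg1 : s * g = g * s by rewrite mulrDl mulrDr Pg Qg.
have sg2 : s * star g = star g * s by rewrite mulrDl mulrDr Psg Qsg.
have Jg1 : J * g = g * J by rewrite mulrBl mulrBr Pg Qg.
have Jg2 : J * star g = star g * J by rewrite mulrBl mulrBr Psg Qsg.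
move=> [e1 e2 e3]; split.
- by rewrite /conjg !starM starK e1 mulNr mulrN mulrA.
- by have [-> _] := cx _ sg1 sg2 a; rewrite e2.
- by have [-> _] := cx _ Jg1 Jg2 a; have [_ ->] := cx _ Jg1 Jg2 a; rewrite e3 conjgN.
Qed.
Lemma offdiag_half a : OD a -> OD (half a).
Proof. exact: offdiagZ. Qed.

Lemma absorb_cexp a : OD a -> s * (cexp a - 1) = cexp a - 1.
Proof.
move=> [_ sa _]; have := @cexp_intertwine R A (1 - s) a 0.
rewrite mulrBl mul1r sa subrr mul0r cexp0 mul1r => /(_ erefl).
rewrite mulrBl mul1r => h; apply/eqP; rewrite eq_sym -subr_eq0 mulrBr mulr1.
have -> : cexp a - 1 - (s * cexp a - s) = (cexp a - s * cexp a) - (1 - s) by nc_ring.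
by rewrite h subrr.
Qed.
Lemma J_cexp a : OD a -> J * cexp a = cexp (- a) * J.
Proof. by move=> [_ _ ja]; apply: cexp_intertwine; rewrite ja mulNr. Qed.

(** P + Q is no unit, so it can absorb x - 1 and y - 1 but not x and y. Since P - Q exchanges x and
    y, their difference anticommutes with it. *)
Lemma offdiag_half_diff (x y : calg A) : star x = y -> s * (x - 1) = x - 1 ->
  s * (y - 1) = y - 1 -> J * x = y * J -> J * y = x * J -> OD (half (x - y)).
Proof.
move=> xy sx sy Jx Jy; apply: offdiag_half; split.
- by rewrite starB xy -xy starK opprB.
- have -> : x - y = (x - 1) - (y - 1) by nc_ring.
  by rewrite mulrBr sx sy.
- by rewrite mulrBr Jx Jy -opprB mulrBl.
Qed.

Lemma star_cexp_off a : OD a -> star (cexp a) = cexp (- a).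
Proof. by move=> [sa _ _]; rewrite cexp_star sa. Qed.

Lemma offdiag_sinh c : OD c -> OD (half (cexp c - cexp (- c))).
Proof.
move=> oc; have onc := offdiagN oc; apply: offdiag_half_diff.
- exact: star_cexp_off.
- exact: absorb_cexp.
- exact: absorb_cexp.
- exact: J_cexp.
- by rewrite (J_cexp onc) opprK.
Qed.

Lemma absorb_mul x y : s * (x - 1) = x - 1 -> s * (y - 1) = y - 1 -> s * (x * y - 1) = x * y - 1.
Proof.
move=> sx sy; have -> : x * y - 1 = (x - 1) * y + (y - 1) by nc_ring.
by rewrite mulrDr sy mulrA sx.
Qed.

Lemma offdiag_fodd a : OD a -> OD (fodd a).
Proof.
move=> oa; have ob := offdiag_conjg oa; have oh := offdiag_half oa.
have onb := offdiagN ob; have onh := offdiagN oh.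
have JF x : OD x -> J * Fexp x = Fexp (- x) * J.
  move=> ox; rewrite /Fexp halfN opprK conjgN.
  have hx := offdiag_half ox; have cx := offdiag_conjg ox.
  rewrite !mulrA (J_cexp (offdiagN hx)) opprK -!mulrA; congr (_ * _).
  by rewrite mulrA (J_cexp cx) -mulrA (J_cexp (offdiagN hx)) opprK.
apply: offdiag_half_diff.
- rewrite /Fexp !starM !star_cexp_off //; rewrite conjgN halfN !opprK mulrA //.
- by rewrite /Fexp; apply: absorb_mul; [apply: absorb_mul|]; apply: absorb_cexp.
- rewrite /Fexp conjgN halfN opprK.
  by apply: absorb_mul; [apply: absorb_mul|]; apply: absorb_cexp.
- exact: JF.
- by rewrite (JF _ (offdiagN oa)) opprK.
Qed.

(* An approximate right inverse of [lin] on off-diagonal elements. *)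
Definition rinv x : calg A := P * x * kap - star (P * x * kap).

Lemma rinvB x y : rinv (x - y) = rinv x - rinv y.
Proof. rewrite /rinv mulrBr mulrBl; move: (P * x * kap) (P * y * kap) => p q; rewrite starB; nc_ring. Qed.
Lemma rnorm_rinv x : rnorm (rinv x) <= 2 * rnorm kap * rnorm x.
Proof.
have h : rnorm (P * x * kap) <= rnorm kap * rnorm x.
  apply: le_trans (rnormM _ _) _; rewrite mulrC ler_wpM2l ?rnorm_ge0 //.
  apply: le_trans (rnormM _ _) _; rewrite -[leRHS]mul1r.
  by rewrite ler_wpM2r ?rnorm_ge0.
by apply: le_trans (rnormB _ _) _; rewrite rnorm_star; lra.
Qed.
Lemma offdiag_rinv x : OD x -> OD (rinv x).
Proof.
move=> ox; have [h1 h2 _] := offdiag_split sP sQ PQ ox.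
apply: offdiag_corner => //; first by rewrite !mulrA -[P * P * x]mulrA h1.
by rewrite -mulrA kQ mulrA h2.
Qed.

(** On the corner w = P x kap, conjugation by g is nearly w |-> lam w (star g), since g is nearly
    lam on the range of P, and [kap] was made to satisfy w (lam star g - 1) = P x. The error is
    controlled by the hypothesis [near]. *)
Lemma lin_rinv x : OD x -> rnorm (lin (rinv x) - x) <= 8^-1 * rnorm x.
Proof.
move=> ox; have [h1 h2 h3] := offdiag_split sP sQ PQ ox.
set w := P * x * kap; set e := (g - lam%:A) * P * x * kap * star g.
have lw : conjg w - w = P * x + e.
  have E1 : P * x * kap * (lam *: star g - 1) = P * x.
    have Qc : Q * (lam *: star g - 1) = (lam *: star g - 1) * Q.
      by rewrite mulrBr mulrBl mulr1 mul1r -scalerAr -scalerAl Qsg.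
    have QkC : Q * (kap * (lam *: star g - 1)) = Q by rewrite mulrA -kQ -mulrA Qc mulrA kapE.
    by rewrite -{1}h2 -!mulrA QkC mulrA h2.
  have -> : e = conjg w - lam *: (w * star g).
    rewrite /e /conjg /w mulrBl !mulrBl mulr_algl; congr (_ - _); first by rewrite !mulrA.
    by rewrite -!scalerAl.
  have -> : P * x = lam *: (w * star g) - w by rewrite -{1}E1 mulrBr mulr1 -scalerAr.
  nc_ring.
have lr : lin (rinv x) = (conjg w - w) - star (conjg w - w).
  by rewrite /lin /rinv -/w conjgB starB /conjg !starM starK; nc_ring.
have ne : rnorm e <= 16^-1 * rnorm x.
  rewrite /e; apply: le_trans (rnormM _ _) _; rewrite rnorm_star ng mulr1.
  apply: le_trans (rnormM _ _) _; rewrite mulrC.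
  apply: le_trans (ler_wpM2l (rnorm_ge0 _) (rnormM _ _)) _.
  rewrite mulrA [rnorm kap * _]mulrC; apply: ler_wpM2r; rewrite ?rnorm_ge0 //.
have -> : lin (rinv x) - x = e - star e.
  rewrite lr lw starD {3}h3; nc_ring.
by apply: le_trans (rnormB _ _) _; rewrite rnorm_star; lra.
Qed.

Lemma small_exp : exists2 eps : R, 0 < eps & forall c, OD c -> rnorm c <= eps ->
  exists2 a, OD a & cexp c = Fexp a.
Proof.
pose k := rnorm kap + 1; have k1 : 1 <= k by rewrite /k; have := rnorm_ge0 kap; lra.
have k0 : 0 < k by lra.
(* r makes the nonlinear part contribute 16 r * 2 k = 1/4 to the contraction factor, which with 1/8
   from [lin_rinv] stays below 1/2. [rinv] maps the ball of radius r' into that of radius r. *)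
pose r := (128 * k)^-1; pose r' := r / (2 * k).
have r0 : 0 < r by rewrite invr_gt0; lra.
have rk : r * k = 128^-1 by rewrite /r invfM mulrAC mulfK ?gt_eqF // mul1r.
have r1 : r <= 128^-1 by rewrite -rk ler_peMr // ltW.
have r'0 : 0 < r' by rewrite divr_gt0 // mulr_gt0.
have r'k : 2 * k * r' = r by rewrite /r' mulrC divfK // gt_eqF // mulr_gt0.
have r'r : r' <= r by rewrite /r' ler_pdivrMr ?mulr_gt0 // ler_peMr ?(ltW r0) //; lra.
have r4 : r <= 4^-1 by lra.
exists (r' / 8); first by rewrite divr_gt0.
move=> c oc cs.
pose y := half (cexp c - cexp (- c)); have oy : OD y by exact: offdiag_sinh.
have cr : rnorm c <= r by lra.
have cnr : rnorm (- c) <= r by rewrite rnormN.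
have r2 : r <= 2^-1 by lra.
have ny : rnorm y <= r' / 4.
  rewrite /y rnorm_half; have h := exp_lip cr cnr r2; rewrite !opprK in h.
  have -> : cexp c - cexp (- c) = (cexp c - c - (cexp (- c) + c)) + (c + c) by nc_ring.
  have h1 := rnormD (cexp c - c - (cexp (- c) + c)) (c + c); have h2 := rnormD c c.
  have := rnorm_ge0 c; have := rnorm_ge0 (c + c); nra.
pose N a := fodd a - lin a.
have NE a : N a = half (rem a - rem (- a)).
  rewrite /N /fodd /rem; have -> : lin (- a) = - lin a by rewrite /lin conjgN; nc_ring.
  have -> : Fexp a - 1 - lin a - (Fexp (- a) - 1 - - lin a) = (Fexp a - Fexp (- a)) - (lin a + lin a).
    by nc_ring.
  by rewrite [RHS]halfD halfN (halfD (lin a)) half_add.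
have Nlip a b : rnorm a <= r -> rnorm b <= r -> rnorm (N a - N b) <= 16 * r * rnorm (a - b).
  move=> ar br; rewrite !NE -halfN -halfD rnorm_half.
  have -> : rem a - rem (- a) - (rem b - rem (- b)) = (rem a - rem b) - (rem (- a) - rem (- b)).
    by nc_ring.
  have h1 := rem_lip r4 ar br; have h2 := @rem_lip r r4 (- a) (- b).
  rewrite !rnormN -opprD rnormN in h2; have {}h2 := h2 ar br.
  have := rnormB (rem a - rem b) (rem (- a) - rem (- b)); lra.
have N0 : N 0 = 0.
  by rewrite NE oppr0 subrr /half scaler0.
(* Only the odd parts of [Fexp a = cexp c] are equated, by a contraction for [T], since they
   are off-diagonal; the even parts then have equal squares [1 + y * y] and are both close to
   [1], hence equal. *)
pose T x := y - (lin (rinv x) - x) - N (rinv x).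
have rr x : rnorm x <= r' -> rnorm (rinv x) <= r.
  move=> xr; apply: le_trans (rnorm_rinv _) _; rewrite -r'k.
  by apply: ler_pM; rewrite ?rnorm_ge0 ?mulr_ge0 ?rnorm_ge0 // ler_wpM2l // /k; lra.
have linB a b : lin (a - b) = lin a - lin b by rewrite /lin conjgB; nc_ring.
have olin a : OD a -> OD (lin a).
  by move=> oa; apply: offdiagD; [exact: offdiag_conjg|exact: offdiagN].
have oN a : OD a -> OD (N a).
  by move=> oa; apply: offdiagD; [exact: offdiag_fodd|apply/offdiagN/olin].
have Tlip x z : OD x -> OD z -> rnorm x <= r' -> rnorm z <= r' ->
    rnorm (T x - T z) <= rnorm (x - z) / 2.
  move=> ox oz xr zr.
  have -> : T x - T z = - ((lin (rinv (x - z)) - (x - z)) + (N (rinv x) - N (rinv z))).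
    by rewrite /T rinvB linB; nc_ring.
  rewrite rnormN; apply: le_trans (rnormD _ _) _.
  have h1 := lin_rinv (offdiagD ox (offdiagN oz)).
  have h2 := Nlip _ _ (rr _ xr) (rr _ zr); rewrite -rinvB in h2.
  have h3 := rnorm_rinv (x - z); have d0 := rnorm_ge0 (x - z).
  have kk : rnorm kap <= k by rewrite /k; lra.
  have h4 : 16 * r * rnorm (rinv (x - z)) <= 16 * r * (2 * k * rnorm (x - z)).
    rewrite ler_wpM2l ?mulr_ge0 ?(ltW r0) //; apply: le_trans h3 _.
    by rewrite ler_wpM2r // ler_wpM2l.
  have h5 : 16 * r * (2 * k * rnorm (x - z)) = 4^-1 * rnorm (x - z).
    have -> : 16 * r * (2 * k * rnorm (x - z)) = 32 * (r * k) * rnorm (x - z) by ring.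
    by rewrite rk; congr (_ * _); lra.
  lra.
have T0 : T 0 = y.
  rewrite /T; have -> : rinv 0 = 0 by rewrite /rinv mulr0 mul0r star0 subrr.
  by rewrite N0 /lin /conjg mulr0 mul0r !subr0.
have [x [ox xr] Tx] : exists2 x, (OD `&` [set x | rnorm x <= r']) x & T x = x.
  apply: (@contraction _ _ _ _ 0).
  - by apply: closedI; [exact: offdiag_closed|exact: closed_ball].
  - by split; [exact: offdiag0|rewrite /= rnorm0 ltW].
  - move=> x [ox xr]; split.
      apply: offdiagD; last by apply/offdiagN/oN/offdiag_rinv.
      apply: offdiagD => //; apply/offdiagN; apply: offdiagD; last exact: offdiagN.
      by apply/olin/offdiag_rinv.
    have := Tlip x 0 ox (offdiag0 _ _) xr; rewrite rnorm0 T0 subr0 => /(_ (ltW r'0)) h.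
    have := rnormD (T x - y) y; rewrite subrK /= in xr *; lra.
  - by move=> x z [ox xr] [oz zr]; exact: Tlip.
pose a := rinv x; have oa : OD a by exact: offdiag_rinv.
exists a => //.
have fa : fodd a = y.
  move: Tx; rewrite /T -/a /N => /eqP.
  have -> : y - (lin a - x) - (fodd a - lin a) = x + (y - fodd a) by nc_ring.
  by rewrite -subr_eq0 addrC addKr subr_eq0 eq_sym => /eqP.
have ar : rnorm a <= r by exact: rr.
pose f0 := half (Fexp a + Fexp (- a)); pose c0 := half (cexp c + cexp (- c)).
have FE : Fexp a = f0 + fodd a.
  by rewrite /f0 /fodd -halfD -[LHS]half_add -halfD; congr half; nc_ring.
have cE : cexp c = c0 + y.
  by rewrite /c0 /y -halfD -[LHS]half_add -halfD; congr half; nc_ring.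
(* cosh^2 = 1 + sinh^2, for any two mutually inverse elements. *)
have quad u v : u * v = 1 -> v * u = 1 ->
    half (u + v) * half (u + v) = 1 + half (u - v) * half (u - v).
  move=> uv vu; rewrite /half -!scalerAl -!scalerAr !scalerA.
  apply: (@half_inj) ; apply: half_inj.
  have q4 (t : calg A) : ((2^-1 : R)%:C * (2^-1)%:C) *: t + ((2^-1 : R)%:C * (2^-1)%:C) *: t +
     (((2^-1 : R)%:C * (2^-1)%:C) *: t + ((2^-1 : R)%:C * (2^-1)%:C) *: t) = t.
    by rewrite -!scalerDl -!rmorphM -!rmorphD /= [X in X%:C](_ : _ = 1) ?rmorph1 ?scale1r //; lra.
  rewrite q4; set q := _ *: _.
  have -> : 1 + q + (1 + q) + (1 + q + (1 + q)) = 1 + 1 + 1 + 1 + (q + q + (q + q)) by nc_ring.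
  rewrite q4.
  have -> : (u + v) * (u + v) = u * u + v * v + u * v + v * u by nc_ring.
  have -> : (u - v) * (u - v) = u * u + v * v - u * v - v * u by nc_ring.
  rewrite uv vu; nc_ring.
have half2 u v : half (u + v) - 1 = half ((u - 1) + (v - 1)).
  have -> : (u - 1) + (v - 1) = (u + v) - (1 + 1) by nc_ring.
  by rewrite [RHS]halfD halfN (halfD 1) half_add.
rewrite FE cE fa; congr (_ + _); apply: sqr_near1_inj.
- rewrite /c0 /f0 (quad _ _ (cexpN c) (cexpNl c)) (quad _ _ (FexpN a) (FexpNl a)).
  by rewrite -/(fodd a) fa.
- have -> : c0 - 1 = half ((cexp c - 1) + (cexp (- c) - 1)).
    exact: half2.
  have near1 z : rnorm z <= r -> rnorm (cexp z - 1) <= 4^-1.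
    move=> zr; have := exp_near zr r2; have := rnormD (cexp z - 1 - z) z; rewrite subrK.
    have := rnorm_ge0 z; nra.
  rewrite rnorm_half; have := rnormD (cexp c - 1) (cexp (- c) - 1).
  by have := near1 _ cr; have := near1 _ cnr; lra.
- have -> : f0 - 1 = half ((Fexp a - 1) + (Fexp (- a) - 1)).
    exact: half2.
  have near1 z : rnorm z <= r -> rnorm (Fexp z - 1) <= 4^-1.
    move=> zr; have := @rem_lip r r4 z 0 zr; rewrite rnorm0 => /(_ (ltW r0)).
    have -> : rem 0 = 0.
      have h0 : half 0 = 0 by rewrite /half scaler0.
      have cg0 : conjg 0 = 0 by rewrite /conjg mulr0 mul0r.
      by rewrite /rem /Fexp /lin h0 cg0 oppr0 cexp0 !mulr1 addr0 subr0 subrr.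
    rewrite !subr0 => h.
    have -> : Fexp z - 1 = rem z + (conjg z - z) by rewrite /rem /lin subrK.
    have := rnormD (rem z) (conjg z - z); have := rnormB (conjg z) z.
    have := rnorm_conjg z; have := rnorm_ge0 z; nra.
  have anr : rnorm (- a) <= r by rewrite rnormN.
  rewrite rnorm_half; have := rnormD (Fexp a - 1) (Fexp (- a) - 1).
  by have := near1 _ ar; have := near1 _ anr; lra.
Qed.
End SmallExp.

(** * Commutators as sums of conjugates of off-diagonal elements *)

Section Simplicity.
Variables (R : realType) (A : cstarAlgType R).
Implicit Types (a b c x y : calg A).

Definition ideal_sum b (s : seq (calg A * calg A)) : calg A := \sum_(p <- s) p.1 * b * p.2.

Lemma inverse_near1 y : rnorm (y - 1) <= 2^-1 -> exists z, y * z = 1.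
Proof.
move=> y1; have [z _ zE] : exists2 z, [set: calg A] z & 1 + (1 - y) * z = z.
  apply: (@contraction _ _ setT (fun z => 1 + (1 - y) * z) 0) => //.
  move=> x z _ _.
  have -> : 1 + (1 - y) * x - (1 + (1 - y) * z) = (1 - y) * (x - z) by nc_ring.
  apply: le_trans (rnormM _ _) _; rewrite (rnormBC 1 y) [leRHS]mulrC.
  by rewrite ler_wpM2r ?rnorm_ge0.
exists z; have -> : y * z = 1 + z - (1 + (1 - y) * z) by nc_ring.
by rewrite zE addrK.
Qed.

(** The closure of the algebraic ideal of b is all of A, so some sum is within 1/2 of 1; a right
    inverse of it is absorbed into the right factors. *)
Lemma simple_unit_sum b : simple_cstar A -> b <> 0 -> exists s, ideal_sum b s = 1.
Proof.
move=> As b0; pose I := [set x : calg A | forall e : R, 0 < e -> exists s, rnorm (ideal_sum b s - x) < e].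
have Ib : I b.
  move=> e e0; exists [:: (1, 1)]; rewrite /ideal_sum big_seq1 /= mul1r mulr1 subrr rnorm0 //.
have II : closed_ideal I.
  split.
  - apply: closedP_rcvg => u l uI ul e e0; have e2 : 0 < e / 2 by lra.
    have [N /(_ N (leqnn _)) h] := ul _ e2; have [s hs] := uI N _ e2; exists s.
    by have := rnorm_tri (u N) (ideal_sum b s) l; lra.
  - by move=> e e0; exists [::]; rewrite /ideal_sum big_nil subrr rnorm0.
  - move=> x y Ix Iy e e0; have e2 : 0 < e / 2 by lra.
    have [s hs] := Ix _ e2; have [t ht] := Iy _ e2; exists (s ++ t).
    rewrite /ideal_sum big_cat /= -!/(ideal_sum _ _) opprD addrACA.
    by apply: le_lt_trans (rnormD _ _) _; lra.
  - move=> k x Ix e e0; have K0 : 0 < complex.Re `|k| + 1.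
      by have := cabs_ge0 k; rewrite /cabs; lra.
    have [s hs] := Ix _ (divr_gt0 e0 K0); exists [seq (k *: p.1, p.2) | p <- s].
    have -> : ideal_sum b [seq (k *: p.1, p.2) | p <- s] = k *: ideal_sum b s.
      by rewrite /ideal_sum big_map scaler_sumr; apply: eq_bigr => p _ /=; rewrite -!scalerAl.
    rewrite -scalerBr rnormZc; rewrite ltr_pdivlMr // in hs.
    have := cabs_ge0 k; rewrite /cabs; have := rnorm_ge0 (ideal_sum b s - x); nra.
  - move=> y x Ix; have K0 : 0 < rnorm y + 1 by have := rnorm_ge0 y; lra.
    split=> e e0; have [s hs] := Ix _ (divr_gt0 e0 K0); rewrite ltr_pdivlMr // in hs.
      exists [seq (y * p.1, p.2) | p <- s].
      have -> : ideal_sum b [seq (y * p.1, p.2) | p <- s] = y * ideal_sum b s.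
        by rewrite /ideal_sum big_map mulr_sumr; apply: eq_bigr => p _ /=; rewrite !mulrA.
      rewrite -mulrBr; apply: le_lt_trans (rnormM _ _) _.
      have := rnorm_ge0 y; have := rnorm_ge0 (ideal_sum b s - x); nra.
    exists [seq (p.1, p.2 * y) | p <- s].
    have -> : ideal_sum b [seq (p.1, p.2 * y) | p <- s] = ideal_sum b s * y.
      by rewrite /ideal_sum big_map mulr_suml; apply: eq_bigr => p _ /=; rewrite !mulrA.
    rewrite -mulrBl; apply: le_lt_trans (rnormM _ _) _.
    have := rnorm_ge0 y; have := rnorm_ge0 (ideal_sum b s - x); nra.
case: (As I II) => IE; first by rewrite IE /= in Ib; case: (b0 Ib).
have I1 : I 1 by rewrite IE.
have h2 : 0 < 2^-1 :> R by rewrite invr_gt0.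
have [s hs] := I1 _ h2; have [z hz] := inverse_near1 (ltW hs).
exists [seq (p.1, p.2 * z) | p <- s]; rewrite -hz /ideal_sum big_map mulr_suml.
by apply: eq_bigr => p _ /=; rewrite !mulrA.
Qed.
End Simplicity.

Section SkewCommutators.
Variables (R : realType) (A : cstarAlgType R).
Hypothesis span_closed : closed (@commutator_span R A).
Implicit Types (x y z l o p q : calg A).

Definition Lskew : set (calg A) := [set x | commutator_span x /\ star x = - x].

Lemma span0 : commutator_span (0 : calg A).
Proof. by exists 0%N, (fun=> 0), (fun=> 0), (fun=> 0); rewrite big_ord0. Qed.
Lemma span_comm x y : commutator_span (x * y - y * x : calg A).
Proof. by exists 1%N, (fun=> 1), (fun=> x), (fun=> y); rewrite big_ord1 scale1r. Qed.
Lemma spanZ (k : R[i]) x : commutator_span x -> commutator_span (k *: x).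
Proof.
move=> [n [c [a [b ->]]]]; exists n, (fun i => k * c i), a, b.
by rewrite scaler_sumr; apply: eq_bigr => i _; rewrite scalerA.
Qed.
Lemma spanD x y : commutator_span x -> commutator_span y -> commutator_span (x + y).
Proof.
move=> [n [c [a [b ->]]]] [n' [c' [a' [b' ->]]]].
pose F (T : Type) (u : 'I_n -> T) (v : 'I_n' -> T) (i : 'I_(n + n')) :=
  match fintype.split i with inl j => u j | inr j => v j end.
exists (n + n')%N, (F _ c c'), (F _ a a'), (F _ b b').
rewrite big_split_ord /=; congr (_ + _); apply: eq_bigr => i _; rewrite /F.
  by rewrite (unsplitK (inl i)).
by rewrite (unsplitK (inr i)).
Qed.

Lemma Lskew0 : Lskew 0. Proof. by split; [exact: span0|rewrite star0 oppr0]. Qed.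
Lemma LskewD x y : Lskew x -> Lskew y -> Lskew (x + y).
Proof. by move=> [a b] [a' b']; split; [exact: spanD|rewrite starD b b' opprD]. Qed.
Lemma LskewZ (k : R) x : Lskew x -> Lskew (k%:C *: x).
Proof. by move=> [a b]; split; [exact: spanZ|rewrite starZr b scalerN]. Qed.
Lemma LskewN x : Lskew x -> Lskew (- x).
Proof. by move=> /(LskewZ (-1)); rewrite rmorphN rmorph1 scaleN1r. Qed.
Lemma Lskew_br x y : Lskew x -> Lskew y -> Lskew (x * y - y * x).
Proof.
move=> [a b] [a' b']; split; first exact: span_comm.
by rewrite starB !starM b b' !mulrNN opprB.
Qed.
Lemma Lskew_closed : closed Lskew.
Proof.
apply: closedP_rcvg => u l uL ul; split.
  by apply: (rcvg_closed span_closed ul) => n; have [] := uL n.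
apply: (rcvg_unique (rcvg_star ul)); apply: (rcvg_ext _ (rcvgN ul)) => n.
by have [_ ->] := uL n.
Qed.

(** The corner z = P x satisfies P z = z and z P = 0, so z = [P, z] and - star z = [P, star z]. *)
Lemma offdiag_Lskew P Q x : star P = P -> star Q = Q -> P * Q = 0 ->
  offdiag P Q x -> Lskew x.
Proof.
move=> sP sQ PQ ox; have [sx _ _] := ox; split=> //.
have QP : Q * P = 0 by rewrite -[Q]sQ -[X in _ * X]sP -starM PQ star0.
have [h1 h2 ->] := offdiag_split sP sQ PQ ox.
have zP : P * x * P = 0 by rewrite -h2 -mulrA QP mulr0.
have -> : P * x - star (P * x) = (P * (P * x) - (P * x) * P) +
   (P * star (P * x) - star (P * x) * P).
  rewrite h1 zP; have -> : P * star (P * x) = 0 by rewrite -{1}sP -starM zP star0.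
  have -> : star (P * x) * P = star (P * x) by rewrite -{2}sP -starM h1.
  by rewrite subr0 sub0r.
by apply: spanD; exact: span_comm.
Qed.

(** One bracket of off-diagonal elements is block diagonal; in the second, P - Q passes three
    anticommuting factors and changes sign again. *)
Lemma offdiag_adj2 P Q p x : star P = P -> star Q = Q -> P * Q = 0 ->
  offdiag P Q p -> offdiag P Q x -> offdiag P Q (adj p (adj p x)).
Proof.
move=> sP sQ PQ [p1 p2 p3] [x1 x2 x3]; split.
- by rewrite /adj !(starB, starM) p1 x1; nc_ring.
- rewrite /adj; have -> : p * (p * x - x * p) - (p * x - x * p) * p =
    p * (p * x - x * p) - p * x * p + x * p * p by nc_ring.
  by rewrite mulrDr mulrBr !mulrA p2 x2.
- move: (P - Q) p3 x3 => J p3 x3.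
  have e : adj p (adj p x) = p * p * x - p * x * p - p * x * p + x * p * p by rewrite /adj; nc_ring.
  have t a b c : J * a = - (a * J) -> J * b = - (b * J) -> J * c = - (c * J) ->
      J * (a * b * c) = - (a * b * c * J).
    move=> ha hb hc; have -> : J * (a * b * c) = (J * a) * b * c by nc_ring.
    rewrite ha; have -> : - (a * J) * b * c = - (a * (J * b) * c) by nc_ring.
    rewrite hb; have -> : - (a * - (b * J) * c) = a * b * (J * c) by nc_ring.
    by rewrite hc; nc_ring.
  rewrite e !(mulrDr, mulrN, mulrDl, mulNr) !t //; nc_ring.
Qed.
End SkewCommutators.

Section Decomposition.
Variables (R : realType) (A : cstarAlgType R) (g : calg A) (lam : R[i]) (n kap : nat -> calg A).
Hypothesis A_simple : simple_cstar A.
Hypothesis cut : cutoffs g 19 lam n kap.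
Implicit Types (x y z l o p q X Y : calg A).

Definition offdiag_at i := offdiag (n i) (1 - n i.+1).

Lemma cut_mulr i j : (i < j)%N -> n i * n j = n i.
Proof.
by move=> ij; rewrite -(cut_sa cut i) -(cut_sa cut j) -starM (cut_mul cut ij).
Qed.
Lemma star_far i : star (1 - n i) = 1 - n i.
Proof. by rewrite starB star1 (cut_sa cut). Qed.
Lemma near_far i j : (i < j)%N -> n i * (1 - n j) = 0.
Proof. by move=> ij; rewrite mulrBr mulr1 cut_mulr // subrr. Qed.
Lemma far_near i j : (i < j)%N -> (1 - n j) * n i = 0.
Proof. by move=> ij; rewrite mulrBl mul1r (cut_mul cut ij) subrr. Qed.
Lemma far_far i j : (i < j)%N -> (1 - n j) * (1 - n i) = 1 - n j.
Proof. by move=> ij; rewrite mulrBr mulr1 far_near // subr0. Qed.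
Lemma far_farl i j : (i < j)%N -> (1 - n i) * (1 - n j) = 1 - n j.
Proof. by move=> ij; rewrite mulrBl mul1r near_far // subr0. Qed.
Lemma norm_far i : rnorm (1 - n i) <= 2.
Proof. by apply: le_trans (rnormB _ _) _; rewrite rnorm1; have := cut_norm cut i; lra. Qed.

Definition small_off (c : R) o := exists2 i, (i < 19)%N & offdiag_at i o /\ rnorm o <= c.

(* [x] is a sum of [N] conjugates of off-diagonal elements of norm at most [c]. *)
Inductive conj_dec (c : R) : nat -> calg A -> Prop :=
| Dec0 : conj_dec c 0 0
| DecS N x l o : conj_dec c N x -> Lskew l -> small_off c o ->
    conj_dec c N.+1 (x + cexp l * o * cexp (- l)).

Lemma small_off_le c c' o : c <= c' -> small_off c o -> small_off c' o.
Proof. by move=> cc [i i9 [oo oc]]; exists i => //; split=> //; apply: le_trans cc. Qed.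
Lemma Dec_le c c' N x : c <= c' -> conj_dec c N x -> conj_dec c' N x.
Proof.
move=> cc; elim=> [|{}N {}x l o _ IH Ll os]; first exact: Dec0.
by apply: DecS => //; apply: small_off_le cc os.
Qed.
Lemma DecD c N M x y : conj_dec c N x -> conj_dec c M y -> conj_dec c (N + M) (x + y).
Proof.
move=> dx; elim=> [|{}M {}y l o _ IH Ll os]; first by rewrite addn0 addr0.
by rewrite addnS addrA; apply: DecS.
Qed.
Lemma DecN c N x : conj_dec c N x -> conj_dec c N (- x).
Proof.
elim=> [|{}N {}x l o _ IH Ll [i i9 [oo os]]]; first by rewrite oppr0; exact: Dec0.
rewrite opprD -mulNr -mulrN; apply: DecS => //; exists i => //.
by split; [exact: offdiagN|rewrite rnormN].
Qed.
Lemma Dec1 c l o : Lskew l -> small_off c o -> conj_dec c 1 (cexp l * o * cexp (- l)).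
Proof. by move=> Ll os; rewrite -[X in conj_dec _ _ X]add0r; apply: DecS => //; exact: Dec0. Qed.

Definition sk x := x - star x.
Lemma skD x y : sk (x + y) = sk x + sk y.
Proof. by rewrite /sk starD; nc_ring. Qed.
Lemma skN x : sk (- x) = - sk x.
Proof. by rewrite /sk starN; nc_ring. Qed.
Lemma sk_star x : sk (star x) = - sk x.
Proof. by rewrite /sk starK opprB. Qed.

(** N and C are uniform in x and y. The size |x| |y| matches what bounded commutators generation
    provides, and [sk] appears because [conj_dec] only produces skew elements. *)
Definition dec_bounded (F : calg A -> calg A -> calg A) := exists N C, 0 <= C /\
  forall x y, conj_dec (C * (rnorm x * rnorm y)) N (sk (F x y)).

Let xy0 x y : 0 <= rnorm x * rnorm y. Proof. by rewrite mulr_ge0 ?rnorm_ge0. Qed.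

Lemma bd0 : dec_bounded (fun _ _ => 0).
Proof. by exists 0%N, 0; split=> // x y; rewrite /sk star0 subrr; exact: Dec0. Qed.
Lemma bdD F G : dec_bounded F -> dec_bounded G -> dec_bounded (fun x y => F x y + G x y).
Proof.
move=> [N [C [C0 hF]]] [M [D [D0 hG]]]; exists (N + M)%N, (C + D); split=> [|x y]; first exact: addr_ge0.
have h := xy0 x y; rewrite skD; apply: DecD.
  by apply: Dec_le (hF x y); rewrite ler_wpM2r // lerDl.
by apply: Dec_le (hG x y); rewrite ler_wpM2r // lerDr.
Qed.
Lemma bd_eq F G : dec_bounded F -> (forall x y, sk (G x y) = sk (F x y)) -> dec_bounded G.
Proof. by move=> [N [C [C0 hF]]] FG; exists N, C; split=> // x y; rewrite FG. Qed.
Lemma bdN F : dec_bounded F -> dec_bounded (fun x y => - F x y).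
Proof.
by move=> [N [C [C0 hF]]]; exists N, C; split=> // x y; rewrite skN; apply: DecN.
Qed.
Lemma bd_sub F (X Y : calg A -> calg A -> calg A) (K : R) : dec_bounded F -> 0 <= K ->
  (forall x y, rnorm (X x y) * rnorm (Y x y) <= K * (rnorm x * rnorm y)) ->
  dec_bounded (fun x y => F (X x y) (Y x y)).
Proof.
move=> [N [C [C0 hF]]] K0 h; exists N, (C * K); split=> [|x y]; first exact: mulr_ge0.
by apply: Dec_le (hF _ _); rewrite -mulrA ler_wpM2l.
Qed.
Lemma bd_sum (T : Type) (s : seq T) (F : T -> calg A -> calg A -> calg A) :
  (forall t, dec_bounded (F t)) -> dec_bounded (fun x y => \sum_(t <- s) F t x y).
Proof.
move=> h; elim: s => [|t s IH].
  by apply: bd_eq bd0 _ => x y; rewrite big_nil.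
by apply: bd_eq (bdD (h t) IH) _ => x y; rewrite big_cons.
Qed.

Lemma norm_near_mul x i : rnorm (n i * x) <= rnorm x.
Proof.
apply: le_trans (rnormM _ _) _; rewrite -[leRHS]mul1r.
by rewrite ler_wpM2r ?rnorm_ge0 // (cut_norm cut).
Qed.
Lemma norm_mul_far x i : rnorm (x * (1 - n i)) <= 2 * rnorm x.
Proof. by apply: le_trans (rnormM _ _) _; rewrite mulrC ler_wpM2r ?rnorm_ge0 ?norm_far. Qed.

Lemma corner_off i j k t : (j < i)%N -> (i.+1 < k)%N ->
  offdiag_at i (sk (n j * t * (1 - n k))) /\ rnorm (sk (n j * t * (1 - n k))) <= 4 * rnorm t.
Proof.
move=> ji ik; split.
  apply: offdiag_corner; rewrite ?(cut_sa cut) ?star_far ?near_far //.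
    by rewrite !mulrA (cut_mul cut ji).
  by rewrite -mulrA far_far.
apply: le_trans (rnormB _ _) _; rewrite rnorm_star.
have h1 := norm_mul_far (n j * t) k; have h2 := norm_near_mul t j; lra.
Qed.

Lemma bd_corner i j k : (j < i)%N -> (i.+1 < k)%N -> (i < 19)%N ->
  dec_bounded (fun x y => n j * (x * y) * (1 - n k)).
Proof.
move=> ji ik i9; exists 1%N, 4; split=> // x y.
have [h1 h2] := corner_off (x * y) ji ik.
have := @Dec1 (4 * (rnorm x * rnorm y)) 0 (sk (n j * (x * y) * (1 - n k))) (Lskew0 _).
rewrite oppr0 cexp0 mul1r mulr1; apply; exists i => //; split=> //.
by apply: le_trans h2 _; rewrite ler_wpM2l ?rnormM.
Qed.
Lemma bd_cornerT i j k : (j < i)%N -> (i.+1 < k)%N -> (i < 19)%N ->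
  dec_bounded (fun x y => (1 - n k) * (x * y) * n j).
Proof.
move=> ji ik i9; apply: bd_eq (bdN (@bd_sub _ (fun x y => star y) (fun x y => star x) 1 (bd_corner ji ik i9) _ _)) _ => //.
  by move=> x y; rewrite mul1r !rnorm_star mulrC.
move=> x y; rewrite skN -sk_star; congr sk; rewrite !starM star_far (cut_sa cut) !starK !mulrA //.
Qed.

(** The products of the two corners and of their adjoints vanish, so only the mixed terms of the
    bracket of the skew parts survive. *)
Lemma sk_comm_star z1 z2 : z1 * z2 = 0 -> z2 * z1 = 0 ->
  sk (star z1 * z2 - z2 * star z1) = - adj (sk z1) (sk z2).
Proof.
move=> z12 z21; rewrite /sk /adj starB !starM starK.
have s12 : star z2 * star z1 = 0 by rewrite -starM z12 star0.
have s21 : star z1 * star z2 = 0 by rewrite -starM z21 star0.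
have -> : (z1 - star z1) * (z2 - star z2) - (z2 - star z2) * (z1 - star z1) =
  z1 * z2 + star z1 * star z2 - z2 * z1 - star z2 * star z1
  - z1 * star z2 - star z1 * z2 + z2 * star z1 + star z2 * z1 by nc_ring.
rewrite z12 z21 s12 s21; nc_ring.
Qed.

(** The commutator of opposite corners is block diagonal, hence out of reach of a single
    off-diagonal term. By [sk_comm_star] it is a bracket [p, q] of off-diagonal elements; solving
    sinhc_ad p w = q turns it into two conjugates of w / 2 up to sign. *)
Lemma bd_sinh i j k : (j < i)%N -> (i.+1 < k)%N -> (i < 19)%N ->
  dec_bounded (fun x y => ((1 - n k) * x * n j) * (n j * y * (1 - n k))
     - (n j * y * (1 - n k)) * ((1 - n k) * x * n j)).
Proof.
move=> ji ik i9; exists 2%N, (2 ^+ 11); split=> [|x y]; first exact: exprn_ge0.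
set z1 := n j * star x * (1 - n k); set z2 := n j * y * (1 - n k).
have -> : (1 - n k) * x * n j = star z1.
  by rewrite /z1 !starM star_far (cut_sa cut) starK !mulrA.
have [h1 b1] := corner_off (star x) ji ik; have [h2 b2] := corner_off y ji ik.
rewrite -/z1 in h1 b1; rewrite -/z2 in h2 b2; rewrite rnorm_star in b1.
have sP : star (n i) = n i := cut_sa cut i.
have sQ := star_far i.+1.
have PQ : n i * (1 - n i.+1) = 0 by exact: near_far.
have kj : (j < k)%N by lia.
have z12 : z1 * z2 = 0.
  by rewrite /z1 /z2 mulrA -[_ * (1 - n k) * (n j * y)]mulrA [(1 - n k) * (n j * y)]mulrA far_near // mul0r mulr0 mul0r.
have z21 : z2 * z1 = 0.
  by rewrite /z1 /z2 mulrA -[_ * (1 - n k) * (n j * _)]mulrA [(1 - n k) * (n j * _)]mulrA far_near // mul0r mulr0 mul0r.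
have skE := sk_comm_star z12 z21.
rewrite skE; have [x0|x0] := eqVneq x 0.
  have -> : sk z1 = 0 by rewrite /z1 x0 /sk star0 mulr0 mul0r star0 subrr.
  have -> : - adj 0 (sk z2) = cexp 0 * 0 * cexp (- 0) + cexp 0 * 0 * cexp (- 0).
    by rewrite /adj !mul0r !mulr0 !mul0r subrr oppr0 addr0.
  have so : small_off (2 ^+ 11 * (rnorm x * rnorm y)) 0.
    by exists i => //; split; [exact: offdiag0|rewrite rnorm0 mulr_ge0 // exprn_ge0].
  by apply: DecS => //; [apply: Dec1 => //; exact: Lskew0|exact: Lskew0].
have nx : 0 < rnorm x by rewrite lt_neqAle rnorm_ge0 andbT eq_sym rnorm_eq0.
(* By bilinearity p is scaled down to norm 4 / 2^8 = 1/64 at the expense of q; the case x = 0 was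
   split off to have t > 0. *)
pose t := 2 ^+ 8 * rnorm x; have t0 : 0 < t by rewrite mulr_gt0 // exprn_gt0.
pose p := (t^-1)%:C *: sk z1; pose q := (- t)%:C *: sk z2.
have op : offdiag (n i) (1 - n i.+1) p by exact: offdiagZ.
have oq : offdiag (n i) (1 - n i.+1) q by exact: offdiagZ.
have ps : rnorm p <= 64^-1.
  rewrite /p rnormZ gtr0_norm ?invr_gt0 // mulrC ler_pdivrMr // /t; lra.
have pq : - adj (sk z1) (sk z2) = adj p q.
  have E : (t^-1)%:C * (- t)%:C = -1 :> R[i].
    by rewrite -rmorphM mulrN mulVf ?gt_eqF // rmorphN rmorph1.
  rewrite /adj /p /q -!scalerAl -!scalerAr !scalerA [(- t)%:C * _]mulrC E.
  by rewrite !scaleN1r opprK opprB addrC.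
have nq : rnorm q <= 2 ^+ 10 * (rnorm x * rnorm y).
  rewrite /q rnormZ normrN gtr0_norm // /t.
  apply: le_trans (ler_wpM2l (ltW t0) b2) _; rewrite le_eqVlt; apply/orP; left; apply/eqP.
  by rewrite /t; ring.
have [w [Kw nw wE]] := sinhc_ad_onto ps (@offdiag_closed R A (n i) (1 - n i.+1)) (@offdiag0 R A _ _)
  (@offdiagD _ _ _ _) (@offdiagZ _ _ _ _) (fun x => offdiag_adj2 sP sQ PQ op) oq.
have E := sinh_adE ps w; rewrite wE in E.
pose h := half w; have oh : offdiag (n i) (1 - n i.+1) h by exact: offdiag_half.
have -> : - adj (sk z1) (sk z2) = cexp p * h * cexp (- p) + cexp (- p) * (- h) * cexp (- - p).
  rewrite pq opprK mulrN mulNr; apply: (@half_inj).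
  have hh : h + h = w by exact: half_add.
  have -> : cexp p * h * cexp (- p) - cexp (- p) * h * cexp p +
     (cexp p * h * cexp (- p) - cexp (- p) * h * cexp p) =
     cexp p * (h + h) * cexp (- p) - cexp (- p) * (h + h) * cexp p by nc_ring.
  by rewrite hh E scaler_nat mulr2n.
have Lp : Lskew p by exact: (offdiag_Lskew sP sQ PQ op).
have nh : rnorm h <= 2 ^+ 11 * (rnorm x * rnorm y) by rewrite rnorm_half; have := xy0 x y; lra.
apply: DecS; [apply: Dec1 => //|exact: LskewN|].
  by exists i.
by exists i => //; split; [exact: offdiagN|rewrite rnormN].
Qed.
End Decomposition.

Section FullDecomposition.
Variables (R : realType) (A : cstarAlgType R) (g : calg A) (lam : R[i]) (n kap : nat -> calg A).
Hypothesis A_simple : simple_cstar A.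
Hypothesis cut : cutoffs g 19 lam n kap.
Implicit Types (x y z l p q X Y : calg A).
Local Notation dec_bounded := (dec_bounded n).

Lemma rnormM_le (a b : calg A) (k m : R) : rnorm a <= k -> rnorm b <= m -> rnorm (a * b) <= k * m.
Proof.
by move=> ak bm; apply: le_trans (rnormM _ _) _; apply: ler_pM; rewrite ?rnorm_ge0.
Qed.
Let n1 i : rnorm (n i) <= 1 := cut_norm cut i.
Let f2 i : rnorm (1 - n i) <= 2 := norm_far cut i.
Let nj i j : (i < j)%N -> n j * n i = n i. Proof. exact: cut_mul cut i j. Qed.
Let ni i j : (i < j)%N -> n i * n j = n i. Proof. exact: (cut_mulr cut). Qed.
Let fj i j : (i < j)%N -> (1 - n j) * (1 - n i) = 1 - n j. Proof. exact: (far_far cut). Qed.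
Let fi i j : (i < j)%N -> (1 - n i) * (1 - n j) = 1 - n j. Proof. exact: (far_farl cut). Qed.

(** The sum 1 = \sum u v through 1 - n 19 routes the commutator through opposite corners: \sum
    [p x u, v p y] is p x p y minus an unwanted sum of terms v p y p x u. The commutators
    [p y p x u, v n 14] produce the same unwanted sum, n 14 being a unit for p y, together with p y
    p x. *)
Lemma bd_near : dec_bounded (fun x y => (n 13 * x * n 13) * (n 13 * y * n 13) - (n 13 * y * n 13) * (n 13 * x * n 13)).
Proof.
have f19 : 1 - n 19%N <> 0.
  by move/eqP; rewrite subr_eq0 eq_sym => /eqP; exact: cut_neq1 cut.
have [s sE] := simple_unit_sum A_simple f19.
have i15 : (15 < 19)%N by []. have j13 : (13 < 15)%N by []. have j14 : (14 < 15)%N by [].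
have k17 : (15.+1 < 17)%N by [].
have S13 := bd_sinh cut j13 k17 i15; have S14 := bd_sinh cut j14 k17 i15.
pose u (t : calg A * calg A) := t.1 * (1 - n 18%N).
pose v (t : calg A * calg A) := (1 - n 19%N) * t.2.
have uv : \sum_(t <- s) u t * v t = 1.
  rewrite -sE /ideal_sum; apply: eq_bigr => t _.
  by rewrite /u /v mulrA -[_ * _ * (1 - n 19%N)]mulrA fi.
pose p x := n 13%N * x * n 13%N.
have F1 t : dec_bounded (fun x y => (p x * u t) * (v t * p y) - (v t * p y) * (p x * u t)).
  have K0 : 0 <= 4 * rnorm t.1 * rnorm t.2 by rewrite !mulr_ge0 ?rnorm_ge0.
  have := bdN (bd_sub (X := fun x y => (1 - n 19%N) * t.2 * n 13%N * y)
    (Y := fun x y => x * n 13%N * t.1 * (1 - n 18%N)) S13 K0 _).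
  move=> h; apply: bd_eq (h _) _ => [x y|x y].
    have hX := rnormM_le (rnormM_le (rnormM_le (f2 19%N) (lexx (rnorm t.2))) (n1 13%N)) (lexx (rnorm y)).
    have hY := rnormM_le (rnormM_le (rnormM_le (lexx (rnorm x)) (n1 13%N)) (lexx (rnorm t.1))) (f2 18%N).
    apply: le_trans (ler_pM (rnorm_ge0 _) (rnorm_ge0 _) hX hY) _.
    by rewrite le_eqVlt; apply/orP; left; apply/eqP; ring.
  have e1 : (1 - n 17%N) * ((1 - n 19%N) * t.2 * n 13%N * y) * n 13%N = v t * p y.
    by rewrite /v /p !mulrA fi.
  have e2 : n 13%N * (x * n 13%N * t.1 * (1 - n 18%N)) * (1 - n 17%N) = p x * u t.
    by rewrite /u /p -!mulrA fj.
  by rewrite e1 e2 opprB.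
have F2 t : dec_bounded (fun x y => (p y * p x * u t) * (v t * n 14%N) - (v t * n 14%N) * (p y * p x * u t)).
  have K0 : 0 <= 4 * rnorm t.1 * rnorm t.2 by rewrite !mulr_ge0 ?rnorm_ge0.
  have := bdN (bd_sub (X := fun x y => (1 - n 19%N) * t.2)
    (Y := fun x y => p y * p x * t.1 * (1 - n 18%N)) S14 K0 _).
  move=> h; apply: bd_eq (h _) _ => [x y|x y].
    have hp z := rnormM_le (rnormM_le (n1 13%N) (lexx (rnorm z))) (n1 13%N).
    have hX := rnormM_le (f2 19%N) (lexx (rnorm t.2)).
    have hY := rnormM_le (rnormM_le (rnormM_le (hp y) (hp x)) (lexx (rnorm t.1))) (f2 18%N).
    apply: le_trans (ler_pM (rnorm_ge0 _) (rnorm_ge0 _) hX hY) _.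
    by rewrite le_eqVlt; apply/orP; left; apply/eqP; ring.
  have e1 : (1 - n 17%N) * ((1 - n 19%N) * t.2) * n 14%N = v t * n 14%N.
    by rewrite /v !mulrA fi.
  have e2 : n 14%N * (p y * p x * t.1 * (1 - n 18%N)) * (1 - n 17%N) = p y * p x * u t.
    by rewrite /u /p !mulrA nj // -!mulrA fj.
  by rewrite e1 e2 opprB.
apply: bd_eq (bdD (bd_sum s F1) (bdN (bd_sum s F2))) _ => x y; congr sk.
rewrite -/(p x) -/(p y) -sumrN -big_split /=.
rewrite (eq_bigr (fun t => p x * (u t * v t) * p y - p y * p x * (u t * v t) * n 14%N
   - v t * (p y * p x) * u t + v t * (n 14%N * p y) * p x * u t)); last by move=> t _; nc_ring.
have -> : n 14%N * p y = p y by rewrite /p !mulrA nj.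
rewrite (eq_bigr (fun t => p x * (u t * v t) * p y - p y * p x * (u t * v t) * n 14%N));
  last by move=> t _; nc_ring.
rewrite big_split sumrN /= -!mulr_suml -!mulr_sumr uv !mulr1.
by rewrite {4}/p -!mulrA ni // !mulrA.
Qed.

(** x is split at n 9, and y at n 6 or n 12 accordingly. In G1 and G3 one of the two products
    vanishes and the other is a single corner; G2 is a commutator of opposite corners; in G4
    everything lives inside n 13. The gaps 6-9, 9-12 and 1-4 leave room for the cutoffs i and i + 1
    of each corner. *)
Lemma bd_mid : dec_bounded (fun x y => (x * n 1%N) * (n 1%N * y) - (n 1%N * y) * (x * n 1%N)).
Proof.
pose p1 x := (1 - n 9%N) * (x * n 1%N); pose p2 x := n 9%N * (x * n 1%N).
pose q1 y := n 1%N * y * n 6%N; pose q2 y := n 1%N * y * (1 - n 6%N).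
pose q3 y := n 1%N * y * n 12%N; pose q4 y := n 1%N * y * (1 - n 12%N).
have G1 : dec_bounded (fun x y => p1 x * q1 y - q1 y * p1 x).
  have := bd_sub (X := fun x y => x * n 1%N) (Y := fun x y => n 1%N * y)
    (bd_cornerT cut (i := 7) (j := 6) (k := 9) isT isT isT) ler01 _ => h.
  apply: bd_eq (h _) _ => [x y|x y].
    rewrite mul1r; have := ler_pM (rnorm_ge0 _) (rnorm_ge0 _) (rnormM_le (lexx (rnorm x)) (n1 1%N)) (rnormM_le (n1 1%N) (lexx (rnorm y))).
    by rewrite mulr1 mul1r.
  congr sk; have -> : q1 y * p1 x = 0.
    by rewrite /q1 /p1 -mulrA [n 6%N * _]mulrA (near_far cut) // mul0r mulr0.
  by rewrite subr0 /p1 /q1 !mulrA.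
have G2 : dec_bounded (fun x y => p1 x * q2 y - q2 y * p1 x).
  have := bd_sub (X := fun x y => (1 - n 9%N) * x) (Y := fun x y => y * (1 - n 6%N))
    (bd_sinh cut (i := 2) (j := 1) (k := 4) isT isT isT) (ler0n _ 4) _ => h.
  apply: bd_eq (h _) _ => [x y|x y].
    have := ler_pM (rnorm_ge0 _) (rnorm_ge0 _) (rnormM_le (f2 9%N) (lexx (rnorm x))) (rnormM_le (lexx (rnorm y)) (f2 6%N)).
    by move=> h1; apply: le_trans h1 _; rewrite le_eqVlt; apply/orP; left; apply/eqP; ring.
  have e1 : (1 - n 4%N) * ((1 - n 9%N) * x) * n 1%N = p1 x by rewrite /p1 !mulrA fi.
  have e2 : n 1%N * (y * (1 - n 6%N)) * (1 - n 4%N) = q2 y by rewrite /q2 -!mulrA fj.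
  by rewrite e1 e2.
have G3 : dec_bounded (fun x y => p2 x * q4 y - q4 y * p2 x).
  have := bd_sub (X := fun x y => x * n 1%N) (Y := fun x y => n 1%N * y)
    (bd_corner cut (i := 10) (j := 9) (k := 12) isT isT isT) ler01 _ => h.
  apply: bd_eq (h _) _ => [x y|x y].
    rewrite mul1r; have := ler_pM (rnorm_ge0 _) (rnorm_ge0 _) (rnormM_le (lexx (rnorm x)) (n1 1%N)) (rnormM_le (n1 1%N) (lexx (rnorm y))).
    by rewrite mulr1 mul1r.
  congr sk; have -> : q4 y * p2 x = 0.
    by rewrite /q4 /p2 -mulrA [(1 - n 12%N) * _]mulrA (far_near cut) // mul0r mulr0.
  by rewrite subr0 /p2 /q4 !mulrA.
have G4 : dec_bounded (fun x y => p2 x * q3 y - q3 y * p2 x).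
  have := bd_sub (X := fun x y => p2 x) (Y := fun x y => q3 y) bd_near ler01 _ => h.
  apply: bd_eq (h _) _ => [x y|x y].
    rewrite mul1r; have := ler_pM (rnorm_ge0 _) (rnorm_ge0 _)
      (rnormM_le (n1 9%N) (rnormM_le (lexx (rnorm x)) (n1 1%N))) (rnormM_le (rnormM_le (n1 1%N) (lexx (rnorm y))) (n1 12%N)).
    by rewrite !mulr1 !mul1r.
  have e1 : n 13 * p2 x * n 13 = p2 x by rewrite /p2 !mulrA nj // -!mulrA ni.
  have e2 : n 13 * q3 y * n 13 = q3 y by rewrite /q3 !mulrA nj // -!mulrA ni.
  by rewrite e1 e2.
apply: bd_eq (bdD (bdD G1 G2) (bdD G3 G4)) _ => x y; congr sk.
rewrite /p1 /p2 /q1 /q2 /q3 /q4.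
move: (x * n 1%N) (n 1%N * y) => p q; nc_ring.
Qed.

(* With [1 = \sum al t * ga t] and [al], [ga] supported in [n 1], [x * y - y * x] is a sum of
   commutators [[ga t x al t', ga t' y al t]] and [[(x y - y x) al t, ga t]]. *)
Lemma bd_commutator : dec_bounded (fun x y => x * y - y * x).
Proof.
have n00 : n 0%N * n 0%N <> 0.
  move=> h; have := rnormCstar (n 0%N); rewrite (cut_sa cut) h rnorm0 => /esym/eqP.
  by rewrite expf_eq0 rnorm_eq0 /= => /eqP; exact: cut_neq0 cut.
have [s sE] := simple_unit_sum A_simple n00.
pose al (t : calg A * calg A) := t.1 * n 0%N; pose ga (t : calg A * calg A) := n 0%N * t.2.
have ag : \sum_(t <- s) al t * ga t = 1.
  by rewrite -sE; apply: eq_bigr => t _; rewrite /al /ga !mulrA.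
have al1 t : al t * n 1%N = al t by rewrite /al -mulrA ni.
have ga1 t : n 1%N * ga t = ga t by rewrite /ga mulrA nj.
have F1 t t' : dec_bounded (fun x y => (ga t * x * al t') * (ga t' * y * al t) - (ga t' * y * al t) * (ga t * x * al t')).
  have K0 : 0 <= rnorm (ga t) * rnorm (al t') * rnorm (ga t') * rnorm (al t) by rewrite !mulr_ge0 ?rnorm_ge0.
  have := bd_sub (X := fun x y => ga t * x * al t') (Y := fun x y => ga t' * y * al t) bd_mid K0 _ => h.
  apply: bd_eq (h _) _ => [x y|x y].
    have hX := rnormM_le (rnormM_le (lexx (rnorm (ga t))) (lexx (rnorm x))) (lexx (rnorm (al t'))).
    have hY := rnormM_le (rnormM_le (lexx (rnorm (ga t'))) (lexx (rnorm y))) (lexx (rnorm (al t))).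
    apply: le_trans (ler_pM (rnorm_ge0 _) (rnorm_ge0 _) hX hY) _.
    by rewrite le_eqVlt; apply/orP; left; apply/eqP; ring.
  have e1 : ga t * x * al t' * n 1%N = ga t * x * al t' by rewrite -mulrA al1.
  have e2 : n 1%N * (ga t' * y * al t) = ga t' * y * al t.
    by rewrite mulrA [n 1%N * (ga t' * y)]mulrA ga1.
  by rewrite e1 e2.
have F2 t : dec_bounded (fun x y => ((x * y - y * x) * al t) * ga t - ga t * ((x * y - y * x) * al t)).
  have K0 : 0 <= 2 * rnorm (al t) * rnorm (ga t) by rewrite !mulr_ge0 ?rnorm_ge0.
  have := bd_sub (X := fun x y => (x * y - y * x) * al t) (Y := fun x y => ga t) bd_mid K0 _ => h.
  apply: bd_eq (h _) _ => [x y|x y].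
    have hc : rnorm (x * y - y * x) <= 2 * (rnorm x * rnorm y).
      by have := rnorm_adj x y; rewrite /adj -mulrA.
    have hX := rnormM_le hc (lexx (rnorm (al t))).
    apply: le_trans (ler_wpM2r (rnorm_ge0 _) hX) _.
    by rewrite le_eqVlt; apply/orP; left; apply/eqP; ring.
  have e1 : (x * y - y * x) * al t * n 1%N = (x * y - y * x) * al t by rewrite -mulrA al1.
  by rewrite e1 ga1.
apply: bd_eq (bdD (bd_sum s (fun t => bd_sum s (F1 t))) (bd_sum s F2)) _ => x y; congr sk.
have E z w t : \sum_(t' <- s) ga t * z * al t' * (ga t' * w * al t) = ga t * (z * w) * al t.
  rewrite (eq_bigr (fun t' => ga t * z * (al t' * ga t') * (w * al t))); last first.
    by move=> t' _; move: (al t') (ga t') (ga t) (al t) => a b c d; nc_ring.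
  rewrite -mulr_suml -mulr_sumr ag mulr1.
  by move: (ga t) (al t) => c d; nc_ring.
have E1 : \sum_(t <- s) \sum_(t' <- s) (ga t * x * al t' * (ga t' * y * al t) -
    ga t' * y * al t * (ga t * x * al t')) = \sum_(t <- s) ga t * (x * y - y * x) * al t.
  rewrite (eq_bigr (fun t => \sum_(t' <- s) ga t * x * al t' * (ga t' * y * al t) -
    \sum_(t' <- s) ga t' * y * al t * (ga t * x * al t'))); last by move=> t _; rewrite sumrB.
  rewrite sumrB (eq_bigr _ (fun t _ => E x y t)) [X in _ - X]exchange_big /=.
  rewrite [X in _ - X](eq_bigr _ (fun t _ => E y x t)) -sumrB; apply: eq_bigr => t _.
  by rewrite mulrBr mulrBl.
rewrite E1 sumrB.
rewrite [X in _ + (X - _)](eq_bigr (fun t => (x * y - y * x) * (al t * ga t))); last first.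
  by move=> t _; move: (al t) (ga t) (x * y - y * x) => a b c; nc_ring.
rewrite -mulr_sumr ag mulr1 [X in _ + (_ - X)](eq_bigr (fun t => ga t * (x * y - y * x) * al t)); last first.
  by move=> t _; move: (al t) (ga t) (x * y - y * x) => a b c; nc_ring.
by rewrite [RHS]addrCA subrr addr0.
Qed.

Lemma Lskew_dec : bounded_commutators_generation A -> exists N C, 0 < C /\
  forall h, Lskew h -> conj_dec n (C * rnorm h) N h.
Proof.
move=> [_ [m [C [C0 hC]]]]; have [N [D [D0 hD]]] := bd_commutator.
exists (m * N)%N, (D * C + 1); split=> [|h [Lh sh]].
  have DC : 0 <= D * C by rewrite mulr_ge0 // ltW.
  lra.
have [x [y [hE xy]]] := hC h (subset_closure Lh).
(* As h is skew it equals sk h / 2, and the factor 1/2 is put into the x i. *)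
have hS : h = \sum_(i < m) sk (half (x i) * y i - y i * half (x i)).
  apply: (@half_inj R A); rewrite -big_split /=.
  have -> : h + h = sk h by rewrite /sk sh opprK.
  have sk0 : sk (0 : calg A) = 0 by rewrite /sk star0 subrr.
  have -> : sk h = \sum_(i < m) sk (commutator (x i) (y i)).
    by rewrite [in LHS]hE (big_morph (@sk R A) (@skD R A) sk0).
  apply: eq_bigr => i _; rewrite -skD /commutator; congr sk.
  rewrite -{1 2}(half_add (x i)); move: (half (x i)) (y i) => a b; nc_ring.
have hi i : conj_dec n ((D * C + 1) * rnorm h) N (sk (half (x i) * y i - y i * half (x i))).
  apply: Dec_le (hD (half (x i)) (y i)); rewrite rnorm_half.
  have h1 := xy i; have h2 : 0 <= rnorm (x i) * rnorm (y i) by rewrite mulr_ge0 ?rnorm_ge0.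
  have h3 := rnorm_ge0 h.
  have h4 : D * (rnorm (x i) * rnorm (y i)) <= D * (C * rnorm h) by rewrite ler_wpM2l.
  have h5 : 0 <= D * (rnorm (x i) * rnorm (y i)) by rewrite mulr_ge0.
  lra.
have gen k (F : 'I_k -> calg A) (c : R) : (forall i, conj_dec n c N (F i)) ->
    conj_dec n c (k * N) (\sum_(i < k) F i).
  elim: k F => [|k IH] F hF; first by rewrite big_ord0 mul0n; exact: Dec0.
  by rewrite big_ord_recl mulSn; apply: DecD => //; exact: IH.
rewrite [X in conj_dec _ _ _ X]hS; exact: gen.
Qed.
End FullDecomposition.

(** * Products of conjugates in SU_0(A) *)

Section GroupExp.
Variables (R : realType) (A : cstarAlgType R).
Local Notation G := (SU0_group A).
Local Notation U := (unitary_group A).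
Local Notation alg := (@SU0_to_alg R A).
Implicit Types (u v : G) (x l h : calg A).

Lemma alg_inj : injective alg.
Proof. by move=> u v /val_inj/val_inj. Qed.
Lemma algM u v : alg (u * v)%g = alg u * alg v.
Proof. by []. Qed.
Lemma algV u : alg u^-1%g = star (alg u).
Proof. by []. Qed.
Lemma alg_unitary u : unitary (alg u).
Proof. exact: set_mem (valP (SU0_val u)). Qed.


Lemma cexp_unitary l : star l = - l -> unitary (cexp l).
Proof. by move=> sl; rewrite /unitary /= cexp_star sl cexpN cexpNl. Qed.

Lemma skewZ (t : R) l : star l = - l -> star (t%:C *: l) = - (t%:C *: l).
Proof. by move=> sl; rewrite starZr sl scalerN. Qed.

Definition uexp l (sl : star l = - l) : U := SigSub (mem_set (cexp_unitary sl)).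

Lemma uexp_U0 l (sl : star l = - l) : U0 (uexp sl).
Proof.
pose f (t : R) : U := uexp (skewZ t sl).
have cf : continuous f.
  apply: continuous_comp_initial => t; apply/cvgrPdist_lt => e e0.
  have er : e = (complex.Re e)%:C by rewrite RRe_real // gtr0_real.
  have e0' : 0 < complex.Re e by rewrite -ltcR -er.
  have n0 := rnorm_ge0 l; pose k := rnorm l + 1.
  have k0 : 0 < k by rewrite /k; lra.
  pose d := Num.min (2^-1 / k) (complex.Re e / (2 * k)).
  have d0 : 0 < d by rewrite lt_min !divr_gt0 // mulr_gt0.
  near=> s; rewrite /= (rnormE (cexp (t%:C *: l) - cexp (s%:C *: l))) er ltcR.
  have ts : `|s - t| < d by rewrite distrC; near: s; apply/nbhs_ballP; exists d.
  have -> : cexp (t%:C *: l) - cexp (s%:C *: l) =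
      - (cexp (t%:C *: l) * (cexp ((s - t)%:C *: l) - 1)).
    rewrite mulrBr mulr1 -cexpD; last by rewrite -!scalerAl -!scalerAr !scalerA mulrC.
    by rewrite -scalerDl -rmorphD /= addrCA subrr addr0 opprB.
  rewrite rnormN; apply: le_lt_trans (rnormM _ _) _.
  rewrite (rnorm_unitary (cexp_unitary (skewZ t sl))) mul1r.
  have nz : rnorm ((s - t)%:C *: l) = `|s - t| * rnorm l by rewrite rnormZ.
  have h1 : `|s - t| * k < 2^-1.
    by rewrite -ltr_pdivlMr //; apply: lt_le_trans ts _; rewrite ge_min lexx.
  have h2 : `|s - t| * (2 * k) < complex.Re e.
    by rewrite -ltr_pdivlMr ?mulr_gt0 //; apply: lt_le_trans ts _; rewrite ge_min lexx orbT.
  have a0 := normr_ge0 (s - t); have hk : `|s - t| * rnorm l <= `|s - t| * k.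
    by rewrite ler_wpM2l // /k; lra.
  have nb : rnorm ((s - t)%:C *: l) <= 2^-1 by rewrite nz; lra.
  have := exp_near nb (lexx _); have := rnormD (cexp ((s - t)%:C *: l) - 1 - (s - t)%:C *: l) ((s - t)%:C *: l).
  rewrite subrK nz; lra.
have cc : connected (range f).
  apply: connected_continuous_connected; first by apply/connected_intervalP.
  exact: continuous_subspaceT.
have f0 : f 0 = 1%g by apply: val_inj; rewrite /= rmorph0 scale0r cexp0.
have f1 : f 1 = uexp sl by apply: val_inj; rewrite /= rmorph1 scale1r.
rewrite /U0 -f1; apply: (connected_component_max _ _ cc) => //.
  by exists 0.
Unshelve. all: by end_near.
Qed.

Hypothesis span_closed : closed (@commutator_span R A).

Lemma conj_i : Num.conj ('i : R[i]) = - 'i.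
Proof. by apply/eqP; rewrite eq_complex /= oppr0 !eqxx. Qed.

Lemma Lskew_selfadjoint l : Lskew l -> selfadjoint_comm (- 'i *: l) /\ 'i *: (- 'i *: l) = l.
Proof.
move=> [cl sl]; split; last by rewrite scalerA mulrN -expr2 sqrCi opprK scale1r.
split; first by apply: subset_closure; exact: spanZ.
by rewrite starZ sl rmorphN /= conj_i opprK scalerN scaleNr.
Qed.
Lemma selfadjoint_Lskew h : selfadjoint_comm h -> Lskew ('i *: h) /\ rnorm ('i *: h) = rnorm h.
Proof.
move=> [ch sh]; split; last by rewrite rnormZc normCi /= mul1r.
split; last by rewrite starZ sh conj_i scaleNr.
by apply: spanZ; move: ch; rewrite -(closure_id _).1.
Qed.

Lemma expG l : Lskew l -> exists u, alg u = cexp l.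
Proof.
move=> Ll; have [_ sl] := Ll; have [sa iE] := Lskew_selfadjoint Ll.
have S : uexp sl \in @SU0 R A.
  apply: mem_set => H _; apply; split; first exact: uexp_U0.
  by exists (- 'i *: l) => //; rewrite iE.
by exists (SU0Elem S).
Qed.

(** The generated subgroup is an intersection, so it suffices that finite products form a subgroup
    containing the generators; an inverse is the reversed word with opposite signs. *)
Lemma exp_word u : exists ls : seq (calg A),
  (forall l, l \in ls -> Lskew l) /\ alg u = \prod_(l <- ls) cexp l.
Proof.
have := set_mem (valP u) => /(_ [set v : U | exists ls : seq (calg A),
  (forall l, l \in ls -> Lskew l) /\ val v = \prod_(l <- ls) cexp l]); apply.
  split.
  - by exists [::]; split=> //; rewrite big_nil.
  - move=> x y [s [Ls xE]] [t [Lt yE]]; exists (s ++ t); split.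
      by move=> l; rewrite mem_cat => /orP[/Ls|/Lt].
    by rewrite big_cat /= -xE -yE.
  - move=> x [s [Ls xE]]; exists (rev [seq - l | l <- s]); split.
      move=> l; rewrite mem_rev => /mapP[m ms ->]; exact: LskewN (Ls _ ms).
    have -> : val x^-1%g = star (val x) by [].
    rewrite xE; elim: s Ls {xE} => [|l s IH] Ls; first by rewrite !big_nil star1.
    rewrite big_cons starM map_cons rev_cons -cats1 big_cat big_seq1 /= IH.
      by rewrite cexp_star; have [_ ->] := Ls l (mem_head _ _).
    by move=> m ms; apply: Ls; rewrite inE ms orbT.
move=> v [_ [h sh vE]]; have [Lh _] := selfadjoint_Lskew sh.
exists [:: 'i *: h]; split; first by move=> l; rewrite inE => /eqP ->.
by rewrite big_seq1.
Qed.

Lemma wordG (ls : seq (calg A)) : (forall l, l \in ls -> Lskew l) ->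
  exists u, alg u = \prod_(l <- ls) cexp l.
Proof.
elim: ls => [|l s IH] Ls; first by exists 1%g; rewrite big_nil.
have [u uE] := expG (Ls l (mem_head _ _)).
have [v vE] : exists v, alg v = \prod_(l <- s) cexp l.
  by apply: IH => m ms; apply: Ls; rewrite inE ms orbT.
by exists (u * v)%g; rewrite big_cons algM uE vE.
Qed.
End GroupExp.

Section SetPower.
Variable G : groupType.
Implicit Types (X : set G) (x y : G).
Local Open Scope group_scope.

Lemma setprod_pow0 X : setprod_pow X 0 1.
Proof. by exists (fun=> 1); split=> [[]//|]; rewrite big_ord0. Qed.
Lemma setprod_powM X n m x y : setprod_pow X n x -> setprod_pow X m y ->
  setprod_pow X (n + m) (x * y).
Proof.
move=> [t [Xt ->]] [t' [Xt' ->]].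
exists (fun i => match fintype.split i with inl j => t j | inr j => t' j end); split.
  by move=> i; case: (fintype.split i).
rewrite big_split_ord /=; congr (_ * _); apply: eq_bigr => i _.
  by rewrite (unsplitK (inl i)).
by rewrite (unsplitK (inr i)).
Qed.
Lemma setprod_pow1 X x : X x -> setprod_pow X 1 x.
Proof. by move=> Xx; exists (fun=> x); split=> //; rewrite big_ord1. Qed.

Lemma conjugates_conj (g h x : G) : conjugates g x -> conjugates g (h * x * h^-1).
Proof.
move=> [k [->|->]]; exists (h * k); [left|right]; by rewrite invgM !mulgA.
Qed.
Lemma setprod_pow_conj (g h x : G) n : setprod_pow (conjugates g) n x ->
  setprod_pow (conjugates g) n (h * x * h^-1).
Proof.
move=> [t [Xt ->]]; exists (fun i => h * t i * h^-1); split.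
  by move=> i; exact: conjugates_conj.
elim: n t {Xt} => [|n IH] t; first by rewrite !big_ord0 mulg1 mulgV.
by rewrite !big_ord_recl -IH !mulgA mulgVK.
Qed.
End SetPower.

Section Core.
Variables (R : realType) (A : cstarAlgType R).
Hypothesis A_simple : simple_cstar A.
Hypothesis A_bcg : bounded_commutators_generation A.
Let span_closed : closed (@commutator_span R A) := A_bcg.1.
Local Notation G := (SU0_group A).
Local Notation alg := (@SU0_to_alg R A).
Implicit Types (u v w : G) (x y l h : calg A) (ls : seq (calg A)).
Let LK := @Lskew_closed R A span_closed.
Let L0 := @Lskew0 R A.
Let LD := @LskewD R A.
Let LZ := @LskewZ R A.
Let LB := @Lskew_br R A.

Lemma Lskew_conj l x : Lskew l -> Lskew x -> Lskew (cexp l * x * cexp (- l)).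
Proof.
move=> [_ sl] [[n [c [a [b xE]]]] sx]; split; last first.
  by rewrite !starM !cexp_star starN sl sx opprK mulNr mulrN mulrA.
exists n, c, (fun i => cexp l * a i * cexp (- l)), (fun i => cexp l * b i * cexp (- l)).
rewrite xE mulr_sumr mulr_suml; apply: eq_bigr => i _.
rewrite -scalerAr -scalerAl; congr (_ *: _); rewrite /commutator.
have e (p q : calg A) : cexp l * p * cexp (- l) * (cexp l * q * cexp (- l)) = cexp l * (p * q) * cexp (- l).
  have -> : cexp l * p * cexp (- l) * (cexp l * q * cexp (- l)) =
    cexp l * p * (cexp (- l) * cexp l) * q * cexp (- l) by nc_ring.
  by rewrite cexpNl mulr1 !mulrA.
by rewrite !e; nc_ring.
Qed.
Lemma rnorm_conj l x : Lskew l -> rnorm (cexp l * x * cexp (- l)) <= rnorm x.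
Proof.
move=> Ll; have [_ s1] := Ll; have [_ s2] := LskewN Ll.
apply: le_trans (rnormM _ _) _; rewrite (rnorm_unitary (cexp_unitary s2)) mulr1.
by apply: le_trans (rnormM _ _) _; rewrite (rnorm_unitary (cexp_unitary s1)) mul1r.
Qed.
Lemma algV_exp v l : Lskew l -> alg v = cexp l -> alg v^-1%g = cexp (- l).
Proof. by move=> [_ sl] vE; rewrite algV vE cexp_star sl. Qed.

Section Fixed.
Variables (g : G) (lam : R[i]) (n kap : nat -> calg A).
Hypothesis cut : cutoffs (alg g) 19 lam n kap.
Local Notation X := (setprod_pow (conjugates g)).

Lemma offdiag_at_Lskew i x : offdiag_at n i x -> Lskew x.
Proof.
apply: offdiag_Lskew; [exact: cut_sa cut i|exact: star_far cut _|].
exact: near_far cut _ _ (ltnSn i).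
Qed.

Lemma small_off_word i : exists2 e : R, 0 < e & forall c u, offdiag_at n i c -> rnorm c <= e ->
  alg u = cexp c -> X 2 u.
Proof.
have gu := alg_unitary g.
have Qg : (1 - n i.+1) * alg g = alg g * (1 - n i.+1).
  by rewrite mulrBl mulrBr mul1r mulr1 (cut_comm cut).
have kQ : kap i * (1 - n i.+1) = (1 - n i.+1) * kap i.
  by rewrite mulrBl mulrBr mul1r mulr1 (cut_kapn cut).
have [e e0 he] := small_exp gu (cut_sa cut i) (star_far cut i.+1) (near_far cut (ltnSn i))
  (cut_comm cut i) Qg (cut_norm cut i) kQ (cut_kap cut i) (cut_near cut i).
exists e => // c u oc ce uE; have [a oa cE] := he c oc ce.
have La : Lskew (half a) by apply: LZ; exact: offdiag_at_Lskew oa.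
have [v vE] := expG La.
(* With v = e^(a/2), the factor g e^a g^-1 of [Fexp a] splits as (g v) (v g^-1), leaving one
   conjugate of g and one of its inverse. *)
have -> : u = (v^-1 * g * (v^-1)^-1 * (v * g^-1 * v^-1))%g.
  apply: alg_inj; rewrite uE cE invgK /Fexp -(conjg_cexp gu) -{2}(half_add a).
  rewrite cexpD // !algM (algV_exp La vE) vE algV; nc_ring.
apply: (setprod_powM (n := 1) (m := 1)); apply: setprod_pow1.
  by exists (v^-1)%g; left.
by exists v; right.
Qed.

Lemma small_off_words m : exists2 e : R, 0 < e & forall i c u, (i < m)%N ->
  offdiag_at n i c -> rnorm c <= e -> alg u = cexp c -> X 2 u.
Proof.
elim: m => [|m [e e0 he]]; first by exists 1.
have [d d0 hd] := small_off_word m; exists (Num.min e d); first by rewrite lt_min e0 d0.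
move=> i c u; rewrite ltnS leq_eqVlt le_min => /orP[/eqP ->|im] oc /andP[ce cd] uE.
  exact: hd oc cd uE.
exact: he im oc ce uE.
Qed.

(** By induction on the summands, [rouviere] turns e^(x + y) into conjugates of e^x and e^y by group
    elements, and powers of the conjugates of g are stable under conjugation. N c <= 2^-20 keeps
    every partial sum within the range of [rouviere]. *)
Lemma Dec_word (e c : R) N x : 0 <= c ->
  (forall i o u, (i < 19)%N -> offdiag_at n i o -> rnorm o <= e -> alg u = cexp o -> X 2 u) ->
  conj_dec n c N x -> c <= e -> N%:R * c <= 2 ^- 20 ->
  [/\ Lskew x, rnorm x <= N%:R * c & forall u, alg u = cexp x -> X (N * 2) u].
Proof.
move=> c0 he; elim=> [_ _|{}N {}x l o _ IH Ll [i i9 [oo os]] ce Nc].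
  split; rewrite ?rnorm0 ?mul0r // => u uE.
  have -> : u = 1%g by apply: alg_inj; rewrite uE cexp0.
  exact: setprod_pow0.
have N1 : N.+1%:R = N%:R + 1 :> R by rewrite -natr1.
rewrite N1 in Nc *; have [|Lx xN Xx] := IH ce; first by lra.
set y := cexp l * o * cexp (- l).
have Lo := offdiag_at_Lskew oo; have Ly : Lskew y by exact: Lskew_conj.
have yN : rnorm y <= c by apply: le_trans os; exact: rnorm_conj.
split; first exact: LD.
  by apply: le_trans (rnormD _ _) _; lra.
move=> u uE.
have N0 : 0 <= N%:R * c by rewrite mulr_ge0.
have xk : rnorm x <= (N%:R + 1) * c by lra.
have yk : rnorm y <= (N%:R + 1) * c by lra.
have [a [b [La Lb E]]] := rouviere LK L0 LD LZ LB Lx Ly xk yk Nc.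
have [ua uaE] := expG La; have [ub ubE] := expG Lb.
have [ux uxE] := expG Lx; have [uo uoE] := expG Lo.
have [ul ulE] := expG Ll.
have -> : u = ((ua * ux * ua^-1) * (ub * (ul * uo * ul^-1) * ub^-1))%g.
  apply: alg_inj; rewrite uE E !algM (algV_exp La uaE) (algV_exp Lb ubE) (algV_exp Ll ulE).
  by rewrite uaE ubE uxE uoE ulE /y -(cexp_conj _ (cexpN l) (cexpNl l)).
rewrite mulSn addnC; apply: setprod_powM; first exact/setprod_pow_conj/Xx.
by do 2 apply: setprod_pow_conj; exact: he i9 oo (le_trans os ce) uoE.
Qed.

Lemma exp_in_pow : exists m (e : R), 0 < e /\
  forall l u, Lskew l -> rnorm l <= e -> alg u = cexp l -> X m u.
Proof.
have [N [C [C0 hD]]] := Lskew_dec A_simple cut A_bcg.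
have [e e0 he] := small_off_words 19.
(* The first bound keeps the off-diagonal pieces below e, the second meets the condition of
   [Dec_word]; N + 1 avoids a zero denominator. *)
pose d := Num.min (e / C) (2 ^- 20 / ((N%:R + 1) * C)).
have N0 : 0 <= N%:R :> R by [].
have NC : 0 < (N%:R + 1) * C by rewrite mulr_gt0 //; lra.
have d0 : 0 < d by rewrite lt_min !divr_gt0 // invr_gt0 exprn_gt0.
exists (N * 2)%N, d; split=> // l u Ll ld uE.
have c0 : 0 <= C * rnorm l by rewrite mulr_ge0 ?rnorm_ge0 // ltW.
have ce : C * rnorm l <= e.
  by rewrite mulrC -ler_pdivlMr //; apply: le_trans ld _; rewrite ge_min lexx.
have Nc : N%:R * (C * rnorm l) <= 2 ^- 20.
  apply: (@le_trans _ _ (rnorm l * ((N%:R + 1) * C))).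
    have -> : rnorm l * ((N%:R + 1) * C) = N%:R * (C * rnorm l) + C * rnorm l by ring.
    by rewrite lerDl.
  by rewrite -ler_pdivlMr //; apply: le_trans ld _; rewrite ge_min lexx orbT.
by have [_ _] := Dec_word c0 he (hD l Ll) ce Nc; apply.
Qed.
End Fixed.

Definition total ls : R := \sum_(l <- ls) rnorm l.
Definition all_skew ls := forall l, l \in ls -> Lskew l.

Lemma total_ge0 ls : 0 <= total ls.
Proof. by apply: sumr_ge0 => l _; exact: rnorm_ge0. Qed.

Lemma total_cons l ls : total (l :: ls) = rnorm l + total ls.
Proof. by rewrite /total big_cons. Qed.

Lemma all_skew_cons l ls : all_skew (l :: ls) <-> Lskew l /\ all_skew ls.
Proof.
split=> [h|[Ll h] m].
  by split=> [|m ms]; apply: h; rewrite inE ?eqxx // ms orbT.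
by rewrite inE => /orP[/eqP ->|/h].
Qed.

(** Iterating the factor 192 of [bch] would be useless for long words. Instead |e^l - 1| is carried
    along, which is subadditive because the factors are unitary; [bch] only has to give |m| <= 1/4,
    after which |m| <= 2 |e^m - 1|. *)
Lemma word_log ls : all_skew ls -> total ls <= 2 ^- 24 ->
  exists l, [/\ Lskew l, \prod_(m <- ls) cexp m = cexp l, rnorm l <= 4 * total ls &
    rnorm (cexp l - 1) <= 2 * total ls].
Proof.
elim: ls => [_ _|h ls IH /all_skew_cons[Lh Ls]].
  by exists 0; rewrite /total !big_nil cexp0 subrr rnorm0 mulr0; split=> //; exact: L0.
rewrite total_cons => tot.
have t0 := total_ge0 ls; have h0 := rnorm_ge0 h.
have [|l [Ll lE l4 l2]] := IH Ls; first by lra.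
have hk : rnorm h <= 2 ^- 20 by lra.
have lk : rnorm l <= 2 ^- 20 by lra.
have [m [Lm mn mE]] := bch LK L0 LD LZ LB Lh Ll hk lk (lexx _).
have m4 : rnorm m <= 4^-1.
  apply: le_trans mn _; lra.
have h2 : rnorm h <= 2^-1 by lra.
have eh : rnorm (cexp h - 1) <= 2 * rnorm h.
  have := exp_near h2 (lexx _); have := rnormD (cexp h - 1 - h) h; rewrite subrK; lra.
have em : rnorm (cexp m - 1) <= 2 * (rnorm h + total ls).
  have -> : cexp m - 1 = cexp h * (cexp l - 1) + (cexp h - 1) by rewrite -mE; nc_ring.
  apply: le_trans (rnormD _ _) _.
  have := rnormM (cexp h) (cexp l - 1); have [_ sh] := Lh.
  rewrite (rnorm_unitary (cexp_unitary sh)) mul1r; lra.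
exists m; rewrite big_cons lE mE; split=> //.
have q2 : 4^-1 <= 2^-1 :> R by lra.
have := exp_near m4 q2; have := rnormB (cexp m - 1) (cexp m - 1 - m).
rewrite (_ : cexp m - 1 - (cexp m - 1 - m) = m); last by nc_ring.
have := rnorm_ge0 m; lra.
Qed.

Lemma split_word ls (s : R) : all_skew ls -> 0 <= s -> s <= total ls -> exists l1 l2 : seq (calg A),
  [/\ all_skew l1, all_skew l2, total l1 = s, total l2 = total ls - s &
   \prod_(l <- ls) cexp l = (\prod_(l <- l1) cexp l) * (\prod_(l <- l2) cexp l)].
Proof.
elim: ls s => [|h ls IH] s.
  have tn : total [::] = 0 by rewrite /total big_nil.
  rewrite tn => _ s0 s1; have se : s = 0 by apply/eqP; rewrite eq_le s0 s1.
  by exists [::], [::]; rewrite !big_nil mulr1 tn se subr0.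
move=> /all_skew_cons[Lh Ls] s0; rewrite total_cons => st.
have h0 := rnorm_ge0 h.
have [sh|hs] := leP s (rnorm h).
  (* If the norm of h is 0, then s is 0 as well and the quotient has the default value 0, which is
     the right one. *)
  pose k := s / rnorm h.
  have kh : k * rnorm h = s.
    have [hz|hn] := eqVneq (rnorm h) 0; first by rewrite hz mulr0; lra.
    by rewrite /k divfK.
  have k01 : 0 <= k <= 1.
    rewrite /k divr_ge0 //=; have [->|hn] := eqVneq (rnorm h) 0; first by rewrite invr0 mulr0.
    by rewrite ler_pdivrMr ?mul1r // lt_neqAle eq_sym hn h0.
  have /andP[k0 k1] := k01.
  exists [:: k%:C *: h], ((1 - k)%:C *: h :: ls); split.
  - by apply/all_skew_cons; split=> //; exact: LZ.
  - by apply/all_skew_cons; split=> //; exact: LZ.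
  - by rewrite /total big_seq1 rnormZ ger0_norm.
  - rewrite total_cons rnormZ ger0_norm ?subr_ge0 //.
    by rewrite -kh; ring.
  - rewrite big_seq1 !big_cons mulrA -cexpD; last by rewrite -!scalerAl -!scalerAr !scalerA mulrC.
    by rewrite -scalerDl -rmorphD /= addrCA subrr addr0 rmorph1 scale1r.
have [l1 [l2 [L1 L2 t1 t2 E]]] := IH (s - rnorm h) Ls ltac:(by rewrite subr_ge0 ltW) ltac:(by rewrite lerBlDl).
exists (h :: l1), l2; split=> //.
- by apply/all_skew_cons.
- by rewrite total_cons t1 addrC subrK.
- by rewrite t2; ring.
- by rewrite !big_cons E mulrA.
Qed.

Lemma words_in_pow (g : G) : ~ Defs.center g -> exists m (e : R), 0 < e /\
  forall j ls u, all_skew ls -> total ls <= j.+1%:R * e -> alg u = \prod_(l <- ls) cexp l ->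
    setprod_pow (conjugates g) (j.+1 * m) u.
Proof.
move=> ng; have [w gw] : exists w, alg g * alg w <> alg w * alg g.
  apply: contrapT => nex; apply: ng => x; apply: alg_inj; rewrite !algM.
  by apply: contrapT => h; apply: nex; exists x.
have [lam [n [kap cut]]] := cutoffs_exist (alg_unitary g) 19 gw.
have [m [e [e0 he]]] := exp_in_pow cut.
pose d := Num.min (e / 4) (2 ^- 24).
have d0 : 0 < d by rewrite lt_min divr_gt0 // invr_gt0 exprn_gt0.
have d1 : 4 * d <= e by rewrite mulrC -ler_pdivlMr // ge_min lexx.
have d2 : d <= 2 ^- 24 by rewrite ge_min lexx orbT.
have base ls u : all_skew ls -> total ls <= d -> alg u = \prod_(l <- ls) cexp l ->
    setprod_pow (conjugates g) m u.
  move=> Ls ld uE; have [l [Ll lE l4 _]] := word_log Ls (le_trans ld d2).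
  by apply: (he l) => //; [lra|rewrite uE lE].
exists m, d; split=> // j; elim: j => [|j IH] ls u Ls.
  by rewrite mul1r mul1n; exact: base.
(* A word already short enough is padded with the empty word, so that the number of factors is
   exactly j.+2 * m. *)
have [ld _|ld lt] := leP (total ls) d.
  move=> uE; rewrite mulSn -[u]mulg1; apply: setprod_powM; first exact: base uE.
  have := IH [::] 1%g; rewrite /total !big_nil; apply=> //.
  by rewrite mulr_ge0 // ltW.
move=> uE; have [l1 [l2 [L1 L2 t1 t2 E]]] := split_word Ls (ltW d0) (ltW ld).
have [u1 u1E] := wordG L1; have [u2 u2E] := wordG L2.
have -> : u = (u1 * u2)%g by apply: alg_inj; rewrite uE E algM u1E u2E.
rewrite mulSn; apply: setprod_powM; first by apply: base L1 _ u1E; rewrite t1.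
apply: IH L2 _ u2E; rewrite t2.
have e2 : j.+2%:R = j.+1%:R + 1 :> R by rewrite -natr1.
by move: lt; rewrite e2 mulrDl mul1r; lra.
Qed.
End Core.

(** * Passage to the quotient by the center *)

Section Quotient.
Variables (R : realType) (A : cstarAlgType R).
Hypothesis A_simple : simple_cstar A.
Hypothesis A_bcg : bounded_commutators_generation A.
Local Notation G := (SU0_group A).
Local Notation Q := (center_quotient G).
Local Notation alg := (@SU0_to_alg R A).
Local Notation pi := (\pi_Q%qT : G -> Q).
Implicit Types (u v w g : G) (q : Q).
Local Open Scope group_scope.
Let span_closed : closed (@commutator_span R A) := A_bcg.1.

Lemma piM u v : pi (u * v) = pi u * pi v.
Proof. exact: center_quotientM. Qed.
Lemma piV u : pi u^-1 = (pi u)^-1.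
Proof. exact/esym/center_quotient_invE. Qed.
Lemma pi1 : pi 1 = 1. Proof. by []. Qed.
Lemma pi_surj q : exists u, pi u = q.
Proof. by exists (repr q); rewrite reprK. Qed.

Lemma setprod_pow_pi g n u : setprod_pow (conjugates g) n u ->
  setprod_pow (conjugates (pi g)) n (pi u).
Proof.
move=> [t [Xt ->]]; exists (fun i => pi (t i)); split.
  move=> i; have [h [->|->]] := Xt i; exists (pi h).
    by left; rewrite !piM piV.
  by right; rewrite !piM !piV.
by rewrite (big_morph pi piM pi1).
Qed.

Lemma noncentral_pi g : pi g <> 1 -> ~ Defs.center g.
Proof.
move=> g1 cg; apply: g1; apply/esym/center_quotient_eqP.
by rewrite invg1 mul1g.
Qed.

Lemma normal_setprod_pow (N : set Q) q n x : normal_subgroup N -> N q ->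
  setprod_pow (conjugates q) n x -> N x.
Proof.
move=> [[N1 NM NV] NJ] Nq [t [Xt ->]].
elim: n t Xt => [|n IH] t Xt; first by rewrite big_ord0.
rewrite big_ord_recl; apply: NM; last exact: IH.
by have [h [->|->]] := Xt ord0; apply: NJ => //; exact: NV.
Qed.

Lemma total_le_mul (e : R) (ls : seq (calg A)) : (0 < e)%R -> exists j, (total ls <= j.+1%:R * e)%R.
Proof.
move=> e0; exists (Num.bound (total ls / e)); rewrite -ler_pdivrMr //.
apply: (@le_trans _ _ (Num.bound (total ls / e))%:R%R); last by rewrite ler_nat.
by apply/ltW; rewrite archi_boundP // divr_ge0 ?total_ge0 // ltW.
Qed.

Lemma center_quotient_simple : simple_group Q.
Proof.
move=> N NN; have [[N1 _ _] _] := NN.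
have [[q [Nq q1]]|nq] := pselect (exists q, N q /\ q <> 1); [right|left]; last first.
  apply/seteqP; split=> [x Nx|_ -> //] /=.
  by apply: contrapT => x1; apply: nq; exists x.
apply/seteqP; split=> // p _; have [u <-] := pi_surj p.
have [g gq] := pi_surj q; rewrite -gq in q1 Nq.
have [m [e [e0 he]]] := words_in_pow A_simple A_bcg (noncentral_pi q1).
have [ls [Ls uE]] := exp_word span_closed u.
have [j tj] := total_le_mul ls e0.
exact: normal_setprod_pow NN Nq (setprod_pow_pi (he j ls u Ls tj uE)).
Qed.

(** [bch] keeps the logarithm of a product in [A, A] with norm at most 192 d, below e for d <= e /
    200. It is what makes the basic sets neighborhoods in the topology built from their
    translates. *)
Lemma nbhs1_mul (e : R) : (0 < e)%R -> exists2 d : R, (0 < d)%R &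
  forall v w, SU0_nbhs1 d v -> SU0_nbhs1 d w -> SU0_nbhs1 e (v * w).
Proof.
move=> e0; pose d : R := Num.min (2 ^- 20)%R (e / 200)%R.
have d0 : (0 < d)%R by rewrite lt_min invr_gt0 exprn_gt0 //= divr_gt0.
have d1 : (d <= 2 ^- 20)%R by rewrite ge_min lexx.
have d2 : (d * 200 <= e)%R by rewrite -ler_pdivlMr // ge_min lexx orbT.
exists d => // v w [h [sh hd vE]] [k [sk' kd wE]].
have [Lh nh] := selfadjoint_Lskew span_closed sh.
have [Lk nk] := selfadjoint_Lskew span_closed sk'.
rewrite -nh in hd; rewrite -nk in kd.
have [l [Ll ln lE]] := bch (@Lskew_closed R A span_closed) (@Lskew0 R A) (@LskewD R A)
  (@LskewZ R A) (@Lskew_br R A) Lh Lk (ltW hd) (ltW kd) d1.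
have [sl iE] := Lskew_selfadjoint Ll; have [_ nl] := selfadjoint_Lskew span_closed sl.
exists (- 'i *: l)%R; split=> //; last by rewrite algM vE wE lE iE.
rewrite -nl iE; apply: le_lt_trans ln _; lra.
Qed.

(** If x differs from u in V by a central element, that element commutes past v, so x * v and u * v
    have the same image. *)
Lemma open_pi (V : set G) : SU0_open V -> open (pi @` V).
Proof.
move=> oV; rewrite -[open _]/(SU0_open (pi @^-1` (pi @` V))) => x [u Vu ux].
have [e e0 eV] := oV u Vu; exists e => // v hv.
exists (u * v); first exact: eV.
move/center_quotient_eqP: ux => cz; apply/center_quotient_eqP.
have -> : (u * v)^-1 * (x * v) = v^-1 * ((u^-1 * x) * v) by rewrite invgM !mulgA.
by rewrite cz mulKg.
Qed.

Lemma center_quotient_local : local_bounded_normal_generation Q.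
Proof.
move=> q; have [g <-] := pi_surj q => q1.
have [m [e [e0 he]]] := words_in_pow A_simple A_bcg (noncentral_pi q1).
exists (1 * m)%N.
pose S0 := setprod_pow (conjugates g) (1 * m).
(* The interior of S0; [nbhs1_mul] is what makes it open. *)
pose V : set G := [set u | exists2 d : R, (0 < d)%R & forall v, SU0_nbhs1 d v -> S0 (u * v)].
have one_nbhs (d : R) : (0 < d)%R -> SU0_nbhs1 d (1 : G).
  move=> d0; exists 0%R; split; rewrite ?rnorm0 //; last by rewrite scaler0 cexp0.
  by split; [apply: subset_closure; exact: span0|rewrite star0].
have oV : SU0_open V.
  move=> u [d d0 hd]; have [b b0 hb] := nbhs1_mul d0; exists b => // v hv.
  exists b => // w hw; rewrite -mulgA; apply: hd; exact: hb.
have V1 : V 1.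
  exists e => // v [h [sh hd vE]]; rewrite mul1g.
  have [Lh nh] := selfadjoint_Lskew span_closed sh.
  apply: (he 0%N [:: 'i *: h]%R); last by rewrite big_seq1.
    by move=> l; rewrite inE => /eqP ->.
  by rewrite /total big_seq1 nh mul1r ltW.
have VS : V `<=` S0.
  by move=> u [d d0 hd]; rewrite -[u]mulg1; apply: hd; exact: one_nbhs.
have ob : open_nbhs (1 : Q) (pi @` V) by split; [exact: open_pi|exists 1].
apply: filterS (open_nbhs_nbhs ob) => _ [u Vu <-].
by apply: setprod_pow_pi; exact: VS.
Qed.

Lemma center_quotient_bounded : SU0_metric_bounded A -> bounded_normal_generation Q.
Proof.
move=> [M hM]; split; first exact: center_quotient_simple.
move=> q; have [g <-] := pi_surj q => q1.
have [m [e [e0 he]]] := words_in_pow A_simple A_bcg (noncentral_pi q1).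
have [j hj] : exists j, (M + 1 <= j.+1%:R * e)%R.
  exists (Num.bound ((`|M| + 1) / e)); rewrite -ler_pdivrMr //.
  apply: (@le_trans _ _ (Num.bound ((`|M| + 1) / e))%:R%R); last by rewrite ler_nat.
  apply: (@le_trans _ _ ((`|M| + 1) / e))%R.
    by rewrite ler_wpM2r ?invr_ge0 ?(ltW e0) // lerD2r ler_norm.
  by apply/ltW; rewrite archi_boundP // divr_ge0 ?addr_ge0 // ltW.
exists (j.+1 * m)%N; apply/seteqP; split=> // p _; have [u <-] := pi_surj p.
apply: setprod_pow_pi.
have := hM 1 u; rewrite /SU0_dist invg1 mul1g /exp_length.
set E := [set l | _] => iM.
(* The infimum is meaningful only for a nonempty set, and [exp_word] supplies a member. It need not
   be attained, so a word of length below the infimum plus 1 is taken; this is the 1 in M + 1. *)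
have E0 : has_inf E.
  split; last first.
    by exists 0%R => _ [hs [_ _ ->]]; apply: sumr_ge0 => h _; exact: rnorm_ge0.
  have [ls [Ls uE]] := exp_word span_closed u.
  exists (\sum_(h <- [seq - 'i *: l | l <- ls]) rnorm h)%R.
  exists [seq (- 'i *: l)%R | l <- ls]; split=> //.
    by move=> h /mapP[l ls_l ->]; have [] := Lskew_selfadjoint (Ls l ls_l).
  rewrite uE big_map; apply: eq_big_seq => l ls_l.
  by have [_ ->] := Lskew_selfadjoint (Ls l ls_l).
have [_ [hs [sh uE ->]] tE] := inf_adherent ltr01 E0.
apply: (he j [seq 'i *: h | h <- hs]%R).
- by move=> l /mapP[h hsh ->]; have [] := selfadjoint_Lskew span_closed (sh h hsh).
- rewrite /total big_map (eq_big_seq (fun h => rnorm h)); last first.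
    by move=> h hsh; have [_] := selfadjoint_Lskew span_closed (sh h hsh).
  by apply: le_trans (ltW tE) _; apply: le_trans hj; rewrite lerD2r.
- by rewrite uE big_map.
Qed.
End Quotient.

Theorem theorem3 (R : realType) (A : cstarAlgType R)
    (A_simple : simple_cstar A)
    (A_bcg : bounded_commutators_generation A) :
  (simple_group (center_quotient (SU0_group A)) /\
   local_bounded_normal_generation (center_quotient (SU0_group A))) /\
  (SU0_metric_bounded A ->
   bounded_normal_generation (center_quotient (SU0_group A))).
Proof.
split; last exact: center_quotient_bounded.
by split; [exact: center_quotient_simple|exact: center_quotient_local].
Qed.
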